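(* Let $E$ be the unique real number $\sigma>1$ satisfying $\frac{2^{\sigma+1}}{4^\sigma-1}\log 2=-\frac{\zeta'(\sigma)}{\zeta(\sigma)}$ (so $E=2.813014\dots$). Then every turning point $b=\sigma+it$ of $\zeta(s)$ satisfies $\sigma\le E$, and there is a sequence $(b_k)$ of turning points of $\zeta(s)$ with $\lim_k \mathrm{Re}(b_k)=E$.
   Context: $\zeta$ is the Riemann zeta function. A turning point of $\zeta$ is a complex number $b$ (with $b\ne 1$) such that $\mathrm{Im}\,\zeta(b)=0$ and $\mathrm{Re}\,\zeta'(b)=0$ (i.e. a point on a curve where $\zeta$ is real at which this curve has a vertical tangent). *)

(* Defs.v *)
From Stdlib Require Import Reals.
From Coquelicot Require Import Coquelicot.
Open Scope R_scope.

Definition Cexp (z : C) : C :=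
  (exp (Re z) * cos (Im z), exp (Re z) * sin (Im z)).

(* n ^ z with the principal logarithm of the positive integer n. *)
Definition natCpow (n : nat) (z : C) : C :=
  Cexp (z * RtoC (ln (INR n)))%C.

(* Sum of a convergent complex series. *)
Definition CSeries (a : nat -> C) : C :=
  (Series (fun n => Re (a n)), Series (fun n => Im (a n))).

(* The Dirichlet series  sum_{n >= 1} n^{-s},  convergent for Re s > 1. *)
Definition zeta_dirichlet (s : C) : C :=
  CSeries (fun n => natCpow (S n) (- s)%C).

(* Hasse's globally convergent series for the analytic continuation:
     zeta(s) = 1/(s-1) sum_{n >= 0} 1/(n+1)
                         sum_{k=0}^{n} (-1)^k binom(n,k) (k+1)^{1-s},
   valid for every complex s <> 1 (H. Hasse, Math. Z. 32, 1930). *)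
Definition zeta_hasse (s : C) : C :=
  (/ (s - RtoC 1) *
   CSeries (fun n =>
     RtoC (/ INR (S n)) *
     sum_n (fun k => RtoC ((-1) ^ k * Binomial.C n k)
                     * natCpow (S k) (RtoC 1 - s)) n))%C.

(* Riemann's zeta function on the complex plane minus 1 (the value at s = 1 is
   meaningless): the Dirichlet series where it converges absolutely, and its
   analytic continuation elsewhere. The two formulas agree for Re s > 1. *)
Definition zeta (s : C) : C :=
  if Rlt_dec 1 (Re s) then zeta_dirichlet s else zeta_hasse s.

(* [is_derive] over [C_AbsRing]: d is the complex derivative of zeta at s. *)
Definition is_zeta' (s d : C) : Prop :=
  is_derive (K := C_AbsRing) (V := C_NormedModule) zeta s d.

Definition turning_point (b : C) : Prop :=
  b <> RtoC 1 /\ Im (zeta b) = 0 /\ exists d : C, is_zeta' b d /\ Re d = 0.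

(* sigma > 1 and
     2^{sigma+1} / (4^sigma - 1) * log 2 = - zeta'(sigma) / zeta(sigma). *)
Definition E_equation (sigma : R) : Prop :=
  1 < sigma /\
  exists d : C, is_zeta' (RtoC sigma) d /\
    RtoC (Rpower 2 (sigma + 1) / (Rpower 4 sigma - 1) * ln 2)
      = (- (d / zeta (RtoC sigma)))%C.

(* Main.v *)
Require Import Defs.
From Stdlib Require Import Reals Lra Lia Arith List ZArith Classical ClassicalEpsilon.
From Coquelicot Require Import Coquelicot.
Open Scope R_scope.

(** For [Re s > 1], the Euler product of zeta (obtained here by sieving, one integer at a
    time) gives [- zeta'/zeta (s) = sum_p log p * p^(-s) / (1 - p^(-s))], and the phase of
    zeta is the sum of the phases of its factors.  If [zeta s] is real, the phase of the factor at
    2 is cancelled by those at the odd primes; a quadratic estimate with constants good for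
    [Re s >= 2.8] then shows that moving the phases away from [2^(-it) = -1] and
    [p^(-it) = 1] (or from [2^(-it) = 1] and [p^(-it) = -1]) costs more than it gains.
    Hence [Re zeta'] can only vanish if
    [Psi (sigma) = sum_(p >= 3) log p / (p^sigma - 1) - log 2 / (2^sigma + 1)] is
    nonnegative, and [E] is the unique zero of [Psi].

    Conversely let [lambda (n) = (-1) ^ v_2 (n)] and [F (s) = sum lambda (n) n^(-s)], so
    that [Psi] is [- F'/F] on the real axis.  By Kronecker's theorem there are shifts [t] with
    [zeta (s + it)] close to [F (s)].  Left of [E], [Im F] decreases in [t] through the
    real axis, and right of [E] it cannot; so in a small rectangle around [E + it] the
    rightmost point of [{Im zeta = 0, Re zeta' <= 0}] is interior, hence a turning point. *)

(** * Absolutely convergent complex series *)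

(** Let [s_p] be the absolute sine of the phase of the Euler factor at [p]. It is subadditive under
    products, so a real value forces [s_2 <= sum_(p >= 3) s_p]. At an odd prime a phase [s_p] costs
    at least [s_p^2 / (2 p^(-sigma))], the weight [log p] included. By Cauchy-Schwarz and [sum_(p >=
    3) p^(-sigma) <= 2^(-sigma) / 2], true from [sigma = 2.8] on, the total cost is at least
    [s_2^2 / 2^(-sigma)]. The factor at 2 gains at most [log 2] times this when [Re 2^(-s) <= 0],
    and at most [1.4 log 2] times this when [Re 2^(-s) >= 0]; both multiples are below 1. So
    [E >= 2.8] must be known before the estimate applies at [E]: the numerical enclosure serves the
    argument and not only the decimals.

    The shifts come from high moments. If [|sum_(n <= N) chi(n) n^(it)|] stayed below some [B < N],
    the mean of its [2m]-th power, which counts equal products of [m] factors, would be at most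
    [B^(2m)]. But the [N^m] products take at most [(m + 1)^N] values, so the count is at least
    [N^(2m) / (m + 1)^N], which is larger for large [m]. *)

Lemma ex_series_telescope (a u : nat -> R) :
  (forall n, 0 <= a n <= u n - u (S n)) -> (forall n, 0 <= u n) ->
  ex_series a /\ Series a <= u 0%nat.
Proof.
  intros Ha Hu.
  assert (B : forall n, sum_n a n <= u 0%nat - u (S n)).
  { induction n as [|n IH].
    - rewrite sum_O. apply Ha.
    - rewrite sum_Sn. unfold plus; simpl. specialize (Ha (S n)). lra. }
  assert (X : ex_series a).
  { assert (Y : ex_finite_lim_seq (sum_n a)).
    { apply ex_finite_lim_seq_incr with (u 0%nat).
      - intros n. rewrite sum_Sn. unfold plus; simpl. specialize (Ha (S n)). lra.
      - intros n. specialize (B n). specialize (Hu (S n)). lra. }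
    destruct Y as [l Hl]. exists l. exact Hl. }
  split; [exact X|].
  apply Series_correct in X.
  assert (Z : Rbar_le (Series a) (u 0%nat)).
  { apply (is_lim_seq_le (sum_n a) (fun _ => u 0%nat)).
    - intros n. specialize (B n). specialize (Hu (S n)). lra.
    - exact X.
    - apply is_lim_seq_const. }
  exact Z.
Qed.

Lemma ex_series_Rscal (c : R) (a : nat -> R) : ex_series a -> ex_series (fun n => c * a n).
Proof. exact (ex_series_scal_l (V := R_NormedModule) c a). Qed.

Definition abs_summable (a : nat -> C) : Prop := ex_series (fun n => Cmod (a n)).

Lemma Cmod_sqr (z : C) : Cmod z * Cmod z = Re z * Re z + Im z * Im z.
Proof. generalize (Cmod2_alt z). simpl. lra. Qed.

Lemma Im_le_Cmod (c : C) : Rabs (Im c) <= Cmod c.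
Proof. eapply Rle_trans; [|apply Rmax_Cmod]. apply Rmax_r. Qed.

Lemma Cmod_le_Re_Im (c : C) : Cmod c <= Rabs (Re c) + Rabs (Im c).
Proof.
  apply Rsqr_incr_0_var.
  - unfold Rsqr. rewrite Cmod_sqr.
    generalize (Rabs_pos (Re c)) (Rabs_pos (Im c)).
    generalize (Rsqr_abs (Re c)) (Rsqr_abs (Im c)). unfold Rsqr. nra.
  - generalize (Rabs_pos (Re c)) (Rabs_pos (Im c)). lra.
Qed.

Lemma abs_summable_le (a : nat -> C) (b : nat -> R) :
  (forall n, Cmod (a n) <= b n) -> ex_series b -> abs_summable a.
Proof.
  intros H Hb. unfold abs_summable.
  apply (ex_series_le (K := R_AbsRing) (V := R_CompleteNormedModule)) with b; [|exact Hb].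
  intros n. unfold norm; simpl. unfold abs; simpl.
  rewrite Rabs_pos_eq by apply Cmod_ge_0. apply H.
Qed.

Lemma ex_series_Rle (a b : nat -> R) :
  (forall n, Rabs (a n) <= b n) -> ex_series b -> ex_series a.
Proof.
  intros H Hb.
  apply (ex_series_le (K := R_AbsRing) (V := R_CompleteNormedModule)) with b; [|exact Hb].
  exact H.
Qed.

Lemma Series_nonneg (f : nat -> R) : (forall n, 0 <= f n) -> ex_series f -> 0 <= Series f.
Proof.
  intros H X. apply Rle_trans with (Series (fun _ : nat => 0)).
  - right. transitivity (0 * Series (fun _ : nat => 0)); [ring|].
    rewrite <- Series_scal_l. apply Series_ext. intros n; ring.
  - apply Series_le; [|exact X]. intros n. split; [lra|apply H].
Qed.

Lemma ex_series_Re (a : nat -> C) : abs_summable a -> ex_series (fun n => Re (a n)).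
Proof. apply ex_series_Rle. intros n. apply re_le_Cmod. Qed.

Lemma ex_series_Im (a : nat -> C) : abs_summable a -> ex_series (fun n => Im (a n)).
Proof. apply ex_series_Rle. intros n. apply Im_le_Cmod. Qed.

Lemma CSeries_ext (a b : nat -> C) : (forall n, a n = b n) -> CSeries a = CSeries b.
Proof. intros H. unfold CSeries. f_equal; apply Series_ext; intros n; now rewrite H. Qed.

Lemma abs_summable_ext (a b : nat -> C) :
  (forall n, a n = b n) -> abs_summable a -> abs_summable b.
Proof. intros H. apply ex_series_ext. intros n. now rewrite H. Qed.

Lemma abs_summable_plus (a b : nat -> C) :
  abs_summable a -> abs_summable b -> abs_summable (fun n => a n + b n)%C.
Proof.
  intros Ha Hb.
  apply abs_summable_le with (fun n => Cmod (a n) + Cmod (b n)).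
  - intros n. apply Cmod_triangle.
  - now apply (ex_series_plus (V := R_NormedModule)).
Qed.

Lemma abs_summable_scal (c : C) (a : nat -> C) :
  abs_summable a -> abs_summable (fun n => c * a n)%C.
Proof.
  intros Ha.
  apply abs_summable_le with (fun n => Cmod c * Cmod (a n)).
  - intros n. rewrite Cmod_mult. lra.
  - now apply ex_series_Rscal.
Qed.

Lemma CSeries_plus (a b : nat -> C) :
  abs_summable a -> abs_summable b ->
  CSeries (fun n => a n + b n)%C = (CSeries a + CSeries b)%C.
Proof.
  intros Ha Hb. unfold CSeries, Cplus; simpl. f_equal.
  - apply (Series_plus (fun n => Re (a n)) (fun n => Re (b n))); now apply ex_series_Re.
  - apply (Series_plus (fun n => Im (a n)) (fun n => Im (b n))); now apply ex_series_Im.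
Qed.

Lemma CSeries_scal (c : C) (a : nat -> C) :
  abs_summable a -> CSeries (fun n => c * a n)%C = (c * CSeries a)%C.
Proof.
  intros Ha. unfold CSeries, Cmult; simpl. f_equal.
  - rewrite <- !Series_scal_l, <- Series_minus.
    + reflexivity.
    + apply ex_series_Rscal, ex_series_Re, Ha.
    + apply ex_series_Rscal, ex_series_Im, Ha.
  - rewrite <- !Series_scal_l, <- Series_plus.
    + reflexivity.
    + apply ex_series_Rscal, ex_series_Im, Ha.
    + apply ex_series_Rscal, ex_series_Re, Ha.
Qed.

Lemma CSeries_minus (a b : nat -> C) :
  abs_summable a -> abs_summable b ->
  CSeries (fun n => a n - b n)%C = (CSeries a - CSeries b)%C.
Proof.
  intros Ha Hb.
  rewrite (CSeries_ext _ (fun n => a n + RtoC (-1) * b n)%C).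
  - rewrite CSeries_plus, CSeries_scal; trivial.
    + unfold Cminus. apply injective_projections; simpl; ring.
    + now apply abs_summable_scal.
  - intros n. apply injective_projections; simpl; ring.
Qed.

Lemma abs_summable_minus (a b : nat -> C) :
  abs_summable a -> abs_summable b -> abs_summable (fun n => a n - b n)%C.
Proof.
  intros Ha Hb.
  apply abs_summable_ext with (fun n => a n + RtoC (-1) * b n)%C.
  - intros n. apply injective_projections; simpl; ring.
  - apply abs_summable_plus; [|apply abs_summable_scal]; assumption.
Qed.

(** [CSeries] is defined componentwise, so the triangle inequality has to be derived. For the sum
    [z], [|z|^2] is the real part of the series of [conj z * a n], hence at most [|z|] times the
    series of moduli. *)
Lemma Cmod_CSeries (a : nat -> C) :
  abs_summable a -> Cmod (CSeries a) <= Series (fun n => Cmod (a n)).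
Proof.
  intros Ha. set (z := CSeries a).
  assert (H : Cmod z * Cmod z <= Cmod z * Series (fun n => Cmod (a n))).
  { rewrite Cmod_sqr.
    replace (Re z * Re z + Im z * Im z) with (Re (Cconj z * z)%C)
      by (generalize z; intros [x y]; unfold Re, Im; simpl; ring).
    unfold z at 2. rewrite <- CSeries_scal by exact Ha. unfold CSeries at 1.
    unfold Re at 1; simpl fst.
    rewrite <- Series_scal_l.
    apply Rle_trans with (Series (fun n => Cmod (Cconj z * a n)%C)).
    - apply Rle_trans with (Rabs (Series (fun n => Re (Cconj z * a n)%C))).
      { apply Rle_abs. }
      eapply Rle_trans; [apply Series_Rabs|].
      + apply ex_series_Rle with (fun n => Cmod (Cconj z * a n)%C).
        * intros n. rewrite Rabs_Rabsolu. apply re_le_Cmod.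
        * now apply abs_summable_scal.
      + apply Series_le.
        * intros n. split; [apply Rabs_pos|apply re_le_Cmod].
        * now apply abs_summable_scal.
    - right. apply Series_ext. intros n. rewrite Cmod_mult, Cmod_conj. reflexivity. }
  destruct (Rle_lt_or_eq_dec 0 (Cmod z) (Cmod_ge_0 z)) as [Hz|Hz].
  - now apply Rmult_le_reg_l with (Cmod z).
  - rewrite <- Hz. apply Series_nonneg; [|exact Ha]. intros n. apply Cmod_ge_0.
Qed.

Lemma Cmod_CSeries_le (a : nat -> C) (b : nat -> R) :
  (forall n, Cmod (a n) <= b n) -> ex_series b -> Cmod (CSeries a) <= Series b.
Proof.
  intros H Hb. eapply Rle_trans.
  - apply Cmod_CSeries. now apply abs_summable_le with b.
  - apply Series_le; [|exact Hb]. intros n. split; [apply Cmod_ge_0|apply H].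
Qed.

Lemma CSeries_incr_1 (a : nat -> C) :
  abs_summable a -> CSeries a = (a 0%nat + CSeries (fun n => a (S n)))%C.
Proof.
  intros Ha. unfold CSeries, Cplus; simpl. f_equal.
  - apply (Series_incr_1 (fun n => Re (a n))). now apply ex_series_Re.
  - apply (Series_incr_1 (fun n => Im (a n))). now apply ex_series_Im.
Qed.

Lemma abs_summable_incr_1 (a : nat -> C) :
  abs_summable (fun n => a (S n)) <-> abs_summable a.
Proof. symmetry. apply (ex_series_incr_1 (fun n => Cmod (a n))). Qed.

(** The upper index [q * M + (q - 1)] is the last one before the next multiple of [q]. These indices
    give a subsequence of partial sums, along which the two series are compared in the limit. *)
Lemma sum_n_multiples (b : nat -> R) (q M : nat) : (1 <= q)%nat ->
  sum_n (fun n => if n mod q =? 0 then b n else 0) (q * M + (q - 1)) =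
  sum_n (fun m => b (q * m)%nat) M.
Proof.
  intros Hq.
  assert (H : forall k j, (j < q)%nat ->
    sum_n (fun n => if n mod q =? 0 then b n else 0) (q * k + j) =
    sum_n (fun n => if n mod q =? 0 then b n else 0) (q * k)).
  { intros k. induction j as [|j IH]; intros Hj.
    - now rewrite Nat.add_0_r.
    - rewrite <- plus_n_Sm, sum_Sn, IH by lia.
      replace (S (q * k + j)) with (S j + k * q)%nat by lia.
      rewrite Nat.Div0.mod_add, Nat.mod_small by lia. simpl.
      unfold plus; simpl. ring. }
  rewrite H by lia.
  assert (K : forall k, (if (q * k) mod q =? 0 then b (q * k)%nat else 0) = b (q * k)%nat).
  { intros k. rewrite Nat.mul_comm, Nat.Div0.mod_mul. reflexivity. }
  induction M as [|M IH].
  - specialize (K 0%nat). rewrite Nat.mul_0_r in *. rewrite !sum_O, Nat.mul_0_r. exact K.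
  - rewrite sum_Sn, <- IH, <- (H M (q - 1)%nat) by lia.
    replace (q * S M)%nat with (S (q * M + (q - 1))) by lia.
    rewrite sum_Sn. f_equal.
    replace (S (q * M + (q - 1))) with (q * S M)%nat by lia. apply K.
Qed.

Lemma is_series_multiples (b : nat -> R) (q : nat) : (1 <= q)%nat ->
  ex_series (fun n => if n mod q =? 0 then b n else 0) ->
  Series (fun n => if n mod q =? 0 then b n else 0) = Series (fun m => b (q * m)%nat).
Proof.
  intros Hq H. symmetry. apply is_series_unique.
  apply Series_correct in H.
  assert (X : is_lim_seq (fun M => sum_n (fun n => if n mod q =? 0 then b n else 0)
    (q * M + (q - 1))) (Series (fun n => if n mod q =? 0 then b n else 0))).
  { apply (is_lim_seq_subseq (sum_n (fun n => if n mod q =? 0 then b n else 0)) _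
      (fun M => (q * M + (q - 1))%nat)); [|exact H].
    apply eventually_subseq. intros n. nia. }
  apply is_lim_seq_ext with (v := sum_n (fun m => b (q * m)%nat)) in X; [exact X|].
  intros n. now apply sum_n_multiples.
Qed.

Lemma CSeries_multiples (a : nat -> C) (q : nat) : (1 <= q)%nat -> abs_summable a ->
  CSeries (fun n => if n mod q =? 0 then a n else 0)%C = CSeries (fun m => a (q * m)%nat).
Proof.
  intros Hq Ha. unfold CSeries. f_equal.
  - rewrite <- (is_series_multiples (fun n => Re (a n)) q Hq).
    + apply Series_ext. intros n. now destruct (_ =? _).
    + apply ex_series_Rle with (fun n => Cmod (a n)); [|exact Ha].
      intros n. destruct (_ =? _); [apply re_le_Cmod|rewrite Rabs_R0; apply Cmod_ge_0].
  - rewrite <- (is_series_multiples (fun n => Im (a n)) q Hq).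
    + apply Series_ext. intros n. now destruct (_ =? _).
    + apply ex_series_Rle with (fun n => Cmod (a n)); [|exact Ha].
      intros n. destruct (_ =? _); [apply Im_le_Cmod|rewrite Rabs_R0; apply Cmod_ge_0].
Qed.

(** * Dirichlet series and their derivatives *)

(* [n^(-sigma)], but [0] at [n = 0], so that the series below may start there. *)
Definition npow (sigma : R) (n : nat) : R :=
  match n with O => 0 | S _ => exp (- (sigma * ln (INR n))) end.

Definition zterm (s : C) (n : nat) : C :=
  match n with O => RtoC 0 | S _ => natCpow n (- s)%C end.

Lemma exp_le_compat (x y : R) : x <= y -> exp x <= exp y.
Proof. intros [H| ->]; [left; now apply exp_increasing|lra]. Qed.

Lemma ln_INR_ge_0 (n : nat) : 0 <= ln (INR n).
Proof.
  destruct n as [|n].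
  - unfold ln. simpl. destruct (Rlt_dec 0 0) as [H|H]; [destruct (Rlt_irrefl _ H)|apply Rle_refl].
  - rewrite <- ln_1. apply ln_le; [lra|]. rewrite S_INR. generalize (pos_INR n). lra.
Qed.

Lemma npow_ge_0 (sigma : R) (n : nat) : 0 <= npow sigma n.
Proof. destruct n; simpl; [lra|]. left. apply exp_pos. Qed.

Lemma ln_npow_ge_0 (sigma : R) (n : nat) : 0 <= ln (INR n) * npow sigma n.
Proof. apply Rmult_le_pos; [apply ln_INR_ge_0|apply npow_ge_0]. Qed.

Lemma npow_pos (sigma : R) (n : nat) : (1 <= n)%nat -> 0 < npow sigma n.
Proof. destruct n; [lia|]. intros _. apply exp_pos. Qed.

Lemma npow_anti (s s' : R) (n : nat) : s <= s' -> npow s' n <= npow s n.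
Proof.
  intros H. destruct n as [|n]; [simpl; lra|].
  unfold npow. generalize (ln_INR_ge_0 (S n)). generalize (ln (INR (S n))). intros l Hl.
  apply exp_le_compat. nra.
Qed.

Lemma npow_1 (sigma : R) : npow sigma 1 = 1.
Proof. simpl. rewrite ln_1, Rmult_0_r, Ropp_0. apply exp_0. Qed.

(** From [x <= exp x] at [x = delta * ln n]: a logarithm costs an arbitrarily small part of the
    exponent, so series with log weights reduce to [npow]. *)
Lemma ln_npow (sigma delta : R) (n : nat) : 0 < delta ->
  ln (INR n) * npow sigma n <= / delta * npow (sigma - delta) n.
Proof.
  intros Hd. destruct n as [|n]; [simpl; lra|]. unfold npow.
  generalize (ln (INR (S n))). intros l.
  replace (- ((sigma - delta) * l)) with (delta * l + - (sigma * l)) by ring.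
  rewrite exp_plus, <- Rmult_assoc. apply Rmult_le_compat_r; [left; apply exp_pos|].
  apply Rmult_le_reg_l with delta; [exact Hd|].
  rewrite <- Rmult_assoc, Rinv_r, Rmult_1_l by lra.
  generalize (exp_ineq1_le (delta * l)). lra.
Qed.

(** The integral test in discrete form, with [x^(1 - sigma) / (sigma - 1)] as the telescoping
    majorant. It needs only [ln (1 - 1/x) <= - 1/x] and [exp u >= 1 + u], and also yields explicit
    bounds for tails. *)
Lemma npow_telescope (sigma : R) (n : nat) : 1 < sigma -> (1 <= n)%nat ->
  npow sigma (S n) <= / (sigma - 1) * npow (sigma - 1) n - / (sigma - 1) * npow (sigma - 1) (S n).
Proof.
  intros Hs Hn.
  assert (P : 0 < INR n) by (apply lt_0_INR; lia).
  apply Rmult_le_reg_l with (sigma - 1); [lra|].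
  replace ((sigma - 1) * (/ (sigma - 1) * npow (sigma - 1) n -
    / (sigma - 1) * npow (sigma - 1) (S n))) with (npow (sigma - 1) n - npow (sigma - 1) (S n))
    by (field; lra).
  destruct n as [|n]; [lia|]. set (m := S n) in *.
  assert (E1 : npow (sigma - 1) m = exp (- ((sigma - 1) * ln (INR m)))) by reflexivity.
  unfold npow at 1 3. rewrite E1.
  rewrite S_INR.
  set (x := INR m + 1).
  assert (Hx : 1 < x) by (unfold x; lra).
  assert (L : ln (INR m) <= ln x - / x).
  { replace (INR m) with (x * (1 - / x)) by (unfold x; field; lra).
    assert (0 < 1 - / x).
    { assert (/ x < 1); [|lra]. rewrite <- Rinv_1. apply Rinv_lt_contravar; lra. }
    rewrite ln_mult by lra.
    assert (ln (1 - / x) <= - / x); [|lra].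
    rewrite <- (ln_exp (- / x)). apply ln_le; [lra|].
    generalize (exp_ineq1_le (- / x)). lra. }
  assert (Q : exp (- (sigma * ln x)) = / x * exp (- ((sigma - 1) * ln x))).
  { rewrite <- (exp_ln x) at 2 by lra. rewrite <- exp_Ropp, <- exp_plus. f_equal. ring. }
  rewrite Q.
  apply Rle_trans with (exp (- ((sigma - 1) * ln x) + (sigma - 1) * / x) - exp (- ((sigma - 1) * ln x))).
  - rewrite exp_plus. generalize (exp_pos (- ((sigma - 1) * ln x))).
    generalize (exp_ineq1_le ((sigma - 1) * / x)).
    generalize (exp (- ((sigma - 1) * ln x))) (exp ((sigma - 1) * / x)). intros u v H1 H2.
    nra.
  - apply Rplus_le_compat_r. apply exp_le_compat. nra.
Qed.

Lemma ex_series_npow (sigma : R) : 1 < sigma -> ex_series (npow sigma).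
Proof.
  intros Hs. apply ex_series_incr_1, ex_series_incr_1.
  destruct (ex_series_telescope (fun n => npow sigma (S (S n)))
    (fun n => / (sigma - 1) * npow (sigma - 1) (S n))) as [H _]; [| |exact H].
  - intros n. split; [apply npow_ge_0|]. apply npow_telescope; [exact Hs|lia].
  - intros n. apply Rmult_le_pos; [|apply npow_ge_0]. left. apply Rinv_0_lt_compat. lra.
Qed.

Lemma ex_series_ln_npow (sigma : R) : 1 < sigma -> ex_series (fun n => ln (INR n) * npow sigma n).
Proof.
  intros Hs. set (d := (sigma - 1) / 2).
  apply ex_series_Rle with (fun n => / d * npow (sigma - d) n).
  - intros n. rewrite Rabs_pos_eq.
    + apply ln_npow. unfold d. lra.
    + apply ln_npow_ge_0.
  - apply ex_series_Rscal, ex_series_npow. unfold d. lra.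
Qed.

Lemma ex_series_ln2_npow (sigma : R) : 1 < sigma ->
  ex_series (fun n => ln (INR n) * ln (INR n) * npow sigma n).
Proof.
  intros Hs. set (d := (sigma - 1) / 2).
  apply ex_series_Rle with (fun n => / d * (ln (INR n) * npow (sigma - d) n)).
  - intros n. generalize (ln_INR_ge_0 n) (npow_ge_0 sigma n). intros H1 H2.
    rewrite Rabs_pos_eq.
    + assert (Hd : 0 < d) by (unfold d; lra).
      generalize (ln_npow sigma d n Hd). nra.
    + apply Rmult_le_pos; [apply Rmult_le_pos|]; trivial.
  - apply ex_series_Rscal, ex_series_ln_npow. unfold d. lra.
Qed.

Lemma Cexp_plus (z w : C) : Cexp (z + w)%C = (Cexp z * Cexp w)%C.
Proof.
  unfold Cexp. destruct z as [a b], w as [c d]; unfold Re, Im; simpl.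
  rewrite exp_plus, cos_plus, sin_plus. apply injective_projections; simpl; ring.
Qed.

Lemma Cmod_Cexp (z : C) : Cmod (Cexp z) = exp (Re z).
Proof.
  apply Rsqr_inj; [apply Cmod_ge_0|left; apply exp_pos|]. unfold Rsqr. rewrite Cmod_sqr.
  destruct z as [x y]. unfold Cexp, Re, Im; simpl.
  generalize (sin2_cos2 y); unfold Rsqr. intros H.
  transitivity (exp x * exp x * (sin y * sin y + cos y * cos y)); [ring|rewrite H; ring].
Qed.

Lemma Cmod_zterm (s : C) (n : nat) : Cmod (zterm s n) = npow (Re s) n.
Proof.
  destruct n as [|n]; [apply Cmod_0|]. unfold zterm, natCpow, npow. rewrite Cmod_Cexp.
  f_equal. generalize (ln (INR (S n))). intros l. destruct s. unfold Re; simpl. ring.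
Qed.

Lemma zterm_1 (s : C) : zterm s 1 = RtoC 1.
Proof.
  unfold zterm, natCpow. simpl INR. rewrite ln_1, Cmult_0_r.
  unfold Cexp, Re, Im; simpl. rewrite exp_0, cos_0, sin_0.
  apply injective_projections; simpl; ring.
Qed.

Lemma zterm_mult (s : C) (m n : nat) : zterm s (m * n) = (zterm s m * zterm s n)%C.
Proof.
  destruct m as [|m]; [simpl; apply injective_projections; simpl; ring|].
  destruct n as [|n]; [rewrite Nat.mul_0_r; apply injective_projections; simpl; ring|].
  assert (H : forall k, (k <> 0)%nat -> zterm s k = Cexp (- s * RtoC (ln (INR k)))%C).
  { intros [|k] Hk; [easy|reflexivity]. }
  rewrite !H by lia. rewrite <- Cexp_plus. f_equal.
  rewrite mult_INR, ln_mult by (apply lt_0_INR; lia).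
  rewrite RtoC_plus. ring.
Qed.

Lemma zterm_plus (s w : C) (n : nat) :
  zterm (s + w)%C n = (zterm s n * Cexp (- (w * RtoC (ln (INR n)))))%C.
Proof.
  destruct n as [|n]; [simpl; apply injective_projections; simpl; ring|].
  unfold zterm, natCpow. rewrite <- Cexp_plus. f_equal. ring.
Qed.

(** * First- and second-order bounds for sine, cosine and the exponential *)

Lemma Rabs_sin_le (y : R) : Rabs (sin y) <= Rabs y.
Proof.
  assert (P : forall x, 0 < x -> - x <= sin x <= x).
  { intros x Hx. destruct (Rlt_le_dec x 3) as [H|H].
    - generalize (sin_lt_x x Hx). generalize (sin_ge_0 x). intros H1 H2.
      generalize PI_RGT_0 PI2_3_2. unfold PI2. intros. lra.
    - generalize (SIN_bound x). lra. }
  destruct (Rtotal_order y 0) as [H|[H|H]].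
  - rewrite (Rabs_left y) by exact H. specialize (P (- y)). rewrite sin_neg in P.
    apply Rabs_le. lra.
  - subst. rewrite sin_0. lra.
  - rewrite (Rabs_right y) by lra. apply Rabs_le, P, H.
Qed.

Lemma one_minus_cos_bounds (y : R) : 0 <= 1 - cos y <= y * y / 2.
Proof.
  replace y with (2 * (y / 2)) at 1 2 by field. rewrite cos_2a_sin.
  generalize (Rabs_sin_le (y / 2)). intros H. apply Rsqr_le_abs_1 in H. unfold Rsqr in H.
  nra.
Qed.

Lemma one_minus_cos_le (y : R) : 1 - cos y <= Rabs y.
Proof.
  generalize (one_minus_cos_bounds y) (COS_bound y). intros H1 H2.
  generalize (Rsqr_abs y) (Rabs_pos y). unfold Rsqr. intros H3 H4. nra.
Qed.

Lemma Rabs_id_minus_sin_le (y : R) : Rabs (y - sin y) <= y * y.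
Proof.
  destruct (Req_dec y 0) as [->|Hy]; [rewrite sin_0, Rminus_0_r, Rabs_R0; lra|].
  destruct (MVT_gen (fun x => x - sin x) 0 y (fun x => 1 - cos x)) as [c [Hc H]].
  - intros x _. auto_derive; [trivial|ring].
  - intros x _. apply continuity_pt_filterlim.
    apply (ex_derive_continuous (fun x => x - sin x)). auto_derive. trivial.
  - rewrite sin_0 in H. replace (y - sin y) with ((1 - cos c) * y) by lra.
    rewrite Rabs_mult.
    apply Rle_trans with (Rabs y * Rabs y).
    + apply Rmult_le_compat_r; [apply Rabs_pos|].
      generalize (one_minus_cos_bounds c). intros B. rewrite Rabs_pos_eq by lra.
      apply Rle_trans with (Rabs c); [apply one_minus_cos_le|].
      unfold Rmin, Rmax in Hc. unfold Rabs.
      destruct (Rle_dec 0 y); destruct (Rcase_abs c), (Rcase_abs y); lra.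
    + right. symmetry. apply Rsqr_abs.
Qed.

Lemma Rabs_exp_opp_minus_1 (x : R) : Rabs (exp (- x) - 1) <= Rabs x * Rmax 1 (exp (- x)).
Proof.
  generalize (exp_ineq1_le x) (exp_ineq1_le (- x)) (exp_pos (- x)) (exp_pos x).
  assert (H : exp x * exp (- x) = 1) by (rewrite <- exp_plus, Rplus_opp_r; apply exp_0).
  revert H. generalize (exp x) (exp (- x)). intros u v H1 H2 H3 H4 H5.
  unfold Rmax. destruct (Rle_dec 1 v).
  - assert (0 <= - x) by nra. rewrite Rabs_pos_eq, Rabs_left1 by lra. nra.
  - assert (0 <= x) by nra. rewrite Rabs_left1, (Rabs_pos_eq x) by lra. nra.
Qed.

Lemma exp_opp_minus_affine (x : R) :
  0 <= exp (- x) - 1 + x <= x * x * Rmax 1 (exp (- x)).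
Proof.
  generalize (exp_ineq1_le x) (exp_ineq1_le (- x)) (exp_pos (- x)) (exp_pos x).
  assert (H : exp x * exp (- x) = 1) by (rewrite <- exp_plus, Rplus_opp_r; apply exp_0).
  revert H. generalize (exp x) (exp (- x)). intros u v H1 H2 H3 H4 H5.
  split; [lra|]. unfold Rmax. destruct (Rle_dec 1 v).
  - assert (0 <= - x) by nra. nra.
  - assert (0 <= x) by nra. nra.
Qed.

Lemma Cexp_opp_minus_1 (w : C) :
  Cmod (Cexp (- w) - RtoC 1)%C <= 3 * Cmod w * Rmax 1 (exp (- Re w)).
Proof.
  eapply Rle_trans; [apply Cmod_le_Re_Im|].
  generalize (re_le_Cmod w) (Im_le_Cmod w).
  destruct w as [x y]. unfold Cexp, Re, Im; simpl fst; simpl snd. intros Hx Hy.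
  rewrite cos_neg, sin_neg.
  generalize (Rabs_exp_opp_minus_1 x) (Rmax_l 1 (exp (- x))) (Rmax_r 1 (exp (- x))) (exp_pos (- x)).
  set (M := Rmax 1 (exp (- x))). set (v := exp (- x)). intros H1 H2 H3 H4.
  generalize (one_minus_cos_le y) (one_minus_cos_bounds y) (Rabs_sin_le y). intros H5 H6 H7.
  generalize (Rabs_pos x) (Rabs_pos y). intros H8 H9.
  replace (v * cos y + - (1)) with ((v - 1) - v * (1 - cos y)) by ring.
  replace (v * - sin y + - 0) with (- (v * sin y)) by ring.
  rewrite Rabs_Ropp, Rabs_mult, (Rabs_pos_eq v) by lra.
  assert (A : Rabs (v - 1 - v * (1 - cos y)) <= Rabs x * M + M * Rabs y).
  { unfold Rminus at 1. eapply Rle_trans; [apply Rabs_triang|]. rewrite Rabs_Ropp, Rabs_mult.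
    rewrite (Rabs_pos_eq v), (Rabs_pos_eq (1 - cos y)) by lra. nra. }
  nra.
Qed.

Lemma Cexp_opp_minus_affine (w : C) :
  Cmod (Cexp (- w) - RtoC 1 + w)%C <= 2 * (Cmod w * Cmod w) * Rmax 1 (exp (- Re w)).
Proof.
  eapply Rle_trans; [apply Cmod_le_Re_Im|]. rewrite Cmod_sqr.
  destruct w as [x y]. unfold Cexp, Re, Im; simpl fst; simpl snd.
  rewrite cos_neg, sin_neg.
  generalize (Rabs_exp_opp_minus_1 x) (exp_opp_minus_affine x) (Rmax_l 1 (exp (- x)))
    (Rmax_r 1 (exp (- x))) (exp_pos (- x)).
  set (M := Rmax 1 (exp (- x))). set (v := exp (- x)). intros H1 H1' H2 H3 H4.
  generalize (one_minus_cos_bounds y) (Rabs_sin_le y) (Rabs_id_minus_sin_le y). intros H6 H7 H5.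
  generalize (Rabs_pos x) (Rabs_pos y) (Rsqr_abs x) (Rsqr_abs y). unfold Rsqr.
  intros H8 H9 H10 H11.
  replace (v * cos y + - (1) + x) with ((v - 1 + x) - v * (1 - cos y)) by ring.
  replace (v * - sin y + - 0 + y) with ((1 - v) * sin y + (y - sin y)) by ring.
  assert (A : Rabs ((v - 1 + x) - v * (1 - cos y)) <= x * x * M + M * (y * y / 2)).
  { unfold Rminus at 1. eapply Rle_trans; [apply Rabs_triang|]. rewrite Rabs_Ropp, Rabs_mult.
    rewrite (Rabs_pos_eq v), (Rabs_pos_eq (1 - cos y)), (Rabs_pos_eq (v - 1 + x)) by lra. nra. }
  assert (B : Rabs ((1 - v) * sin y + (y - sin y)) <= Rabs x * M * Rabs y + y * y * M).
  { eapply Rle_trans; [apply Rabs_triang|]. rewrite Rabs_mult, (Rabs_minus_sym 1 v).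
    apply Rplus_le_compat.
    - apply Rmult_le_compat; try apply Rabs_pos; assumption.
    - nra. }
  assert (D : Rabs x * Rabs y <= (x * x + y * y) / 2).
  { rewrite H10, H11. generalize (Rle_0_sqr (Rabs x - Rabs y)). unfold Rsqr. nra. }
  assert (F : Rabs x * Rabs y * M <= (x * x + y * y) / 2 * M) by (apply Rmult_le_compat_r; lra).
  nra.
Qed.

(** The factor [Rmax 1 (exp ...)] in the bounds on [Cexp] depends on the direction of the increment.
    It is absorbed by passing to an abscissa [m] to the left of both endpoints. *)
Lemma npow_Rmax (s w m : R) (n : nat) : m <= s -> m <= s + w ->
  npow s n * Rmax 1 (exp (- (w * ln (INR n)))) <= npow m n.
Proof.
  intros H1 H2. unfold Rmax. destruct (Rle_dec _ _).
  - replace (npow s n * exp (- (w * ln (INR n)))) with (npow (s + w) n).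
    + now apply npow_anti.
    + destruct n as [|n]; [simpl; ring|]. unfold npow. rewrite <- exp_plus. f_equal. ring.
  - rewrite Rmult_1_r. now apply npow_anti.
Qed.

Lemma zterm_Lipschitz (s s' : C) (m : R) (n : nat) : m <= Re s -> m <= Re s' ->
  Cmod (zterm s' n - zterm s n)%C <= 3 * Cmod (s' - s)%C * (ln (INR n) * npow m n).
Proof.
  intros H1 H2. replace s' with (s + (s' - s))%C at 1 by ring.
  set (w := (s' - s)%C). rewrite zterm_plus.
  replace (zterm s n * Cexp (- (w * ln (INR n))) - zterm s n)%C with
    (zterm s n * (Cexp (- (w * ln (INR n))) - 1))%C by ring.
  rewrite Cmod_mult, Cmod_zterm.
  generalize (Cexp_opp_minus_1 (w * ln (INR n))). rewrite Cmod_mult, Cmod_R.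
  rewrite Rabs_pos_eq by apply ln_INR_ge_0.
  replace (Re (w * ln (INR n))%C) with (Re w * ln (INR n))
    by (destruct w; unfold Re; simpl; ring).
  intros H.
  assert (Q : npow (Re s) n * Rmax 1 (exp (- (Re w * ln (INR n)))) <= npow m n).
  { apply npow_Rmax; [exact H1|]. unfold w. destruct s, s'; unfold Re in *; simpl in *. lra. }
  apply Rle_trans with (npow (Re s) n * (3 * (Cmod w * ln (INR n)) *
    Rmax 1 (exp (- (Re w * ln (INR n)))))).
  - apply Rmult_le_compat_l; [apply npow_ge_0|exact H].
  - generalize (Cmod_ge_0 w) (ln_INR_ge_0 n). intros.
    replace (npow (Re s) n * (3 * (Cmod w * ln (INR n)) * Rmax 1 (exp (- (Re w * ln (INR n))))))
      with (3 * Cmod w * ln (INR n) * (npow (Re s) n * Rmax 1 (exp (- (Re w * ln (INR n))))))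
      by ring.
    rewrite <- (Rmult_assoc (3 * Cmod w) (ln (INR n)) (npow m n)).
    apply Rmult_le_compat_l; [|exact Q].
    apply Rmult_le_pos; [lra|assumption].
Qed.

Lemma zterm_Taylor (s s' : C) (m : R) (n : nat) : m <= Re s -> m <= Re s' ->
  Cmod (zterm s' n - zterm s n + (s' - s) * (RtoC (ln (INR n)) * zterm s n))%C <=
  2 * (Cmod (s' - s)%C * Cmod (s' - s)%C) * (ln (INR n) * ln (INR n) * npow m n).
Proof.
  intros H1 H2. replace s' with (s + (s' - s))%C at 1 by ring.
  set (w := (s' - s)%C). rewrite zterm_plus.
  replace (zterm s n * Cexp (- (w * ln (INR n))) - zterm s n +
      w * (RtoC (ln (INR n)) * zterm s n))%C with
    (zterm s n * (Cexp (- (w * ln (INR n))) - 1 + w * ln (INR n)))%C by ring.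
  rewrite Cmod_mult, Cmod_zterm.
  generalize (Cexp_opp_minus_affine (w * ln (INR n))). rewrite Cmod_mult, Cmod_R.
  rewrite Rabs_pos_eq by apply ln_INR_ge_0.
  replace (Re (w * ln (INR n))%C) with (Re w * ln (INR n))
    by (destruct w; unfold Re; simpl; ring).
  intros H.
  assert (Q : npow (Re s) n * Rmax 1 (exp (- (Re w * ln (INR n)))) <= npow m n).
  { apply npow_Rmax; [exact H1|]. unfold w. destruct s, s'; unfold Re in *; simpl in *. lra. }
  set (e := Rmax 1 (exp (- (Re w * ln (INR n))))) in *.
  set (l := ln (INR n)) in *.
  eapply Rle_trans; [apply Rmult_le_compat_l; [apply npow_ge_0|exact H]|].
  replace (npow (Re s) n * (2 * (Cmod w * l * (Cmod w * l)) * e))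
    with (2 * (Cmod w * Cmod w) * (l * l * (npow (Re s) n * e))) by ring.
  generalize (Cmod_ge_0 w). intros.
  apply Rmult_le_compat_l; [nra|]. apply Rmult_le_compat_l; [nra|exact Q].
Qed.

(* [- dirichlet_ln c] is the derivative of [dirichlet c]. *)
Definition dirichlet (c : nat -> C) (s : C) : C := CSeries (fun n => c n * zterm s n)%C.

Definition dirichlet_ln (c : nat -> C) (s : C) : C :=
  CSeries (fun n => c n * (RtoC (ln (INR n)) * zterm s n))%C.

Definition unit_bounded (c : nat -> C) : Prop := forall n, Cmod (c n) <= 1.

Lemma Cmod_mult_le (c z : C) (b : R) : Cmod c <= 1 -> Cmod z <= b -> Cmod (c * z)%C <= b.
Proof.
  intros H1 H2. rewrite Cmod_mult. generalize (Cmod_ge_0 c) (Cmod_ge_0 z). nra.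
Qed.

Lemma Cmod_ln_zterm (s : C) (n : nat) :
  Cmod (RtoC (ln (INR n)) * zterm s n)%C = ln (INR n) * npow (Re s) n.
Proof.
  rewrite Cmod_mult, Cmod_R, Cmod_zterm, Rabs_pos_eq by apply ln_INR_ge_0. reflexivity.
Qed.

Lemma abs_summable_dirichlet (c : nat -> C) (s : C) : unit_bounded c -> 1 < Re s ->
  abs_summable (fun n => c n * zterm s n)%C.
Proof.
  intros Hc Hs. apply abs_summable_le with (npow (Re s)).
  - intros n. apply Cmod_mult_le; [apply Hc|]. rewrite Cmod_zterm. lra.
  - now apply ex_series_npow.
Qed.

Lemma abs_summable_dirichlet_ln (c : nat -> C) (s : C) : unit_bounded c -> 1 < Re s ->
  abs_summable (fun n => c n * (RtoC (ln (INR n)) * zterm s n))%C.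
Proof.
  intros Hc Hs. apply abs_summable_le with (fun n => ln (INR n) * npow (Re s) n).
  - intros n. apply Cmod_mult_le; [apply Hc|]. rewrite Cmod_ln_zterm. lra.
  - now apply ex_series_ln_npow.
Qed.

(** The constant depends on [m] only and not on the coefficients. It can therefore be fixed before
    the shift [t] of the coefficients [n^(-it)] is chosen. *)
Lemma dirichlet_Lipschitz (c : nat -> C) (m : R) : unit_bounded c -> 1 < m ->
  forall s s', m <= Re s -> m <= Re s' ->
  Cmod (dirichlet c s' - dirichlet c s)%C <=
  3 * Series (fun n => ln (INR n) * npow m n) * Cmod (s' - s)%C.
Proof.
  intros Hc Hm s s' H1 H2. unfold dirichlet.
  rewrite <- CSeries_minus by (apply abs_summable_dirichlet; [exact Hc|lra]).
  replace (3 * Series (fun n => ln (INR n) * npow m n) * Cmod (s' - s)%C)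
    with (3 * Cmod (s' - s)%C * Series (fun n => ln (INR n) * npow m n)) by ring.
  rewrite <- Series_scal_l. apply Cmod_CSeries_le.
  - intros n. replace (c n * zterm s' n - c n * zterm s n)%C with
      (c n * (zterm s' n - zterm s n))%C by ring.
    apply Cmod_mult_le; [apply Hc|]. now apply zterm_Lipschitz.
  - apply ex_series_Rscal, ex_series_ln_npow, Hm.
Qed.

Lemma dirichlet_ln_Lipschitz (c : nat -> C) (m : R) : unit_bounded c -> 1 < m ->
  forall s s', m <= Re s -> m <= Re s' ->
  Cmod (dirichlet_ln c s' - dirichlet_ln c s)%C <=
  3 * Series (fun n => ln (INR n) * ln (INR n) * npow m n) * Cmod (s' - s)%C.
Proof.
  intros Hc Hm s s' H1 H2. unfold dirichlet_ln.
  rewrite <- CSeries_minus by (apply abs_summable_dirichlet_ln; [exact Hc|lra]).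
  replace (3 * Series (fun n => ln (INR n) * ln (INR n) * npow m n) * Cmod (s' - s)%C)
    with (3 * Cmod (s' - s)%C * Series (fun n => ln (INR n) * ln (INR n) * npow m n)) by ring.
  rewrite <- Series_scal_l. apply Cmod_CSeries_le.
  - intros n.
    replace (c n * (RtoC (ln (INR n)) * zterm s' n) - c n * (RtoC (ln (INR n)) * zterm s n))%C with
      (c n * (RtoC (ln (INR n)) * (zterm s' n - zterm s n)))%C by ring.
    apply Cmod_mult_le; [apply Hc|]. rewrite Cmod_mult, Cmod_R, Rabs_pos_eq by apply ln_INR_ge_0.
    generalize (zterm_Lipschitz s s' m n H1 H2) (ln_INR_ge_0 n). intros. nra.
  - apply ex_series_Rscal, ex_series_ln2_npow, Hm.
Qed.

Lemma dirichlet_Taylor (c : nat -> C) (m : R) : unit_bounded c -> 1 < m ->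
  forall s s', m <= Re s -> m <= Re s' ->
  Cmod (dirichlet c s' - dirichlet c s + (s' - s) * dirichlet_ln c s)%C <=
  2 * Series (fun n => ln (INR n) * ln (INR n) * npow m n) * (Cmod (s' - s)%C * Cmod (s' - s)%C).
Proof.
  intros Hc Hm s s' H1 H2. unfold dirichlet, dirichlet_ln.
  rewrite <- CSeries_minus by (apply abs_summable_dirichlet; [exact Hc|lra]).
  rewrite <- CSeries_scal by (apply abs_summable_dirichlet_ln; [exact Hc|lra]).
  rewrite <- CSeries_plus.
  2: { apply abs_summable_minus; apply abs_summable_dirichlet; trivial; lra. }
  2: { apply abs_summable_scal, abs_summable_dirichlet_ln; trivial; lra. }
  replace (2 * Series (fun n => ln (INR n) * ln (INR n) * npow m n) *
      (Cmod (s' - s)%C * Cmod (s' - s)%C)) with (2 * (Cmod (s' - s)%C * Cmod (s' - s)%C) *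
    Series (fun n => ln (INR n) * ln (INR n) * npow m n)) by ring.
  rewrite <- Series_scal_l. apply Cmod_CSeries_le.
  - intros n.
    replace (c n * zterm s' n - c n * zterm s n +
        (s' - s) * (c n * (RtoC (ln (INR n)) * zterm s n)))%C with
      (c n * (zterm s' n - zterm s n + (s' - s) * (RtoC (ln (INR n)) * zterm s n)))%C by ring.
    apply Cmod_mult_le; [apply Hc|]. now apply zterm_Taylor.
  - apply ex_series_Rscal, ex_series_ln2_npow, Hm.
Qed.

Definition one_coef (n : nat) : C := RtoC 1.

Lemma unit_bounded_one : unit_bounded one_coef.
Proof. intros n. unfold one_coef. rewrite Cmod_1. lra. Qed.

Lemma zeta_dirichlet_series (s : C) : 1 < Re s -> zeta s = dirichlet one_coef s.
Proof.
  intros Hs. unfold zeta. destruct (Rlt_dec 1 (Re s)) as [_|]; [|lra].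
  unfold dirichlet. rewrite CSeries_incr_1.
  - unfold zeta_dirichlet. unfold one_coef.
    rewrite (CSeries_ext (fun n => 1 * zterm s (S n))%C (fun n => natCpow (S n) (- s)%C)).
    + simpl. ring.
    + intros n. simpl zterm. ring.
  - apply abs_summable_dirichlet; [apply unit_bounded_one|exact Hs].
Qed.

Lemma is_derive_zeta (s : C) : 1 < Re s ->
  is_zeta' s (- dirichlet_ln one_coef s)%C.
Proof.
  intros Hs. set (m := (1 + Re s) / 2).
  set (K := 2 * Series (fun n => ln (INR n) * ln (INR n) * npow m n)).
  assert (HK : 0 <= K).
  { unfold K. apply Rmult_le_pos; [lra|].
    assert (X : ex_series (fun n => ln (INR n) * ln (INR n) * npow m n))
      by (apply ex_series_ln2_npow; unfold m; lra).
    apply Series_nonneg; [|exact X]. intros n.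
    apply Rmult_le_pos; [apply Rle_0_sqr|apply npow_ge_0]. }
  unfold is_zeta', is_derive. split; [apply is_linear_scal_l|].
  intros x Hx. 
  apply (is_filter_lim_locally_unique (V := AbsRing_NormedModule C_AbsRing)) in Hx. subst x.
  intros eps.
  (* The first bound keeps [y] in [Re y >= m > 1], where [zeta] is given by its Dirichlet branch.
     The second makes the quadratic Taylor error at most [eps * |y - s|]. *)
  assert (Hd : 0 < Rmin ((Re s - 1) / 2) (pos eps / (K + 1))).
  { apply Rmin_pos; [lra|]. apply Rdiv_lt_0_compat; [apply eps|lra]. }
  exists (mkposreal _ Hd). intros y Hy.
  change (Cmod (y - s)%C < Rmin ((Re s - 1) / 2) (pos eps / (K + 1))) in Hy.
  change (Cmod (zeta y - zeta s - (y - s) * (- dirichlet_ln one_coef s))%C <=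
    pos eps * Cmod (y - s)%C).
  assert (H1 : Cmod (y - s)%C < (Re s - 1) / 2).
  { eapply Rlt_le_trans; [exact Hy|apply Rmin_l]. }
  assert (H2 : Cmod (y - s)%C < pos eps / (K + 1)).
  { eapply Rlt_le_trans; [exact Hy|apply Rmin_r]. }
  assert (H3 : m <= Re y).
  { generalize (re_le_Cmod (y - s)%C). intros H. apply Rabs_le_between in H.
    destruct y, s; unfold Re, m in *; simpl in *. lra. }
  rewrite !zeta_dirichlet_series by (unfold m in H3; lra).
  replace (dirichlet one_coef y - dirichlet one_coef s - (y - s) * - dirichlet_ln one_coef s)%C
    with (dirichlet one_coef y - dirichlet one_coef s + (y - s) * dirichlet_ln one_coef s)%C by ring.
  eapply Rle_trans; [apply dirichlet_Taylor with (m := m)|].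
  - apply unit_bounded_one.
  - unfold m; lra.
  - unfold m; lra.
  - exact H3.
  - fold K. rewrite <- Rmult_assoc. apply Rmult_le_compat_r; [apply Cmod_ge_0|].
    apply Rle_trans with (K * (pos eps / (K + 1))).
    + apply Rmult_le_compat_l; lra.
    + replace (K * (pos eps / (K + 1))) with (pos eps * (K / (K + 1))) by (field; lra).
      rewrite <- (Rmult_1_r (pos eps)) at 2. apply Rmult_le_compat_l; [left; apply eps|].
      apply Rmult_le_reg_r with (K + 1); [lra|]. unfold Rdiv.
      rewrite Rmult_assoc, Rinv_l by lra. lra.
Qed.

Lemma is_zeta'_unique (s d : C) : 1 < Re s -> is_zeta' s d -> d = (- dirichlet_ln one_coef s)%C.
Proof.
  intros Hs Hd. rewrite <- (is_C_derive_unique zeta s d Hd).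
  apply is_C_derive_unique. now apply is_derive_zeta.
Qed.

(** * Sieving a completely multiplicative sequence *)

(* Trial division suffices: [q >= 2] is prime exactly when [rough (q - 1) q]. *)
Fixpoint rough (q n : nat) : bool :=
  match q with
  | O => true
  | S p => rough p n && ((q =? 1) || negb (n mod q =? 0))
  end.

Definition is_prime (q : nat) : bool := rough (q - 1) q.

Lemma rough_spec (q n : nat) :
  rough q n = true <-> forall d, (2 <= d <= q)%nat -> (n mod d <> 0)%nat.
Proof.
  induction q as [|q IH].
  - simpl. split; [lia|trivial].
  - cbn [rough]. rewrite Bool.andb_true_iff, IH, Bool.orb_true_iff, Bool.negb_true_iff.
    rewrite Nat.eqb_eq, Nat.eqb_neq. split.
    + intros [H1 H2] d Hd. destruct (Nat.eq_dec d (S q)) as [->|]; [lia|]. apply H1. lia.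
    + intros H. split.
      * intros d Hd. apply H. lia.
      * destruct q as [|q]; [now left|right]. apply H. lia.
Qed.

(** The hypothesis makes every [d] in [2..q] coprime to [S q], since a common divisor would be at
    most [q]. Gauss's lemma then moves a divisor of [S q * m] to [m]. *)
Lemma rough_mult (q m : nat) : rough q (S q) = true -> rough q (S q * m) = rough q m.
Proof.
  intros HQ. apply Bool.eq_true_iff_eq. rewrite !rough_spec. rewrite rough_spec in HQ. split.
  - intros H d Hd E. apply (H d Hd).
    apply Nat.Lcm0.mod_divide in E. apply Nat.Lcm0.mod_divide. now apply Nat.divide_mul_r.
  - intros H d Hd E. apply Nat.Lcm0.mod_divide in E.
    set (g := Nat.gcd d (S q)).
    assert (G1 : Nat.divide g d) by apply Nat.gcd_divide_l.
    assert (G2 : Nat.divide g (S q)) by apply Nat.gcd_divide_r.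
    assert (G3 : (g <= d)%nat) by (apply Nat.divide_pos_le; [lia|exact G1]).
    destruct (le_lt_dec 2 g) as [G|G].
    + apply (HQ g); [lia|]. now apply Nat.Lcm0.mod_divide.
    + assert (g <> 0)%nat.
      { intros G0. rewrite G0 in G1. destruct G1 as [k Hk]. lia. }
      assert (G4 : g = 1%nat) by lia.
      apply (H d Hd), Nat.Lcm0.mod_divide. now apply Nat.gauss with (S q).
Qed.

(** Multiples of a composite [S q] have already been removed by one of its smaller divisors, so this
    sieving step changes nothing. *)
Lemma rough_succ_composite (q n : nat) : (1 <= q)%nat -> rough q (S q) = false ->
  rough (S q) n = rough q n.
Proof.
  intros Hq H. cbn [rough]. destruct (rough q n) eqn:E; [|reflexivity].
  rewrite Bool.andb_true_l.
  destruct (n mod S q =? 0) eqn:F; [|now rewrite Bool.orb_true_r].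
  exfalso. apply Nat.eqb_eq, Nat.Lcm0.mod_divide in F.
  enough (rough q (S q) = true) by congruence.
  rewrite rough_spec in E |- *. intros d Hd Z. apply (E d Hd).
  apply Nat.Lcm0.mod_divide in Z. apply Nat.Lcm0.mod_divide. now apply Nat.divide_trans with (S q).
Qed.

Lemma rough_small (q n : nat) : (2 <= n <= q)%nat -> rough q n = false.
Proof.
  intros Hn. destruct (rough q n) eqn:E; [|reflexivity].
  rewrite rough_spec in E. destruct (E n Hn). apply Nat.Div0.mod_same.
Qed.

Lemma rough_one (q : nat) : rough q 1 = true.
Proof. rewrite rough_spec. intros d Hd. rewrite Nat.mod_small; lia. Qed.

(** Only the moduli are prescribed. This covers all twists [c(n) n^(-s)] by a completely
    multiplicative unimodular [c], so that zeta, its vertical shifts and the limit function [F] are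
    treated at once. *)
Record cmult (a : nat -> C) (sigma : R) : Prop := {
  cmult_0 : a 0%nat = RtoC 0;
  cmult_1 : a 1%nat = RtoC 1;
  cmult_mult : forall m n, a (m * n)%nat = (a m * a n)%C;
  cmult_mod : forall n, Cmod (a n) = npow sigma n }.

Definition sieved (a : nat -> C) (q n : nat) : C := if rough q n then a n else RtoC 0.
Definition sieve_sum (a : nat -> C) (q : nat) : C := CSeries (sieved a q).
Definition sieve_ln (a : nat -> C) (q : nat) : C :=
  CSeries (fun n => RtoC (ln (INR n)) * sieved a q n)%C.

Lemma Cmod_sieved (a : nat -> C) (sigma : R) (q n : nat) : cmult a sigma ->
  Cmod (sieved a q n) <= npow sigma n.
Proof.
  intros Ha. unfold sieved. destruct (rough q n).
  - rewrite (cmult_mod _ _ Ha). lra.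
  - rewrite Cmod_0. apply npow_ge_0.
Qed.

Lemma Cmod_ln_sieved (a : nat -> C) (sigma : R) (q n : nat) : cmult a sigma ->
  Cmod (RtoC (ln (INR n)) * sieved a q n)%C <= ln (INR n) * npow sigma n.
Proof.
  intros Ha. rewrite Cmod_mult, Cmod_R, Rabs_pos_eq by apply ln_INR_ge_0.
  apply Rmult_le_compat_l; [apply ln_INR_ge_0|]. now apply Cmod_sieved.
Qed.

Lemma abs_summable_sieved (a : nat -> C) (sigma : R) (q : nat) : 1 < sigma -> cmult a sigma ->
  abs_summable (sieved a q).
Proof.
  intros Hs Ha. apply abs_summable_le with (npow sigma); [|now apply ex_series_npow].
  intros n. now apply Cmod_sieved.
Qed.

Lemma abs_summable_ln_sieved (a : nat -> C) (sigma : R) (q : nat) : 1 < sigma -> cmult a sigma ->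
  abs_summable (fun n => RtoC (ln (INR n)) * sieved a q n)%C.
Proof.
  intros Hs Ha. apply abs_summable_le with (fun n => ln (INR n) * npow sigma n).
  - intros n. now apply Cmod_ln_sieved.
  - now apply ex_series_ln_npow.
Qed.

Lemma sieved_split (a : nat -> C) (q n : nat) : (1 <= q)%nat ->
  sieved a q n = (sieved a (S q) n + (if n mod S q =? 0 then sieved a q n else 0))%C.
Proof.
  intros Hq. unfold sieved. cbn [rough].
  replace (S q =? 1) with false by (symmetry; apply Nat.eqb_neq; lia).
  destruct (rough q n), (n mod S q =? 0); simpl; ring.
Qed.

Lemma sieved_mult (a : nat -> C) (sigma : R) (q m : nat) : cmult a sigma ->
  rough q (S q) = true -> sieved a q (S q * m) = (a (S q) * sieved a q m)%C.
Proof.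
  intros Ha Hq. unfold sieved. rewrite (rough_mult q m Hq), (cmult_mult _ _ Ha).
  destruct (rough q m); [reflexivity|ring].
Qed.

Lemma abs_summable_if (a : nat -> C) (f : nat -> bool) :
  abs_summable a -> abs_summable (fun n => if f n then a n else 0)%C.
Proof.
  intros Ha. apply abs_summable_le with (fun n => Cmod (a n)); [|exact Ha].
  intros n. destruct (f n); [lra|]. rewrite Cmod_0. apply Cmod_ge_0.
Qed.

(** The integers removed at the prime [S q] are the [S q * m] with [m] still present. By complete
    multiplicativity they contribute [a (S q)] times the sum before the step. *)
Lemma sieve_sum_prime (a : nat -> C) (sigma : R) (q : nat) :
  1 < sigma -> cmult a sigma -> (1 <= q)%nat -> rough q (S q) = true ->
  sieve_sum a (S q) = ((1 - a (S q)) * sieve_sum a q)%C.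
Proof.
  intros Hs Ha Hq HQ.
  assert (E : sieve_sum a q = (sieve_sum a (S q) + a (S q) * sieve_sum a q)%C).
  { unfold sieve_sum at 1. rewrite (CSeries_ext _ _ (fun n => sieved_split a q n Hq)).
    rewrite CSeries_plus.
    - rewrite CSeries_multiples; [|lia|now apply abs_summable_sieved with sigma].
      rewrite (CSeries_ext _ _ (fun m => sieved_mult a sigma q m Ha HQ)).
      rewrite CSeries_scal by now apply abs_summable_sieved with sigma. reflexivity.
    - now apply abs_summable_sieved with sigma.
    - apply (abs_summable_if (sieved a q) (fun n => n mod S q =? 0)).
      now apply abs_summable_sieved with sigma. }
  replace (sieve_sum a (S q)) with (sieve_sum a (S q) + a (S q) * sieve_sum a q -
    a (S q) * sieve_sum a q)%C by ring.
  rewrite <- E. ring.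
Qed.

(** The product rule for [sieve_sum_prime], up to sign. The extra term comes from
    [ln (S q * m) = ln (S q) + ln m] on the removed integers. *)
Lemma sieve_ln_prime (a : nat -> C) (sigma : R) (q : nat) :
  1 < sigma -> cmult a sigma -> (1 <= q)%nat -> rough q (S q) = true ->
  sieve_ln a (S q) = ((1 - a (S q)) * sieve_ln a q -
    RtoC (ln (INR (S q))) * a (S q) * sieve_sum a q)%C.
Proof.
  intros Hs Ha Hq HQ.
  assert (E : sieve_ln a q = (sieve_ln a (S q) +
    (a (S q) * sieve_ln a q + RtoC (ln (INR (S q))) * a (S q) * sieve_sum a q))%C).
  { set (f := fun n => (RtoC (ln (INR n)) * sieved a q n)%C).
    assert (Hf : abs_summable f) by now apply abs_summable_ln_sieved with sigma.
    change (sieve_ln a q) with (CSeries f) at 1.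
    rewrite (CSeries_ext f (fun n => RtoC (ln (INR n)) * sieved a (S q) n +
      (if n mod S q =? 0 then f n else 0))%C).
    2: { intros n. unfold f. rewrite (sieved_split a q n Hq) at 1.
      destruct (_ =? _); ring. }
    rewrite CSeries_plus.
    - rewrite CSeries_multiples; [|lia|exact Hf].
      rewrite (CSeries_ext (fun m => f (S q * m)%nat) (fun m => a (S q) * f m +
        RtoC (ln (INR (S q))) * a (S q) * sieved a q m)%C).
      + rewrite CSeries_plus, !CSeries_scal.
        * reflexivity.
        * now apply abs_summable_sieved with sigma.
        * exact Hf.
        * now apply abs_summable_scal.
        * apply abs_summable_scal. now apply abs_summable_sieved with sigma.
      + intros m. unfold f. rewrite (sieved_mult a sigma q m Ha HQ).
        destruct m as [|m].
        * assert (Z : sieved a q 0 = RtoC 0)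
            by (unfold sieved; rewrite (cmult_0 _ _ Ha); now destruct (rough q 0)).
          rewrite Z. ring.
        * rewrite mult_INR, ln_mult, RtoC_plus by (apply lt_0_INR; lia). ring.
    - now apply abs_summable_ln_sieved with sigma.
    - now apply (abs_summable_if f (fun n => n mod S q =? 0)). }
  replace (sieve_ln a (S q)) with (sieve_ln a (S q) +
    (a (S q) * sieve_ln a q + RtoC (ln (INR (S q))) * a (S q) * sieve_sum a q) -
    (a (S q) * sieve_ln a q + RtoC (ln (INR (S q))) * a (S q) * sieve_sum a q))%C by ring.
  rewrite <- E. ring.
Qed.

Lemma sieve_composite (a : nat -> C) (q : nat) : (1 <= q)%nat -> rough q (S q) = false ->
  sieve_sum a (S q) = sieve_sum a q /\ sieve_ln a (S q) = sieve_ln a q.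
Proof.
  intros Hq H. split; apply CSeries_ext; intros n; unfold sieved;
    now rewrite (rough_succ_composite q n Hq H).
Qed.

(** * The limit of the sieve: logarithmic Euler product and phases *)

Definition tail (f : nat -> R) (q n : nat) : R := if n <=? q then 0 else f n.

Lemma tail_bounds (f : nat -> R) (q n : nat) : (forall k, 0 <= f k) -> 0 <= tail f q n <= f n.
Proof. intros H. unfold tail. specialize (H n). destruct (_ <=? _); lra. Qed.

Lemma ex_series_tail (f : nat -> R) (q : nat) : (forall k, 0 <= f k) -> ex_series f ->
  ex_series (tail f q).
Proof.
  intros H Hf. apply ex_series_Rle with f; [|exact Hf].
  intros n. generalize (tail_bounds f q n H). intros B. rewrite Rabs_pos_eq; lra.
Qed.

Lemma Series_tail (f : nat -> R) (q : nat) : (forall k, 0 <= f k) -> ex_series f ->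
  Series (tail f q) = Series f - sum_n f q.
Proof.
  intros H Hf.
  rewrite (Series_incr_n f (S q)) by (lia || exact Hf).
  rewrite (Series_incr_n (tail f q) (S q)) by (lia || now apply ex_series_tail).
  simpl pred. rewrite <- !sum_n_Reals.
  assert (Z : sum_n (tail f q) q = 0).
  { rewrite (sum_n_ext_loc _ (fun _ => 0)).
    - rewrite sum_n_const. apply Rmult_0_r.
    - intros n Hn. unfold tail. apply Nat.leb_le in Hn. now rewrite Hn. }
  rewrite Z.
  rewrite (Series_ext (fun k => tail f q (S q + k)) (fun k => f (S q + k)%nat)).
  - ring.
  - intros k. unfold tail. replace (S q + k <=? q) with false; [reflexivity|].
    symmetry. apply Nat.leb_gt. lia.
Qed.

Lemma is_lim_seq_Series_tail (f : nat -> R) : (forall k, 0 <= f k) -> ex_series f ->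
  is_lim_seq (fun q => Series (tail f q)) 0.
Proof.
  intros H Hf.
  apply is_lim_seq_ext with (fun q => Series f - sum_n f q).
  - intros q. symmetry. now apply Series_tail.
  - replace 0 with (Series f - Series f) by ring.
    apply is_lim_seq_minus'; [apply is_lim_seq_const|].
    exact (Series_correct f Hf).
Qed.

(** The number 1 written as a series, to be subtracted from [sieve_sum] term by term. *)
Definition delta_one (n : nat) : C := if n =? 1 then RtoC 1 else RtoC 0.

Lemma CSeries_delta_one : abs_summable delta_one /\ CSeries delta_one = RtoC 1.
Proof.
  assert (Z : abs_summable (fun n => delta_one (S (S n)))).
  { apply abs_summable_le with (fun n => 0 * npow 2 n).
    - intros n. unfold delta_one; simpl. rewrite Cmod_0. lra.
    - apply ex_series_Rscal, ex_series_npow. lra. }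
  assert (Y := proj1 (abs_summable_incr_1 (fun n => delta_one (S n))) Z).
  assert (X := proj1 (abs_summable_incr_1 delta_one) Y).
  split; [exact X|]. rewrite CSeries_incr_1, (CSeries_incr_1 (fun n => delta_one (S n))) by assumption.
  rewrite (CSeries_ext (fun n => delta_one (S (S n))) (fun n => 0 * delta_one (S (S n)))%C).
  - rewrite CSeries_scal by exact Z. unfold delta_one; simpl. ring.
  - intros n. unfold delta_one; simpl. ring.
Qed.

(** Among the positive integers up to [q] only 1 survives, since every [n] in [2..q] is removed by
    itself. *)
Lemma sieve_sum_minus_1 (a : nat -> C) (sigma : R) (q : nat) : 1 < sigma -> cmult a sigma ->
  (1 <= q)%nat -> Cmod (sieve_sum a q - 1)%C <= Series (tail (npow sigma) q).
Proof.
  intros Hs Ha Hq. destruct CSeries_delta_one as [D1 D2]. rewrite <- D2.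
  unfold sieve_sum.
  rewrite <- CSeries_minus; [|now apply abs_summable_sieved with sigma|exact D1].
  apply Cmod_CSeries_le.
  - intros n. unfold tail, delta_one. destruct (Nat.leb_spec n q) as [H|H].
    + unfold sieved.
      destruct n as [|[|n]].
      * rewrite (cmult_0 _ _ Ha). simpl.
        replace ((if rough q 0 then 0 else 0) - 0)%C with (RtoC 0) by (destruct (rough q 0); ring).
        rewrite Cmod_0. lra.
      * rewrite rough_one, (cmult_1 _ _ Ha). simpl.
        replace (1 - 1)%C with (RtoC 0) by ring. rewrite Cmod_0. lra.
      * rewrite rough_small by lia. simpl.
        replace (0 - 0)%C with (RtoC 0) by ring. rewrite Cmod_0. lra.
    + replace (n =? 1) with false by (symmetry; apply Nat.eqb_neq; lia).
      replace (sieved a q n - 0)%C with (sieved a q n) by ring. now apply Cmod_sieved.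
  - apply ex_series_tail; [apply npow_ge_0|now apply ex_series_npow].
Qed.

Lemma sieve_ln_small (a : nat -> C) (sigma : R) (q : nat) : 1 < sigma -> cmult a sigma ->
  (1 <= q)%nat -> Cmod (sieve_ln a q) <= Series (tail (fun n => ln (INR n) * npow sigma n) q).
Proof.
  intros Hs Ha Hq. unfold sieve_ln.
  apply Cmod_CSeries_le.
  - intros n. unfold tail. destruct (Nat.leb_spec n q) as [H|H].
    + unfold sieved. destruct n as [|[|n]].
      * rewrite (cmult_0 _ _ Ha).
        replace (RtoC (ln (INR 0)) * (if rough q 0 then 0 else 0))%C with (RtoC 0)
          by (destruct (rough q 0); ring).
        rewrite Cmod_0. lra.
      * simpl INR. rewrite ln_1, Cmult_0_l, Cmod_0. lra.
      * rewrite rough_small by lia. rewrite Cmult_0_r, Cmod_0. lra.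
    + now apply Cmod_ln_sieved.
  - apply ex_series_tail; [|now apply ex_series_ln_npow].
    intros n. apply ln_npow_ge_0.
Qed.

Lemma npow_lt_1 (sigma : R) (n : nat) : 0 < sigma -> (2 <= n)%nat -> npow sigma n < 1.
Proof.
  intros Hs Hn. destruct n as [|n]; [lia|]. unfold npow. rewrite <- exp_0. apply exp_increasing.
  assert (0 < ln (INR (S n))); [|nra].
  rewrite <- ln_1. apply ln_increasing; [lra|]. apply lt_1_INR. lia.
Qed.

Lemma one_minus_neq_0 (w : C) : Cmod w < 1 -> (1 - w)%C <> RtoC 0.
Proof.
  intros H E. assert (w = RtoC 1).
  { replace w with (1 - (1 - w))%C by ring. rewrite E. ring. }
  subst w. rewrite Cmod_1 in H. lra.
Qed.

Lemma cmult_one_minus_neq_0 (a : nat -> C) (sigma : R) (q : nat) : 1 < sigma -> cmult a sigma ->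
  (2 <= q)%nat -> (1 - a q)%C <> RtoC 0.
Proof.
  intros Hs Ha Hq. apply one_minus_neq_0. rewrite (cmult_mod _ _ Ha).
  apply npow_lt_1; [lra|exact Hq].
Qed.

Lemma sieve_sum_step_neq_0 (a : nat -> C) (sigma : R) (q : nat) : 1 < sigma -> cmult a sigma ->
  (1 <= q)%nat -> sieve_sum a (S q) <> RtoC 0 -> sieve_sum a q <> RtoC 0.
Proof.
  intros Hs Ha Hq H E. apply H. destruct (rough q (S q)) eqn:R.
  - rewrite (sieve_sum_prime a sigma q Hs Ha Hq R), E. ring.
  - destruct (sieve_composite a q Hq R) as [-> _]. exact E.
Qed.

(** Backward induction: a zero at [q] would persist at [S q], while for large [q] the sieved sum is
    at distance less than 1 from 1. *)
Lemma sieve_sum_neq_0 (a : nat -> C) (sigma : R) (q : nat) : 1 < sigma -> cmult a sigma ->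
  (1 <= q)%nat -> sieve_sum a q <> RtoC 0.
Proof.
  intros Hs Ha Hq.
  assert (X : exists k, sieve_sum a (k + q) <> RtoC 0).
  { assert (Y := is_lim_seq_Series_tail (npow sigma) (npow_ge_0 sigma) (ex_series_npow sigma Hs)).
    apply is_lim_seq_spec in Y. destruct (Y (mkposreal 1 Rlt_0_1)) as [N HN].
    exists N. specialize (HN (N + q)%nat ltac:(lia)). simpl in HN. rewrite Rminus_0_r in HN.
    intros E. generalize (sieve_sum_minus_1 a sigma (N + q) Hs Ha ltac:(lia)).
    rewrite E. replace (0 - 1)%C with (- (1))%C by ring. rewrite Cmod_m1.
    generalize (Rle_abs (Series (tail (npow sigma) (N + q)))). lra. }
  destruct X as [k Hk]. induction k as [|k IH]; [exact Hk|].
  apply IH. apply sieve_sum_step_neq_0 with sigma; trivial. lia.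
Qed.

Definition euler_term (a : nat -> C) (q : nat) : C :=
  if is_prime q then (RtoC (ln (INR q)) * (a q / (1 - a q)))%C else RtoC 0.

(** Logarithmic differentiation of a single sieving step; for composite [S q] nothing changes and
    the Euler term is 0. *)
Lemma euler_term_step (a : nat -> C) (sigma : R) (q : nat) : 1 < sigma -> cmult a sigma ->
  (1 <= q)%nat ->
  (sieve_ln a q / sieve_sum a q = euler_term a (S q) + sieve_ln a (S q) / sieve_sum a (S q))%C.
Proof.
  intros Hs Ha Hq. unfold euler_term, is_prime. replace (S q - 1)%nat with q by lia.
  assert (N := sieve_sum_neq_0 a sigma q Hs Ha Hq).
  destruct (rough q (S q)) eqn:R.
  - rewrite (sieve_sum_prime a sigma q Hs Ha Hq R), (sieve_ln_prime a sigma q Hs Ha Hq R).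
    assert (M := cmult_one_minus_neq_0 a sigma (S q) Hs Ha ltac:(lia)).
    field. now split.
  - destruct (sieve_composite a q Hq R) as [-> ->]. ring.
Qed.

(** Telescoping [euler_term_step] leaves the quotient [sieve_ln / sieve_sum] at a late stage as
    remainder. It tends to 0, because its numerator is bounded by a tail and its denominator tends
    to 1. *)
Lemma is_series_euler (a : nat -> C) (sigma : R) : 1 < sigma -> cmult a sigma ->
  is_series (fun k => Re (euler_term a (S (S k)))) (Re (sieve_ln a 1 / sieve_sum a 1)%C).
Proof.
  intros Hs Ha.
  assert (P : forall n, @eq R (sum_n (fun k => Re (euler_term a (S (S k)))) n)
    (Re (sieve_ln a 1 / sieve_sum a 1)%C - Re (sieve_ln a (S (S n)) / sieve_sum a (S (S n)))%C)).
  { assert (RP : forall z w : C, Re (z + w)%C = Re z + Re w) by (intros [] []; reflexivity).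
    induction n as [|n IH].
    - rewrite sum_O, (euler_term_step a sigma 1 Hs Ha) by lia. rewrite RP. ring.
    - rewrite sum_Sn, IH, (euler_term_step a sigma (S (S n)) Hs Ha) by lia.
      rewrite RP. unfold plus; simpl. ring. }
  assert (G : is_lim_seq (sum_n (fun k => Re (euler_term a (S (S k)))))
    (Re (sieve_ln a 1 / sieve_sum a 1)%C)); [|exact G].
  apply is_lim_seq_ext with (fun n => Re (sieve_ln a 1 / sieve_sum a 1)%C -
    Re (sieve_ln a (S (S n)) / sieve_sum a (S (S n)))%C); [intros n; now rewrite P|].
  rewrite <- (Rminus_0_r (Re (sieve_ln a 1 / sieve_sum a 1)%C)) at 1.
  apply is_lim_seq_minus'; [apply is_lim_seq_const|].
  apply is_lim_seq_abs_0.
  assert (T0 := is_lim_seq_Series_tail (npow sigma) (npow_ge_0 sigma) (ex_series_npow sigma Hs)).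
  assert (LP : forall k, 0 <= ln (INR k) * npow sigma k).
  { intros k. apply ln_npow_ge_0. }
  assert (T1 := is_lim_seq_Series_tail _ LP (ex_series_ln_npow sigma Hs)).
  apply is_lim_seq_incr_1, is_lim_seq_incr_1 in T0.
  apply is_lim_seq_incr_1, is_lim_seq_incr_1 in T1.
  apply is_lim_seq_le_le_loc with (u := fun _ => 0)
    (w := fun n => 2 * Series (tail (fun n => ln (INR n) * npow sigma n) (S (S n)))).
  (* Once the tail is below 1/2, the sieved sum has modulus at least 1/2; hence the factor 2 in the
     majorant. *)
  - apply is_lim_seq_spec in T0. destruct (T0 (mkposreal (1/2) ltac:(lra))) as [N HN].
    exists N. intros n Hn. specialize (HN n Hn). simpl pos in HN. rewrite Rminus_0_r in HN.
    split; [apply Rabs_pos|].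
    eapply Rle_trans; [apply re_le_Cmod|].
    rewrite Cmod_div by (apply sieve_sum_neq_0 with sigma; trivial; lia).
    generalize (sieve_ln_small a sigma (S (S n)) Hs Ha ltac:(lia)). intros H1.
    generalize (sieve_sum_minus_1 a sigma (S (S n)) Hs Ha ltac:(lia)). intros H2.
    generalize (Cmod_triangle (sieve_sum a (S (S n))) (- (sieve_sum a (S (S n)) - 1))%C).
    replace (sieve_sum a (S (S n)) + - (sieve_sum a (S (S n)) - 1))%C with (RtoC 1) by ring.
    rewrite Cmod_1, Cmod_opp. intros H3.
    generalize (Rle_abs (Series (tail (npow sigma) (S (S n))))). intros H4.
    set (T := Series (tail (fun n => ln (INR n) * npow sigma n) (S (S n)))) in *.
    assert (H5 : / Cmod (sieve_sum a (S (S n))) <= 2).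
    { replace 2 with (/ (1/2)) by field. apply Rinv_le_contravar; lra. }
    unfold Rdiv. generalize (Cmod_ge_0 (sieve_ln a (S (S n)))). intros H6.
    assert (0 < / Cmod (sieve_sum a (S (S n)))) by (apply Rinv_0_lt_compat; lra).
    nra.
  - apply is_lim_seq_const.
  - apply (is_lim_seq_scal_l _ 2) in T1. simpl in T1. rewrite Rmult_0_r in T1. exact T1.
Qed.

(* [|sin (arg z)|], a substitute for [|arg z|] that needs no branch of the logarithm. *)
Definition sin_arg (z : C) : R := Rabs (Im z) / Cmod z.

Lemma sin_arg_ge_0 (z : C) : z <> RtoC 0 -> 0 <= sin_arg z.
Proof.
  intros H. unfold sin_arg. apply Cmod_gt_0 in H.
  apply Rmult_le_pos; [apply Rabs_pos|]. left. now apply Rinv_0_lt_compat.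
Qed.

(** The addition formula for [sin (arg (z w) - arg z)], with both cosines bounded by 1. The identity
    [I] below is that formula cleared of denominators. *)
Lemma sin_arg_factor (z w : C) : z <> RtoC 0 -> w <> RtoC 0 ->
  sin_arg w <= sin_arg z + sin_arg (z * w)%C.
Proof.
  intros Hz Hw. unfold sin_arg. rewrite Cmod_mult.
  apply Cmod_gt_0 in Hz. apply Cmod_gt_0 in Hw.
  set (Z := Cmod z) in *. set (W := Cmod w) in *.
  assert (I : Im w * (Z * Z) = Re z * Im (z * w)%C - Im z * Re (z * w)%C).
  { unfold Z. rewrite Cmod_sqr. destruct z, w; unfold Re, Im; simpl. ring. }
  assert (J : Rabs (Im w) * (Z * Z) <= Z * Rabs (Im (z * w)%C) + Rabs (Im z) * (Z * W)).
  { rewrite <- (Rabs_pos_eq (Z * Z)) by (apply Rmult_le_pos; lra). rewrite <- Rabs_mult, I.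
    unfold Rminus. eapply Rle_trans; [apply Rabs_triang|]. rewrite Rabs_Ropp, !Rabs_mult.
    apply Rplus_le_compat.
    - apply Rmult_le_compat_r; [apply Rabs_pos|apply re_le_Cmod].
    - apply Rmult_le_compat_l; [apply Rabs_pos|].
      unfold Z, W. rewrite <- Cmod_mult. apply re_le_Cmod. }
  apply Rmult_le_reg_r with (W * (Z * Z)).
  { apply Rmult_lt_0_compat; [|apply Rmult_lt_0_compat]; lra. }
  replace (Rabs (Im w) / W * (W * (Z * Z))) with (Rabs (Im w) * (Z * Z)) by (field; lra).
  replace ((Rabs (Im z) / Z + Rabs (Im (z * w)%C) / (Z * W)) * (W * (Z * Z))) with
    (Z * Rabs (Im (z * w)%C) + Rabs (Im z) * (Z * W)) by (field; lra).
  exact J.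
Qed.

Definition prime_sin_arg (a : nat -> C) (q : nat) : R :=
  if is_prime q then sin_arg (1 - a q)%C else 0.

Lemma sin_arg_sieve_step (a : nat -> C) (sigma : R) (q : nat) : 1 < sigma -> cmult a sigma ->
  (1 <= q)%nat ->
  sin_arg (sieve_sum a q) <= prime_sin_arg a (S q) + sin_arg (sieve_sum a (S q)).
Proof.
  intros Hs Ha Hq. unfold prime_sin_arg, is_prime. replace (S q - 1)%nat with q by lia.
  assert (N := sieve_sum_neq_0 a sigma q Hs Ha Hq).
  destruct (rough q (S q)) eqn:R.
  - rewrite (sieve_sum_prime a sigma q Hs Ha Hq R). apply sin_arg_factor; [|exact N].
    apply cmult_one_minus_neq_0 with sigma; trivial. lia.
  - destruct (sieve_composite a q Hq R) as [-> _]. lra.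
Qed.

(** The disc of radius [|w|] about 1 is seen from 0 under a half-angle of sine [|w|]. Algebraically,
    [|w|^2 |1 - w|^2 - (Im w)^2] is the square of [x (1 - x) - y^2], where [w = x + iy]. *)
Lemma sin_arg_one_minus (w : C) : Cmod w < 1 -> sin_arg (1 - w)%C <= Cmod w.
Proof.
  intros H. assert (N := one_minus_neq_0 w H). apply Cmod_gt_0 in N.
  unfold sin_arg. apply Rmult_le_reg_r with (Cmod (1 - w)%C); [exact N|].
  unfold Rdiv. rewrite Rmult_assoc, Rinv_l, Rmult_1_r by lra.
  apply Rsqr_incr_0_var; [|generalize (Cmod_ge_0 w); nra].
  rewrite <- Rsqr_abs. unfold Rsqr.
  replace (Cmod w * Cmod (1 - w)%C * (Cmod w * Cmod (1 - w)%C)) with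
    (Cmod w * Cmod w * (Cmod (1 - w)%C * Cmod (1 - w)%C)) by ring.
  rewrite !Cmod_sqr. destruct w as [x y]; unfold Re, Im; simpl.
  generalize (Rle_0_sqr (x * (1 - x) - y * y)). unfold Rsqr. nra.
Qed.

Lemma prime_sin_arg_bounds (a : nat -> C) (sigma : R) (q : nat) : 1 < sigma -> cmult a sigma ->
  (2 <= q)%nat -> 0 <= prime_sin_arg a q <= npow sigma q.
Proof.
  intros Hs Ha Hq. unfold prime_sin_arg. destruct (is_prime q).
  - rewrite <- (cmult_mod _ _ Ha). split.
    + apply sin_arg_ge_0. now apply cmult_one_minus_neq_0 with sigma.
    + apply sin_arg_one_minus. rewrite (cmult_mod _ _ Ha). apply npow_lt_1; [lra|exact Hq].
  - split; [lra|apply npow_ge_0].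
Qed.

Lemma is_lim_seq_sin_arg_sieve (a : nat -> C) (sigma : R) : 1 < sigma -> cmult a sigma ->
  is_lim_seq (fun q => sin_arg (sieve_sum a (S q))) 0.
Proof.
  intros Hs Ha.
  assert (T0 := is_lim_seq_Series_tail (npow sigma) (npow_ge_0 sigma) (ex_series_npow sigma Hs)).
  apply is_lim_seq_incr_1 in T0.
  apply is_lim_seq_le_le_loc with (u := fun _ => 0)
    (w := fun n => 2 * Series (tail (npow sigma) (S n))).
  - assert (T1 := T0). apply is_lim_seq_spec in T0.
    destruct (T0 (mkposreal (1/2) ltac:(lra))) as [N HN].
    exists N. intros n Hn. specialize (HN n Hn). simpl pos in HN. rewrite Rminus_0_r in HN.
    split; [apply sin_arg_ge_0; apply sieve_sum_neq_0 with sigma; trivial; lia|].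
    generalize (sieve_sum_minus_1 a sigma (S n) Hs Ha ltac:(lia)). intros H2.
    generalize (Cmod_triangle (sieve_sum a (S n)) (- (sieve_sum a (S n) - 1))%C).
    replace (sieve_sum a (S n) + - (sieve_sum a (S n) - 1))%C with (RtoC 1) by ring.
    rewrite Cmod_1, Cmod_opp. intros H3.
    generalize (Rle_abs (Series (tail (npow sigma) (S n)))). intros H4.
    assert (H5 : / Cmod (sieve_sum a (S n)) <= 2).
    { replace 2 with (/ (1/2)) by field. apply Rinv_le_contravar; lra. }
    assert (H6 : Rabs (Im (sieve_sum a (S n))) <= Cmod (sieve_sum a (S n) - 1)%C).
    { replace (Im (sieve_sum a (S n))) with (Im (sieve_sum a (S n) - 1)%C); [apply Im_le_Cmod|].
      destruct (sieve_sum a (S n)); unfold Im; simpl. ring. }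
    unfold sin_arg, Rdiv. generalize (Rabs_pos (Im (sieve_sum a (S n)))). intros H7.
    assert (0 < / Cmod (sieve_sum a (S n))) by (apply Rinv_0_lt_compat; lra).
    nra.
  - apply is_lim_seq_const.
  - apply (is_lim_seq_scal_l _ 2) in T0. simpl in T0. rewrite Rmult_0_r in T0. exact T0.
Qed.

Lemma ex_series_prime_sin_arg (a : nat -> C) (sigma : R) : 1 < sigma -> cmult a sigma ->
  ex_series (fun k => prime_sin_arg a (S (S (S k)))).
Proof.
  intros Hs Ha. apply ex_series_Rle with (fun k => npow sigma (S (S (S k)))).
  - intros n. generalize (prime_sin_arg_bounds a sigma (S (S (S n))) Hs Ha ltac:(lia)).
    intros [H1 H2]. now rewrite Rabs_pos_eq.
  - apply (ex_series_incr_1 (fun k => npow sigma (S (S k)))).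
    apply (ex_series_incr_1 (fun k => npow sigma (S k))).
    apply (ex_series_incr_1 (npow sigma)). now apply ex_series_npow.
Qed.

(* When the full sum is real, the phase of the factor at 2 is cancelled by the phases of
   the factors at the odd primes. *)
Lemma sin_arg_two_le (a : nat -> C) (sigma : R) : 1 < sigma -> cmult a sigma ->
  Im (sieve_sum a 1) = 0 ->
  sin_arg (1 - a 2%nat)%C <= Series (fun k => prime_sin_arg a (S (S (S k)))).
Proof.
  intros Hs Ha Hi.
  assert (H2 : sin_arg (1 - a 2%nat)%C <= sin_arg (sieve_sum a 2)).
  { rewrite (sieve_sum_prime a sigma 1 Hs Ha ltac:(lia) eq_refl).
    assert (N := sieve_sum_neq_0 a sigma 1 Hs Ha ltac:(lia)).
    assert (M := cmult_one_minus_neq_0 a sigma 2 Hs Ha ltac:(lia)).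
    assert (Z : sin_arg (sieve_sum a 1) = 0)
      by (unfold sin_arg; rewrite Hi, Rabs_R0; unfold Rdiv; ring).
    rewrite Cmult_comm. rewrite <- (Rplus_0_l (sin_arg (_ * _)%C)), <- Z.
    now apply sin_arg_factor. }
  assert (P : forall n, sin_arg (sieve_sum a 2) <=
    sum_n (fun k => prime_sin_arg a (S (S (S k)))) n + sin_arg (sieve_sum a (S (S (S n))))).
  { induction n as [|n IH].
    - rewrite sum_O. apply sin_arg_sieve_step with sigma; trivial. lia.
    - rewrite sum_Sn. unfold plus; simpl plus.
      generalize (sin_arg_sieve_step a sigma (S (S (S n))) Hs Ha ltac:(lia)).
      unfold plus in *. simpl. lra. }
  eapply Rle_trans; [exact H2|].
  assert (Q : Rbar_le (sin_arg (sieve_sum a 2)) (Series (fun k => prime_sin_arg a (S (S (S k)))) + 0)).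
  { eapply is_lim_seq_le; [exact P|apply is_lim_seq_const|].
    apply is_lim_seq_plus'.
    - exact (Series_correct _ (ex_series_prime_sin_arg a sigma Hs Ha)).
    - assert (T := is_lim_seq_sin_arg_sieve a sigma Hs Ha).
      apply is_lim_seq_incr_1, is_lim_seq_incr_1 in T. exact T. }
  rewrite Rplus_0_r in Q. exact Q.
Qed.

(** * Fixed-point enclosures of logarithms and exponentials *)

Lemma nonneg_of_derive (f df : R -> R) (x : R) : 0 <= x -> f 0 = 0 ->
  (forall t, 0 <= t <= x -> is_derive f t (df t)) ->
  (forall t, 0 <= t <= x -> 0 <= df t) -> 0 <= f x.
Proof.
  intros Hx H0 Hd Hp.
  destruct (MVT_gen f 0 x df) as [c [Hc H]].
  - rewrite Rmin_left, Rmax_right by lra. intros t Ht. apply Hd. lra.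
  - rewrite Rmin_left, Rmax_right by lra. intros t Ht. apply continuity_pt_filterlim.
    apply (ex_derive_continuous f). exists (df t). apply Hd. lra.
  - rewrite Rmin_left, Rmax_right in Hc by lra. specialize (Hp c Hc). nra.
Qed.

(** For [j = 1], the first [K] terms of the series of [artanh z = ln ((1 + z) / (1 - z)) / 2]. The
    sum [geom_sum2] below gives the derivative of such a partial sum. *)
Fixpoint atanh_sum (K j : nat) (z : R) : R :=
  match K with O => 0 | S K => z ^ j / INR j + atanh_sum K (S (S j)) z end.

Fixpoint geom_sum2 (K j : nat) (z : R) : R :=
  match K with O => 0 | S K => z ^ j + geom_sum2 K (S (S j)) z end.

Lemma geom_sum2_eq (K j : nat) (z : R) :
  (1 - z * z) * geom_sum2 K j z = z ^ j - z ^ (j + 2 * K).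
Proof.
  revert j. induction K as [|K IH]; intros j; simpl geom_sum2.
  - rewrite Nat.add_0_r. ring.
  - rewrite Rmult_plus_distr_l, IH.
    replace (S (S j) + 2 * K)%nat with (j + 2 * S K)%nat by lia. simpl pow. ring.
Qed.

Lemma is_derive_atanh_sum (K j : nat) (z : R) :
  is_derive (atanh_sum K (S j)) z (geom_sum2 K j z).
Proof.
  revert j. induction K as [|K IH]; intros j.
  - apply (is_derive_const (V := R_NormedModule) 0 z).
  - cbn [atanh_sum geom_sum2].
    apply (is_derive_plus (V := R_NormedModule) (fun z => z ^ S j / INR (S j))
      (fun z => atanh_sum K (S (S (S j))) z)); [|apply IH].
    auto_derive; [trivial|].
    replace (match j with O => 1 | S _ => INR j + 1 end) with (INR (S j)) by reflexivity.
    field. apply not_0_INR. lia.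
Qed.

Lemma is_derive_atanh (z : R) : 0 <= z < 1 ->
  is_derive (fun z => ln ((1 + z) / (1 - z))) z (2 / (1 - z * z)).
Proof.
  intros Hz. auto_derive.
  - repeat split; try lra. apply Rdiv_lt_0_compat; lra.
  - field. repeat split; nra.
Qed.

Lemma atanh_lower (K : nat) (z : R) : 0 <= z <= 1 / 3 ->
  2 * atanh_sum K 1 z <= ln ((1 + z) / (1 - z)).
Proof.
  intros Hz.
  assert (Z0 : forall K j, atanh_sum K (S j) 0 = 0).
  { induction K0 as [|K0 IH]; intros j; [reflexivity|]. cbn [atanh_sum]. rewrite IH.
    simpl pow. unfold Rdiv. ring. }
  enough (0 <= (fun z => ln ((1 + z) / (1 - z)) - 2 * atanh_sum K 1 z) z) as Q
    by (cbv beta in Q; lra).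
  apply (nonneg_of_derive (fun z => ln ((1 + z) / (1 - z)) - 2 * atanh_sum K 1 z)
    (fun z => 2 / (1 - z * z) - 2 * geom_sum2 K 0 z)); [lra| | |].
  - rewrite Z0. replace ((1 + 0) / (1 - 0)) with 1 by field. rewrite ln_1. ring.
  - intros t Ht.
    apply (is_derive_minus (V := R_NormedModule) (fun z => ln ((1 + z) / (1 - z)))
      (fun z => 2 * atanh_sum K 1 z)).
    + apply is_derive_atanh. lra.
    + apply (is_derive_scal (atanh_sum K 1)). apply is_derive_atanh_sum.
  - intros t Ht. apply Rmult_le_reg_l with (1 - t * t); [nra|].
    generalize (geom_sum2_eq K 0 t). intros G.
    replace ((1 - t * t) * (2 / (1 - t * t) - 2 * geom_sum2 K 0 t)) with
      (2 - 2 * ((1 - t * t) * geom_sum2 K 0 t)) by (field; nra).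
    rewrite G. simpl (0 + 2 * K)%nat. change (t ^ 0) with 1.
    assert (0 <= t ^ (K + (K + 0))) by (apply pow_le; lra). lra.
Qed.

(** Compare derivatives: the remainder has derivative [2 z^(2K) / (1 - z^2)], and
    [2 / (1 - 1/9) = 9/4]. The range [z <= 1/3] is that of [z = 1 / (2n + 1)] with [n >= 1]. *)
Lemma atanh_upper (K : nat) (z : R) : 0 <= z <= 1 / 3 ->
  ln ((1 + z) / (1 - z)) <= 2 * atanh_sum K 1 z + 9 / 4 * (z ^ S (2 * K) / INR (S (2 * K))).
Proof.
  intros Hz.
  assert (Z0 : forall K j, atanh_sum K (S j) 0 = 0).
  { induction K0 as [|K0 IH]; intros j; [reflexivity|]. cbn [atanh_sum]. rewrite IH.
    simpl pow. unfold Rdiv. ring. }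
  enough (0 <= (fun z => (9 / 4 * atanh_sum 1 (S (2 * K)) z + 2 * atanh_sum K 1 z) -
    ln ((1 + z) / (1 - z))) z) as Q by (cbn [atanh_sum] in Q; lra).
  apply (nonneg_of_derive (fun z => (9 / 4 * atanh_sum 1 (S (2 * K)) z + 2 * atanh_sum K 1 z) -
    ln ((1 + z) / (1 - z)))
    (fun z => (9 / 4 * geom_sum2 1 (2 * K) z + 2 * geom_sum2 K 0 z) - 2 / (1 - z * z))); [lra| | |].
  - rewrite !Z0. replace ((1 + 0) / (1 - 0)) with 1 by field. rewrite ln_1. ring.
  - intros t Ht.
    apply (is_derive_minus (V := R_NormedModule)
      (fun z => 9 / 4 * atanh_sum 1 (S (2 * K)) z + 2 * atanh_sum K 1 z)
      (fun z => ln ((1 + z) / (1 - z)))).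
    + apply (is_derive_plus (V := R_NormedModule) (fun z => 9 / 4 * atanh_sum 1 (S (2 * K)) z)
        (fun z => 2 * atanh_sum K 1 z)).
      * apply (is_derive_scal (atanh_sum 1 (S (2 * K)))). apply is_derive_atanh_sum.
      * apply (is_derive_scal (atanh_sum K 1)). apply is_derive_atanh_sum.
    + apply is_derive_atanh. lra.
  - intros t Ht. apply Rmult_le_reg_l with (1 - t * t); [nra|].
    generalize (geom_sum2_eq K 0 t). intros G. cbn [geom_sum2].
    replace ((1 - t * t) * (9 / 4 * (t ^ (2 * K) + 0) + 2 * geom_sum2 K 0 t - 2 / (1 - t * t))) with
      (9 / 4 * (1 - t * t) * t ^ (2 * K) + 2 * ((1 - t * t) * geom_sum2 K 0 t) - 2) by (field; nra).
    rewrite G. change (0 + 2 * K)%nat with (2 * K)%nat. change (t ^ 0) with 1.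
    assert (0 <= t ^ (2 * K)) by (apply pow_le; lra).
    assert (t * t <= 1 / 9) by nra. nra.
Qed.

(** The remainder is dominated term by term by [u^(K+1) / (K+1)!] times the whole series, because
    [(K+1)! n! <= (K+1+n)!]. *)
Lemma exp_partial_sum (u : R) (K : nat) : 0 <= u ->
  sum_f_R0 (fun k => u ^ k / INR (fact k)) K <= exp u <=
  sum_f_R0 (fun k => u ^ k / INR (fact k)) K + u ^ S K / INR (fact (S K)) * exp u.
Proof.
  intros Hu.
  assert (S0 : is_series (fun k => u ^ k / INR (fact k)) (exp u)).
  { generalize (is_exp_Reals u). intros H. apply is_pseries_R in H.
    eapply is_series_ext; [|exact H]. intros n. simpl. unfold Rdiv. ring. }
  assert (P : forall k, 0 <= u ^ k / INR (fact k)).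
  { intros k. apply Rmult_le_pos; [now apply pow_le|]. left. apply Rinv_0_lt_compat, INR_fact_lt_0. }
  assert (EX : ex_series (fun k => u ^ k / INR (fact k))) by (eexists; exact S0).
  assert (EXS : ex_series (fun k => u ^ (S K + k) / INR (fact (S K + k)))).
  { apply (ex_series_incr_n (fun k => u ^ k / INR (fact k)) (S K)). exact EX. }
  assert (E : exp u = sum_f_R0 (fun k => u ^ k / INR (fact k)) K +
    Series (fun k => u ^ (S K + k) / INR (fact (S K + k)))).
  { rewrite <- (is_series_unique _ _ S0), (Series_incr_n _ (S K)); [reflexivity|lia|exact EX]. }
  assert (Z : 0 <= Series (fun k => u ^ (S K + k) / INR (fact (S K + k)))).
  { apply Series_nonneg; [|exact EXS]. intros n. apply P. }
  split; [lra|]. rewrite E at 1. apply Rplus_le_compat_l.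
  rewrite <- (is_series_unique _ _ S0), <- Series_scal_l.
  apply Series_le; [|now apply ex_series_Rscal].
  intros n. split; [apply P|].
  assert (F : INR (fact (S K)) * INR (fact n) <= INR (fact (S K + n))).
  { rewrite <- mult_INR. apply le_INR. generalize (S K). intros a. clear.
    induction n as [|n IH].
    - rewrite Nat.add_0_r. simpl. lia.
    - rewrite <- plus_n_Sm. cbn [fact]. nia. }
  rewrite pow_add.
  replace (u ^ S K / INR (fact (S K)) * (u ^ n / INR (fact n))) with
    (u ^ S K * u ^ n * / (INR (fact (S K)) * INR (fact n)))
    by (field; split; apply INR_fact_neq_0).
  apply Rmult_le_compat_l; [apply Rmult_le_pos; now apply pow_le|].
  apply Rinv_le_contravar; [|exact F]. apply Rmult_lt_0_compat; apply INR_fact_lt_0.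
Qed.

(* Horner scheme for [sum_(i < K) u^i j!/(i+j)! + X u^K j!/(K+j)!]. *)
Fixpoint exp_horner (K j : nat) (X u : R) : R :=
  match K with O => X | S K => 1 + u / INR (S j) * exp_horner K (S j) X u end.

Lemma exp_horner_eq (K j : nat) (X u : R) :
  u ^ j / INR (fact j) * exp_horner (S K) j X u =
  sum_f_R0 (fun k => u ^ (j + k) / INR (fact (j + k))) K +
  u ^ (S K + j) / INR (fact (S K + j)) * X.
Proof.
  revert j. induction K as [|K IH]; intros j.
  - simpl sum_f_R0. simpl exp_horner. rewrite Nat.add_0_r.
    change (1 + j)%nat with (S j). rewrite fact_simpl, mult_INR.
    replace (u ^ S j) with (u * u ^ j) by reflexivity.
    change (match j with O => 1 | S _ => INR j + 1 end) with (INR (S j)).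
    field. split; try apply INR_fact_neq_0; apply not_0_INR; lia.
  - change (exp_horner (S (S K)) j X u) with (1 + u / INR (S j) * exp_horner (S K) (S j) X u).
    rewrite (decomp_sum _ (S K)) by lia. simpl pred.
    rewrite (sum_eq (fun i => u ^ (j + S i) / INR (fact (j + S i)))
      (fun i => u ^ (S j + i) / INR (fact (S j + i)))).
    2: { intros i _. now rewrite <- plus_n_Sm. }
    replace (S (S K) + j)%nat with (S K + S j)%nat by lia.
    rewrite Rplus_assoc, <- IH, Nat.add_0_r.
    rewrite fact_simpl, mult_INR. replace (u ^ S j) with (u * u ^ j) by reflexivity.
    field. split; try apply INR_fact_neq_0; apply not_0_INR; lia.
Qed.

Lemma exp_horner_lower (K : nat) (u : R) : 0 <= u -> exp_horner (S K) 0 0 u <= exp u.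
Proof.
  intros Hu. generalize (exp_horner_eq K 0 0 u). simpl (u ^ 0). simpl (fact 0). intros H.
  replace (1 / INR 1 * exp_horner (S K) 0 0 u) with (exp_horner (S K) 0 0 u) in H by (simpl INR; field).
  rewrite H, Rmult_0_r, Rplus_0_r. apply exp_partial_sum, Hu.
Qed.

Lemma exp_horner_upper (K : nat) (X u : R) : 0 <= u -> exp u <= X -> exp u <= exp_horner (S K) 0 X u.
Proof.
  intros Hu HX. generalize (exp_horner_eq K 0 X u). simpl (u ^ 0). simpl (fact 0). intros H.
  replace (1 / INR 1 * exp_horner (S K) 0 X u) with (exp_horner (S K) 0 X u) in H by (simpl INR; field).
  rewrite H, Nat.add_0_r. destruct (exp_partial_sum u K Hu) as [_ H2].
  eapply Rle_trans; [exact H2|]. apply Rplus_le_compat_l.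
  apply Rmult_le_compat_l; [|exact HX].
  apply Rmult_le_pos; [now apply pow_le|]. left. apply Rinv_0_lt_compat, INR_fact_lt_0.
Qed.

(** This is [2^44]: reals are enclosed by integers in units of [2^(-44)], and the enclosures are
    computed in exact integer arithmetic. *)
Definition scale : Z := 17592186044416.

Definition encl (lo : Z) (x : R) (hi : Z) : Prop := IZR lo <= IZR scale * x <= IZR hi.

Lemma scale_pos : 0 < IZR scale.
Proof. apply IZR_lt. reflexivity. Qed.

Lemma Zdiv_floor (x y : Z) : (0 < y)%Z -> IZR (x / y) <= IZR x / IZR y <= IZR (x / y + 1).
Proof.
  intros Hy. assert (Hy' : 0 < IZR y) by now apply IZR_lt.
  generalize (Z.div_mod x y) (Z.mod_pos_bound x y Hy). intros H1 H2.
  split; apply Rmult_le_reg_r with (IZR y); trivial; unfold Rdiv;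
    rewrite Rmult_assoc, Rinv_l, Rmult_1_r by lra; rewrite <- mult_IZR; apply IZR_le; lia.
Qed.

(** Here [t] stands for [scale * z^j] with [z = 1 / d] and [d2 = d^2], so the next odd power costs
    one integer division. Quotients are rounded down here and up in [ln_hi]. *)
Fixpoint ln_lo (K : nat) (j d2 t : Z) : Z :=
  match K with O => 0 | S K => t / j + ln_lo K (j + 2) d2 (t / d2) end%Z.

(** The final [2 * t] covers the remainder, at most [9/8 * z^j / j], of the artanh series. *)
Fixpoint ln_hi (K : nat) (j d2 t : Z) : Z :=
  match K with O => 2 * t | S K => (t / j + 1) + ln_hi K (j + 2) d2 (t / d2 + 1) end%Z.

Lemma ln_lo_sound (K j : nat) (d2 t : Z) (z : R) : (0 < d2)%Z -> z * z = / IZR d2 ->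
  (1 <= j)%nat -> IZR t <= IZR scale * z ^ j ->
  IZR (ln_lo K (Z.of_nat j) d2 t) <= IZR scale * atanh_sum K j z.
Proof.
  intros Hd Hz. revert j t. induction K as [|K IH]; intros j t Hj Ht.
  - simpl. lra.
  - cbn [ln_lo atanh_sum]. rewrite plus_IZR.
    replace (Z.of_nat j + 2)%Z with (Z.of_nat (S (S j))) by lia.
    assert (Pj : 0 < INR j) by (apply lt_0_INR; lia).
    assert (Pd : 0 < IZR d2) by now apply IZR_lt.
    rewrite Rmult_plus_distr_l. apply Rplus_le_compat.
    + eapply Rle_trans; [apply Zdiv_floor; lia|]. rewrite <- INR_IZR_INZ.
      unfold Rdiv. rewrite <- Rmult_assoc. apply Rmult_le_compat_r; [|exact Ht].
      left. now apply Rinv_0_lt_compat.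
    + apply IH; [lia|]. eapply Rle_trans; [apply Zdiv_floor; lia|].
      replace (z ^ S (S j)) with (z ^ j * / IZR d2) by (rewrite <- Hz; simpl; ring).
      unfold Rdiv. rewrite <- Rmult_assoc. apply Rmult_le_compat_r; [|exact Ht].
      left. now apply Rinv_0_lt_compat.
Qed.

Lemma ln_hi_sound (K j : nat) (d2 t : Z) (z : R) : (0 < d2)%Z -> z * z = / IZR d2 ->
  (1 <= j)%nat -> 0 <= z -> IZR scale * z ^ j <= IZR t ->
  IZR scale * (atanh_sum K j z + 9 / 8 * (z ^ (j + 2 * K) / INR (j + 2 * K))) <=
  IZR (ln_hi K (Z.of_nat j) d2 t).
Proof.
  intros Hd Hz Hj Hz0. revert j t Hj. induction K as [|K IH]; intros j t Hj Ht.
  - cbn [ln_hi atanh_sum]. rewrite Nat.mul_0_r, Nat.add_0_r, mult_IZR.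
    assert (Pj : 1 <= INR j) by (apply (le_INR 1); lia).
    assert (z ^ j / INR j <= z ^ j).
    { apply Rmult_le_reg_r with (INR j); [lra|]. unfold Rdiv.
      rewrite Rmult_assoc, Rinv_l by lra. assert (0 <= z ^ j) by now apply pow_le. nra. }
    assert (0 <= z ^ j) by now apply pow_le.
    generalize scale_pos. intros. nra.
  - cbn [ln_hi atanh_sum]. rewrite plus_IZR.
    replace (Z.of_nat j + 2)%Z with (Z.of_nat (S (S j))) by lia.
    assert (Pj : 0 < INR j) by (apply lt_0_INR; lia).
    assert (Pd : 0 < IZR d2) by now apply IZR_lt.
    rewrite Rplus_assoc, Rmult_plus_distr_l. apply Rplus_le_compat.
    + eapply Rle_trans; [|apply Zdiv_floor; lia]. rewrite <- INR_IZR_INZ.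
      unfold Rdiv. rewrite <- Rmult_assoc. apply Rmult_le_compat_r; [|exact Ht].
      left. now apply Rinv_0_lt_compat.
    + replace (j + 2 * S K)%nat with (S (S j) + 2 * K)%nat by lia.
      apply IH; [lia|]. eapply Rle_trans; [|apply Zdiv_floor; lia].
      replace (z ^ S (S j)) with (z ^ j * / IZR d2) by (rewrite <- Hz; simpl; ring).
      unfold Rdiv. rewrite <- Rmult_assoc. apply Rmult_le_compat_r; [|exact Ht].
      left. now apply Rinv_0_lt_compat.
Qed.

(** With 13 terms the remainder involves [z^27 <= 3^(-27)], which is of the order of the unit
    [2^(-44)]. *)
Definition ln_succ_lo (n lo : Z) : Z :=
  let d := (2 * n + 1)%Z in (lo + 2 * ln_lo 13 1 (d * d) (scale / d))%Z.
Definition ln_succ_hi (n hi : Z) : Z :=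
  let d := (2 * n + 1)%Z in (hi + 2 * ln_hi 13 1 (d * d) (scale / d + 1))%Z.

(* [ln (n + 1) - ln n = 2 artanh (1 / (2 n + 1))]. *)
Lemma encl_ln_succ (n lo hi : Z) : (1 <= n)%Z -> encl lo (ln (IZR n)) hi ->
  encl (ln_succ_lo n lo) (ln (IZR (n + 1))) (ln_succ_hi n hi).
Proof.
  intros Hn [H1 H2]. unfold ln_succ_lo, ln_succ_hi. set (d := (2 * n + 1)%Z).
  assert (Pn : 1 <= IZR n) by now apply IZR_le.
  assert (Ed : IZR d = 2 * IZR n + 1) by (unfold d; now rewrite plus_IZR, mult_IZR).
  set (z := / IZR d).
  assert (Hz : 0 <= z <= 1 / 3).
  { unfold z. split; [left; apply Rinv_0_lt_compat; lra|].
    replace (1 / 3) with (/ 3) by field. apply Rinv_le_contravar; lra. }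
  assert (E : ln (IZR (n + 1)) = ln (IZR n) + ln ((1 + z) / (1 - z))).
  { rewrite <- ln_mult.
    - f_equal. rewrite plus_IZR. unfold z. rewrite Ed. field. lra.
    - lra.
    - apply Rdiv_lt_0_compat; lra. }
  assert (Hd : (0 < d)%Z) by (unfold d; lia).
  assert (Hd2 : (0 < d * d)%Z) by lia.
  assert (Hzz : z * z = / IZR (d * d)).
  { unfold z. rewrite mult_IZR. field. lra. }
  unfold encl. rewrite E, !plus_IZR, !mult_IZR, Rmult_plus_distr_l. generalize scale_pos. intros SP.
  split; apply Rplus_le_compat; trivial.
  - apply Rle_trans with (2 * (IZR scale * atanh_sum 13 1 z)).
    + apply Rmult_le_compat_l; [lra|]. apply (ln_lo_sound 13 1 (d * d)); trivial; try lia.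
      rewrite pow_1. apply (Zdiv_floor scale d Hd).
    + generalize (atanh_lower 13 z Hz). nra.
  - apply Rle_trans with (2 * (IZR scale * (atanh_sum 13 1 z +
      9 / 8 * (z ^ (1 + 2 * 13) / INR (1 + 2 * 13))))).
    + generalize (atanh_upper 13 z Hz). change (S (2 * 13))%nat with (1 + 2 * 13)%nat. nra.
    + apply Rmult_le_compat_l; [lra|]. apply (ln_hi_sound 13 1 (d * d)); trivial; try lia; try lra.
      rewrite pow_1. apply (Zdiv_floor scale d Hd).
Qed.

Fixpoint exp_lo (K : nat) (j u : Z) : Z :=
  match K with O => 0 | S K => scale + (u * exp_lo K (j + 1) u) / (scale * (j + 1)) end%Z.
(** The Horner scheme is seeded with 4, an upper bound of [exp u] for [u <= 13/10], which accounts
    for the whole remainder. *)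
Fixpoint exp_hi (K : nat) (j u : Z) : Z :=
  match K with O => 4 * scale
  | S K => scale + ((u * exp_hi K (j + 1) u) / (scale * (j + 1)) + 1) end%Z.

Lemma exp_lo_sound (K j : nat) (ul : Z) (u : R) : (0 <= ul)%Z -> IZR ul <= IZR scale * u ->
  (0 <= exp_lo K (Z.of_nat j) ul)%Z /\
  IZR (exp_lo K (Z.of_nat j) ul) <= IZR scale * exp_horner K j 0 u.
Proof.
  intros H0 H1. revert j. induction K as [|K IH]; intros j.
  - simpl. split; [lia|lra].
  - cbn [exp_lo exp_horner]. replace (Z.of_nat j + 1)%Z with (Z.of_nat (S j)) by lia.
    destruct (IH (S j)) as [I1 I2]. set (e := exp_lo K (Z.of_nat (S j)) ul) in *.
    assert (SP : (0 < scale * Z.of_nat (S j))%Z) by (unfold scale; lia).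
    generalize scale_pos. intros SP'.
    assert (0 < INR (S j)) by (apply lt_0_INR; lia).
    split.
    + generalize (Z.div_pos (ul * e) (scale * Z.of_nat (S j)) ltac:(nia) SP). unfold scale. lia.
    + rewrite plus_IZR, Rmult_plus_distr_l, Rmult_1_r. apply Rplus_le_compat_l.
      eapply Rle_trans; [apply Zdiv_floor, SP|]. rewrite !mult_IZR, <- INR_IZR_INZ.
      apply Rmult_le_reg_r with (IZR scale * INR (S j)); [nra|].
      replace (IZR ul * IZR e / (IZR scale * INR (S j)) * (IZR scale * INR (S j)))
        with (IZR ul * IZR e) by (field; lra).
      replace (IZR scale * (u / INR (S j) * exp_horner K (S j) 0 u) * (IZR scale * INR (S j)))
        with ((IZR scale * u) * (IZR scale * exp_horner K (S j) 0 u)) by (field; lra).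
      apply Rmult_le_compat; trivial; now apply (IZR_le 0).
Qed.

Lemma exp_hi_sound (K j : nat) (uh : Z) (u : R) : 0 <= u -> IZR scale * u <= IZR uh ->
  0 <= exp_horner K j 4 u /\
  IZR scale * exp_horner K j 4 u <= IZR (exp_hi K (Z.of_nat j) uh).
Proof.
  intros H0 H1. revert j. induction K as [|K IH]; intros j.
  - cbn [exp_hi exp_horner]. rewrite mult_IZR. generalize scale_pos. lra.
  - cbn [exp_hi exp_horner]. replace (Z.of_nat j + 1)%Z with (Z.of_nat (S j)) by lia.
    destruct (IH (S j)) as [I1 I2]. set (e := exp_hi K (Z.of_nat (S j)) uh) in *.
    assert (SP : (0 < scale * Z.of_nat (S j))%Z) by (unfold scale; lia).
    generalize scale_pos. intros SP'.
    assert (0 < INR (S j)) by (apply lt_0_INR; lia).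
    assert (U : 0 <= u / INR (S j)) by (apply Rmult_le_pos; [lra|left; now apply Rinv_0_lt_compat]).
    split; [nra|].
    rewrite plus_IZR, Rmult_plus_distr_l, Rmult_1_r. apply Rplus_le_compat_l.
    eapply Rle_trans; [|apply Zdiv_floor, SP]. rewrite !mult_IZR, <- INR_IZR_INZ.
    apply Rmult_le_reg_r with (IZR scale * INR (S j)); [nra|].
    replace (IZR uh * IZR e / (IZR scale * INR (S j)) * (IZR scale * INR (S j)))
      with (IZR uh * IZR e) by (field; lra).
    replace (IZR scale * (u / INR (S j) * exp_horner K (S j) 4 u) * (IZR scale * INR (S j)))
      with ((IZR scale * u) * (IZR scale * exp_horner K (S j) 4 u)) by (field; lra).
    apply Rmult_le_compat; trivial; nra.
Qed.

Lemma encl_exp (ul uh : Z) (u : R) : (0 <= ul)%Z -> encl ul u uh -> u <= 13 / 10 ->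
  encl (exp_lo 17 0 ul) (exp u) (exp_hi 17 0 uh).
Proof.
  intros H0 [H1 H2] Hu. generalize scale_pos. intros SP.
  assert (U0 : 0 <= u).
  { apply Rmult_le_reg_l with (IZR scale); [exact SP|]. rewrite Rmult_0_r.
    eapply Rle_trans; [|exact H1]. now apply (IZR_le 0). }
  assert (E4 : exp u <= 4).
  (* The linear bound [1 - u] is useless here, so the argument is cut into 32 parts: each factor is
     at least [1 - 13/320], and the 32nd power of that exceeds 1/4. *)
  { assert (L : / 4 <= exp (- u)).
    { replace (- u) with (- u / 32 + - u / 32 + - u / 32 + - u / 32 + - u / 32 + - u / 32
        + - u / 32 + - u / 32 + - u / 32 + - u / 32 + - u / 32 + - u / 32 + - u / 32 + - u / 32
        + - u / 32 + - u / 32 + - u / 32 + - u / 32 + - u / 32 + - u / 32 + - u / 32 + - u / 32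
        + - u / 32 + - u / 32 + - u / 32 + - u / 32 + - u / 32 + - u / 32 + - u / 32 + - u / 32
        + - u / 32 + - u / 32) by field.
      rewrite !exp_plus.
      set (e := exp (- u / 32)).
      assert (He : 1 - 13 / 320 <= e).
      { unfold e. generalize (exp_ineq1_le (- u / 32)). lra. }
      assert (P := pow_incr (1 - 13 / 320) e 32 ltac:(lra)).
      simpl in P. rewrite !Rmult_1_r in P.
      eapply Rle_trans; [|eapply Rle_trans; [exact P|right; ring]]. lra. }
    rewrite exp_Ropp in L. apply Rinv_le_contravar in L.
    - rewrite !Rinv_inv in L. exact L.
    - lra. }
  split.
  - eapply Rle_trans; [apply (exp_lo_sound 17 0 ul u H0 H1)|].
    apply Rmult_le_compat_l; [lra|]. now apply exp_horner_lower.
  - eapply Rle_trans; [|apply (exp_hi_sound 17 0 uh u U0 H2)].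
    apply Rmult_le_compat_l; [lra|]. now apply exp_horner_upper.
Qed.

(** * Numerical location of [E] *)

(* Enclosures of [n^(-sigma)] for [sigma = 3 - b / 10^6], from those of [ln n]. *)
Definition pow_lo (b n ll : Z) : Z := (exp_lo 17 0 (b * ll / 1000000) / (n * n * n))%Z.
Definition pow_hi (b n lh : Z) : Z := (exp_hi 17 0 (b * lh / 1000000 + 1) / (n * n * n) + 1)%Z.

Definition sigma_of (b : Z) : R := 3 - IZR b / 1000000.

Lemma ln_2_bounds : 0.693 < ln 2 < 0.6932.
Proof.
  assert (H : encl 0 (ln (IZR 1)) 0) by (unfold encl; rewrite ln_1; lra).
  apply (encl_ln_succ 1 0 0 ltac:(lia)) in H.
  assert (H1 : (0.693 * IZR scale < IZR (ln_succ_lo 1 0))).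
  { assert (Q : (693 * scale <? 1000 * ln_succ_lo 1 0)%Z = true) by (vm_compute; reflexivity).
    apply Z.ltb_lt, IZR_lt in Q. rewrite !mult_IZR in Q. lra. }
  assert (H2 : (IZR (ln_succ_hi 1 0) < 0.6932 * IZR scale)).
  { assert (Q : (10000 * ln_succ_hi 1 0 <? 6932 * scale)%Z = true) by (vm_compute; reflexivity).
    apply Z.ltb_lt, IZR_lt in Q. rewrite !mult_IZR in Q. lra. }
  destruct H as [H3 H4]. change (IZR (1 + 1)) with 2 in *. generalize scale_pos. intros. nra.
Qed.

Lemma ln_3_lower : 1.0986 < ln 3.
Proof.
  assert (H : encl 0 (ln (IZR 1)) 0) by (unfold encl; rewrite ln_1; lra).
  apply (encl_ln_succ 1 0 0 ltac:(lia)) in H.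
  apply (encl_ln_succ 2 _ _ ltac:(lia)) in H.
  assert (H1 : (1.0986 * IZR scale < IZR (ln_succ_lo 2 (ln_succ_lo 1 0)))).
  { assert (Q : (10986 * scale <? 10000 * ln_succ_lo 2 (ln_succ_lo 1 0))%Z = true)
      by (vm_compute; reflexivity).
    apply Z.ltb_lt, IZR_lt in Q. rewrite !mult_IZR in Q. lra. }
  destruct H as [H3 H4]. change (IZR (2 + 1)) with 3 in *. generalize scale_pos. intros. nra.
Qed.

Lemma ln_le_of_512 (n : Z) : (1 <= n <= 512)%Z -> 0 <= ln (IZR n) <= 6.3.
Proof.
  intros [H1 H2]. apply IZR_le in H1, H2. split.
  - rewrite <- ln_1. apply ln_le; lra.
  - apply Rle_trans with (ln (2 ^ 9)); [apply ln_le; lra|].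
    rewrite ln_pow by lra. generalize ln_2_bounds. simpl INR. lra.
Qed.

(** Factoring out the integer [n^3] leaves [exp (b / 10^6 * ln n)], whose argument is at most
    [0.2 * 6.3 < 1.3], within the range of [encl_exp]. *)
Lemma encl_pow (b n ll lh : Z) : (0 <= b <= 200000)%Z -> (1 <= n <= 512)%Z -> (0 <= ll)%Z ->
  encl ll (ln (IZR n)) lh ->
  encl (pow_lo b n ll) (exp (- (sigma_of b * ln (IZR n)))) (pow_hi b n lh).
Proof.
  intros Hb Hn Hl [H1 H2]. generalize scale_pos. intros SP.
  assert (B1 := IZR_le _ _ (proj1 Hb)). assert (B2 := IZR_le _ _ (proj2 Hb)).
  assert (N1 := IZR_le _ _ (proj1 Hn)).
  assert (L := ln_le_of_512 n Hn). set (l := ln (IZR n)) in *.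
  set (u := IZR b / 1000000 * l).
  assert (EU : encl (b * ll / 1000000) u (b * lh / 1000000 + 1)).
  { split.
    - eapply Rle_trans; [apply Zdiv_floor; lia|]. unfold u. rewrite mult_IZR. nra.
    - eapply Rle_trans; [|apply Zdiv_floor; lia]. unfold u. rewrite mult_IZR. nra. }
  apply encl_exp in EU.
  2: { apply Z.div_pos; lia. }
  2: { unfold u. nra. }
  assert (E : exp (- (sigma_of b * l)) = exp u / IZR (n * n * n)).
  { unfold sigma_of. replace (- ((3 - IZR b / 1000000) * l)) with (u + - (l + l + l)) by (unfold u; field).
    rewrite exp_plus, exp_Ropp, !exp_plus. unfold l. rewrite exp_ln by lra.
    rewrite !mult_IZR. reflexivity. }
  assert (N3 : (0 < n * n * n)%Z) by nia.
  assert (N3' : 0 < IZR (n * n * n)) by now apply IZR_lt.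
  destruct EU as [E1 E2]. unfold encl. rewrite E. split.
  - eapply Rle_trans; [apply Zdiv_floor, N3|]. unfold Rdiv. rewrite <- Rmult_assoc.
    apply Rmult_le_compat_r; [|exact E1]. left. now apply Rinv_0_lt_compat.
  - eapply Rle_trans; [|apply Zdiv_floor, N3]. unfold Rdiv. rewrite <- Rmult_assoc.
    apply Rmult_le_compat_r; [|exact E2]. left. now apply Rinv_0_lt_compat.
Qed.

(* After treating [1, ..., n]: enclosures of [ln n], of [sum k^(-sigma)] and of
   [sum ln k k^(-sigma)]. *)
Record run_state := RunState { rs_n : Z; rs_ll : Z; rs_lh : Z;
  rs_al : Z; rs_ah : Z; rs_bl : Z; rs_bh : Z }.

Definition run_step (b : Z) (s : run_state) : run_state :=
  let n := (rs_n s + 1)%Z in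
  let ll := ln_succ_lo (rs_n s) (rs_ll s) in
  let lh := ln_succ_hi (rs_n s) (rs_lh s) in
  let pl := pow_lo b n ll in
  let ph := pow_hi b n lh in
  RunState n ll lh (rs_al s + pl) (rs_ah s + ph)
    (rs_bl s + ll * pl / scale) (rs_bh s + (lh * ph / scale + 1)).

Fixpoint run (k : nat) (b : Z) (s : run_state) : run_state :=
  match k with O => s | S k => run k b (run_step b s) end.

Definition run_init : run_state := RunState 1 0 0 scale scale 0 0.

Definition run_inv (b : Z) (k : nat) (s : run_state) : Prop :=
  rs_n s = Z.of_nat k /\ (0 <= rs_ll s)%Z /\ encl (rs_ll s) (ln (INR k)) (rs_lh s) /\
  encl (rs_al s) (sum_n (npow (sigma_of b)) k) (rs_ah s) /\
  encl (rs_bl s) (sum_n (fun n => ln (INR n) * npow (sigma_of b) n) k) (rs_bh s).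

Lemma run_inv_init (b : Z) : run_inv b 1 run_init.
Proof.
  unfold run_inv, run_init, encl; cbn [rs_n rs_ll rs_lh rs_al rs_ah rs_bl rs_bh].
  rewrite !sum_Sn, !sum_O. simpl INR. rewrite npow_1, ln_1. unfold Hierarchy.plus; simpl.
  repeat split; try lia; try lra.
Qed.

Lemma ln_lo_nonneg (K : nat) (j d2 t : Z) : (0 < j)%Z -> (0 < d2)%Z -> (0 <= t)%Z ->
  (0 <= ln_lo K j d2 t)%Z.
Proof.
  revert j t. induction K as [|K IH]; intros j t Hj Hd Ht; cbn [ln_lo]; [lia|].
  generalize (Z.div_pos t j Ht Hj) (Z.div_pos t d2 Ht Hd). intros H1 H2.
  specialize (IH (j + 2)%Z (t / d2)%Z ltac:(lia) Hd H2). lia.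
Qed.

Lemma exp_lo_nonneg (K : nat) (j u : Z) : (0 <= j)%Z -> (0 <= u)%Z -> (0 <= exp_lo K j u)%Z.
Proof.
  revert j. induction K as [|K IH]; intros j Hj Hu; cbn [exp_lo]; [lia|].
  specialize (IH (j + 1)%Z ltac:(lia) Hu).
  generalize (Z.div_pos (u * exp_lo K (j + 1) u) (scale * (j + 1)) ltac:(nia)).
  unfold scale. lia.
Qed.

Lemma pow_lo_nonneg (b n ll : Z) : (0 <= b)%Z -> (1 <= n)%Z -> (0 <= ll)%Z ->
  (0 <= pow_lo b n ll)%Z.
Proof.
  intros Hb Hn Hl. unfold pow_lo. apply Z.div_pos; [|nia]. apply exp_lo_nonneg; [lia|].
  apply Z.div_pos; lia.
Qed.

Lemma run_inv_step (b : Z) (k : nat) (s : run_state) : (0 <= b <= 200000)%Z ->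
  (1 <= k < 512)%nat -> run_inv b k s -> run_inv b (S k) (run_step b s).
Proof.
  intros Hb Hk [H1 [H2 [H3 [H4 H5]]]]. unfold run_inv, run_step; cbv zeta;
    cbn [rs_n rs_ll rs_lh rs_al rs_ah rs_bl rs_bh].
  generalize scale_pos. intros SP.
  assert (EK : INR (S k) = IZR (rs_n s + 1)) by (rewrite H1, INR_IZR_INZ; f_equal; lia).
  rewrite INR_IZR_INZ, <- H1 in H3.
  assert (L := encl_ln_succ (rs_n s) _ _ ltac:(lia) H3). rewrite <- EK in L.
  assert (LL : (0 <= ln_succ_lo (rs_n s) (rs_ll s))%Z).
  { unfold ln_succ_lo. generalize (ln_lo_nonneg 13 1 ((2 * rs_n s + 1) * (2 * rs_n s + 1))
      (scale / (2 * rs_n s + 1)) ltac:(lia) ltac:(nia) ltac:(apply Z.div_pos; [easy|lia])). lia. }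
  set (ll := ln_succ_lo (rs_n s) (rs_ll s)) in *. set (lh := ln_succ_hi (rs_n s) (rs_lh s)) in *.
  assert (P : encl (pow_lo b (rs_n s + 1) ll) (npow (sigma_of b) (S k)) (pow_hi b (rs_n s + 1) lh)).
  { unfold npow. rewrite EK. apply encl_pow; trivial; [lia|]. now rewrite <- EK. }
  assert (PL := pow_lo_nonneg b (rs_n s + 1) ll ltac:(lia) ltac:(lia) LL).
  set (pl := pow_lo b (rs_n s + 1) ll) in *. set (ph := pow_hi b (rs_n s + 1) lh) in *.
  split; [lia|]. split; [exact LL|]. split; [exact L|].
  unfold encl in *. rewrite !sum_Sn, !plus_IZR. 
  set (sa := sum_n (npow (sigma_of b)) k) in *.
  set (sb := sum_n (fun n => ln (INR n) * npow (sigma_of b) n) k) in *.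
  change (Hierarchy.plus sa (npow (sigma_of b) (S k))) with (sa + npow (sigma_of b) (S k)).
  change (Hierarchy.plus sb (ln (INR (S k)) * npow (sigma_of b) (S k)))
    with (sb + ln (INR (S k)) * npow (sigma_of b) (S k)).
  set (p := npow (sigma_of b) (S k)) in *. set (l := ln (INR (S k))) in *.
  apply IZR_le in LL, PL.
  assert (D : IZR (ll * pl / scale) <= IZR scale * (l * p) <= IZR (lh * ph / scale) + 1).
  { assert (SZ : (0 < scale)%Z) by easy. split.
    - eapply Rle_trans; [apply Zdiv_floor, SZ|]. rewrite mult_IZR.
      apply Rmult_le_reg_r with (IZR scale); [exact SP|]. unfold Rdiv.
      rewrite Rmult_assoc, Rinv_l by lra.
      replace (IZR scale * (l * p) * IZR scale) with ((IZR scale * l) * (IZR scale * p)) by ring.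
      rewrite Rmult_1_r. apply Rmult_le_compat; lra.
    - eapply Rle_trans; [|rewrite <- plus_IZR; apply Zdiv_floor, SZ]. rewrite mult_IZR.
      apply Rmult_le_reg_r with (IZR scale); [exact SP|]. unfold Rdiv.
      rewrite (Rmult_assoc _ (/ _)), Rinv_l by lra.
      replace (IZR scale * (l * p) * IZR scale) with ((IZR scale * l) * (IZR scale * p)) by ring.
      rewrite Rmult_1_r. apply Rmult_le_compat; lra. }
  repeat split; try lra.
Qed.

Lemma run_inv_run (b : Z) (j k : nat) (s : run_state) : (0 <= b <= 200000)%Z ->
  (1 <= k)%nat -> (k + j <= 512)%nat -> run_inv b k s -> run_inv b (k + j) (run j b s).
Proof.
  intros Hb. revert k s. induction j as [|j IH]; intros k s Hk Hj H.
  - now rewrite Nat.add_0_r.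
  - rewrite <- Nat.add_succ_comm. cbn [run]. apply IH; [lia|lia|].
    apply run_inv_step; trivial. lia.
Qed.

(** The left side of the equation of [E] in terms of [r = 2^(-sigma)]. It equals
    [log 2 * (r / (1 - r) + r / (1 + r))], the difference between the contributions of the prime 2
    for zeta and for [F]. *)
Definition ratio_h (sigma : R) : R :=
  2 * npow sigma 2 * ln 2 / (1 - npow sigma 2 * npow sigma 2).

Definition h_hi (b : Z) : Z :=
  let l := ln_succ_hi 1 0 in let r := pow_hi b 2 l in
  ((2 * r * l * scale) / (scale * scale - r * r) + 1)%Z.
Definition h_lo (b : Z) : Z :=
  let l := ln_succ_lo 1 0 in let r := pow_lo b 2 l in
  ((2 * r * l * scale) / (scale * scale - r * r))%Z.

Lemma encl_ratio_h (b : Z) : (0 <= b <= 200000)%Z ->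
  (0 < scale * scale - pow_hi b 2 (ln_succ_hi 1 0) * pow_hi b 2 (ln_succ_hi 1 0))%Z ->
  encl (h_lo b) (ratio_h (sigma_of b)) (h_hi b).
Proof.
  intros Hb HP. generalize scale_pos. intros SP.
  assert (H : encl 0 (ln (IZR 1)) 0) by (unfold encl; rewrite ln_1; lra).
  apply (encl_ln_succ 1 0 0 ltac:(lia)) in H.
  assert (L0 : (0 <= ln_succ_lo 1 0)%Z) by (vm_compute; discriminate).
  assert (P := encl_pow b (1 + 1) _ _ Hb ltac:(lia) L0 H).
  change (1 + 1)%Z with 2%Z in *.
  assert (P0 := pow_lo_nonneg b 2 (ln_succ_lo 1 0) ltac:(lia) ltac:(lia) L0).
  unfold h_lo, h_hi, ratio_h. change (npow (sigma_of b) 2) with (exp (- (sigma_of b * ln (INR 2)))).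
  change (IZR 2) with 2 in *. change (INR 2) with 2.
  cbv zeta.
  set (ll := ln_succ_lo 1 0) in *. set (lh := ln_succ_hi 1 0) in *.
  set (pl := pow_lo b 2 ll) in *. set (ph := pow_hi b 2 lh) in *.
  set (p := exp (- (sigma_of b * ln 2))) in *. set (l := ln 2) in *.
  assert (Pp : 0 < p) by apply exp_pos.
  destruct H as [H1 H2], P as [P1 P2].
  apply IZR_le in L0, P0. apply IZR_lt in HP as HP'. rewrite minus_IZR, !mult_IZR in HP'.
  set (S := IZR scale) in *.
  assert (HQ : (0 < scale * scale - pl * pl)%Z).
  { apply lt_IZR. rewrite minus_IZR, !mult_IZR. fold S. nra. }
  assert (HQ' := IZR_lt _ _ HQ). rewrite minus_IZR, !mult_IZR in HQ'. fold S in HQ'.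
  assert (R1 : 0 < 1 - p * p).
  { assert (0 < S * S * (1 - p * p)) by nra. nra. }
  split.
  - eapply Rle_trans; [apply Zdiv_floor, HQ|]. rewrite minus_IZR, !mult_IZR. fold S.
    apply Rmult_le_reg_r with (S * S - IZR pl * IZR pl); [exact HQ'|].
    unfold Rdiv at 1. rewrite Rmult_assoc, Rinv_l, Rmult_1_r by lra.
    apply Rmult_le_reg_r with (1 - p * p); [exact R1|].
    replace (S * (2 * p * l / (1 - p * p)) * (S * S - IZR pl * IZR pl) * (1 - p * p)) with
      (2 * (S * p) * (S * l) * (S * S - IZR pl * IZR pl) / S) by (field; lra).
    apply Rmult_le_reg_r with S; [exact SP|].
    replace (2 * (S * p) * (S * l) * (S * S - IZR pl * IZR pl) / S * S) with
      (2 * ((S * p) * (S * l)) * (S * S - IZR pl * IZR pl)) by (field; lra).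
    replace (2 * IZR pl * IZR ll * S * (1 - p * p) * S) with
      (2 * (IZR pl * IZR ll) * (S * S - (S * p) * (S * p))) by ring.
    apply Rmult_le_compat; try nra.
  - eapply Rle_trans; [|apply Zdiv_floor, HP]. rewrite minus_IZR, !mult_IZR. fold S.
    apply Rmult_le_reg_r with (S * S - IZR ph * IZR ph); [exact HP'|].
    unfold Rdiv at 2. rewrite (Rmult_assoc _ (/ _)), Rinv_l, Rmult_1_r by lra.
    apply Rmult_le_reg_r with (1 - p * p); [exact R1|].
    replace (S * (2 * p * l / (1 - p * p)) * (S * S - IZR ph * IZR ph) * (1 - p * p)) with
      (2 * (S * p) * (S * l) * (S * S - IZR ph * IZR ph) / S) by (field; lra).
    apply Rmult_le_reg_r with S; [exact SP|].
    replace (2 * (S * p) * (S * l) * (S * S - IZR ph * IZR ph) / S * S) with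
      (2 * ((S * p) * (S * l)) * (S * S - IZR ph * IZR ph)) by (field; lra).
    replace (2 * IZR ph * IZR lh * S * (1 - p * p) * S) with
      (2 * (IZR ph * IZR lh) * (S * S - (S * p) * (S * p))) by ring.
    apply Rmult_le_compat; try nra.
Qed.

Lemma MVT_derive (f df : R -> R) (a b : R) : a < b ->
  (forall x, a <= x <= b -> is_derive f x (df x)) ->
  exists c, a <= c <= b /\ f b - f a = df c * (b - a).
Proof.
  intros Hab Hd. destruct (MVT_gen f a b df) as [c [Hc H]].
  - rewrite Rmin_left, Rmax_right by lra. intros t Ht. apply Hd. lra.
  - rewrite Rmin_left, Rmax_right by lra. intros t Ht. apply continuity_pt_filterlim.
    apply (ex_derive_continuous f). exists (df t). apply Hd. lra.
  - rewrite Rmin_left, Rmax_right in Hc by lra. now exists c.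
Qed.

(** * Integral and trapezoidal bounds for the tail of a log-weighted series *)

Definition phi (sigma h x : R) : R := (ln x - h) * exp (- (sigma * ln x)).
(** The integral of [phi sigma h] from [x] to infinity. *)
Definition phi_int (sigma h x : R) : R :=
  x * exp (- (sigma * ln x)) * ((ln x - h) / (sigma - 1) + 1 / ((sigma - 1) * (sigma - 1))).
Definition dphi (sigma h x : R) : R := exp (- (sigma * ln x)) / x * (1 - sigma * (ln x - h)).

Lemma is_derive_phi_int (sigma h x : R) : 1 < sigma -> 0 < x ->
  is_derive (phi_int sigma h) x (- phi sigma h x).
Proof.
  intros Hs Hx. unfold phi_int, phi. auto_derive; [lra|]. field. lra.
Qed.

Lemma is_derive_phi (sigma h x : R) : 0 < x -> is_derive (phi sigma h) x (dphi sigma h x).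
Proof. intros Hx. unfold phi, dphi. auto_derive; [lra|]. field. lra. Qed.

Lemma is_derive_dphi (sigma h x : R) : 0 < x -> is_derive (dphi sigma h) x
  (exp (- (sigma * ln x)) / (x * x) * (sigma * (sigma + 1) * (ln x - h) - 2 * sigma - 1)).
Proof.
  intros Hx. unfold dphi. auto_derive; [lra|]. field. lra.
Qed.

Lemma dphi_neg (sigma h x : R) : 2 < sigma -> 0 < x -> 1 <= ln x - h -> dphi sigma h x <= 0.
Proof.
  intros Hs Hx Hl. unfold dphi.
  assert (0 < exp (- (sigma * ln x)) / x) by (apply Rdiv_lt_0_compat; [apply exp_pos|lra]).
  assert (1 - sigma * (ln x - h) <= 0) by nra. nra.
Qed.

(** Convexity of [phi] where [ln x - h >= 1]: the second derivative has the sign of [sigma (sigma +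
    1) (ln x - h) - 2 sigma - 1], which is at least [sigma^2 - sigma - 1 > 0]. *)
Lemma dphi_incr (sigma h x y : R) : 2 < sigma -> 0 < x -> x <= y -> 1 <= ln x - h ->
  dphi sigma h x <= dphi sigma h y.
Proof.
  intros Hs Hx [Hxy| ->] Hl; [|lra].
  destruct (MVT_derive (dphi sigma h)
    (fun x => exp (- (sigma * ln x)) / (x * x) * (sigma * (sigma + 1) * (ln x - h) - 2 * sigma - 1)) x y)
    as [c [Hc H]]; [lra| |].
  - intros t Ht. apply is_derive_dphi. lra.
  - assert (ln x <= ln c) by (apply ln_le; lra).
    assert (0 < exp (- (sigma * ln c)) / (c * c)) by (apply Rdiv_lt_0_compat; [apply exp_pos|nra]).
    assert (0 <= sigma * (sigma + 1) * (ln c - h) - 2 * sigma - 1) by nra.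
    assert (0 <= exp (- (sigma * ln c)) / (c * c) *
      (sigma * (sigma + 1) * (ln c - h) - 2 * sigma - 1)) by (apply Rmult_le_pos; lra).
    nra.
Qed.

Lemma phi_succ_le (sigma h x : R) : 2 < sigma -> 0 < x -> 1 <= ln x - h ->
  phi sigma h (x + 1) <= phi_int sigma h x - phi_int sigma h (x + 1).
Proof.
  intros Hs Hx Hl.
  destruct (MVT_derive (phi_int sigma h) (fun x => - phi sigma h x) x (x + 1)) as [c [Hc H]]; [lra| |].
  - intros t Ht. apply is_derive_phi_int; lra.
  - enough (phi sigma h (x + 1) <= phi sigma h c) by lra.
    destruct (Rle_lt_or_eq_dec c (x + 1)) as [L| ->]; [lra| |lra].
    destruct (MVT_derive (phi sigma h) (dphi sigma h) c (x + 1)) as [d [Hd H']]; [lra| |].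
    + intros t Ht. apply is_derive_phi; lra.
    + assert (ln x <= ln d) by (apply ln_le; lra).
      assert (dphi sigma h d <= 0) by (apply dphi_neg; lra). nra.
Qed.

(** The trapezoidal rule overestimates the integral of a convex function. *)
Lemma phi_trapezoid (sigma h x : R) : 2 < sigma -> 0 < x -> 1 <= ln x - h ->
  phi_int sigma h x - phi_int sigma h (x + 1) <= (phi sigma h x + phi sigma h (x + 1)) / 2.
Proof.
  intros Hs Hx Hl.
  (* The right end of the trapezoid is made variable: the claim is [psi x <= psi (x + 1)], and
     [psi' >= 0] says that [phi] lies above its tangent at [c]. *)
  set (psi := fun y => phi_int sigma h y + (y - x) * (phi sigma h x + phi sigma h y) / 2).
  destruct (MVT_derive psi (fun y => - phi sigma h y +
    ((phi sigma h x + phi sigma h y) + (y - x) * dphi sigma h y) / 2) x (x + 1)) as [c [Hc H]]; [lra| |].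
  - intros t Ht. unfold psi.
    apply (is_derive_plus (V := R_NormedModule) (phi_int sigma h)).
    + apply is_derive_phi_int; lra.
    + assert (D := is_derive_phi sigma h t ltac:(lra)).
      auto_derive; [now exists (dphi sigma h t)|].
      replace (Derive (fun x0 => phi sigma h x0) t) with (dphi sigma h t)
        by (symmetry; now apply is_derive_unique).
      unfold Rdiv. ring.
  - enough (0 <= - phi sigma h c + ((phi sigma h x + phi sigma h c) + (c - x) * dphi sigma h c) / 2).
    { unfold psi in H. nra. }
    destruct (Rle_lt_or_eq_dec x c) as [L|<-]; [lra| |].
    + destruct (MVT_derive (phi sigma h) (dphi sigma h) x c) as [d [Hd H']]; [lra| |].
      * intros t Ht. apply is_derive_phi; lra.
      * assert (ln x <= ln d) by (apply ln_le; lra).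
        assert (dphi sigma h d <= dphi sigma h c) by (apply dphi_incr; lra). nra.
    + lra.
Qed.

(** The sum over [n] is [- zeta' - h zeta] at [sigma]. For [h = ratio_h sigma] this is [zeta * Psi],
    so its sign is that of [Psi]. *)
Definition ln_term (sigma h : R) (n : nat) : R := (ln (INR n) - h) * npow sigma n.

Lemma ln_term_phi (sigma h : R) (n : nat) : (1 <= n)%nat -> ln_term sigma h n = phi sigma h (INR n).
Proof. intros Hn. destruct n; [lia|reflexivity]. Qed.

Lemma ex_series_ln_term (sigma h : R) : 1 < sigma -> ex_series (ln_term sigma h).
Proof.
  intros Hs. unfold ln_term.
  apply ex_series_ext with (fun n => ln (INR n) * npow sigma n + (- h) * npow sigma n).
  - intros n. simpl. ring.
  - apply (ex_series_plus (V := R_NormedModule)); [now apply ex_series_ln_npow|].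
    apply ex_series_Rscal. now apply ex_series_npow.
Qed.

Lemma Series_ln_term (sigma h : R) : 1 < sigma ->
  Series (ln_term sigma h) = Series (fun n => ln (INR n) * npow sigma n) - h * Series (npow sigma).
Proof.
  intros Hs. rewrite <- Series_scal_l, <- Series_minus.
  - apply Series_ext. intros n. unfold ln_term. ring.
  - now apply ex_series_ln_npow.
  - apply ex_series_Rscal. now apply ex_series_npow.
Qed.

(** From 8 on, [ln x - h >= 1] for every [h <= 1], the range in which [phi] is decreasing and
    convex. *)
Lemma ln_ge_2 (N k : nat) : (8 <= N)%nat -> 2 <= ln (INR (N + k)).
Proof.
  intros HN. apply Rle_trans with (ln (2 ^ 3)).
  - rewrite ln_pow by lra. generalize ln_2_bounds. simpl INR. lra.
  - apply ln_le; [lra|]. replace (2 ^ 3) with (INR 8) by (simpl; lra). apply le_INR. lia.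
Qed.

Lemma Series_split (f : nat -> R) (N : nat) : ex_series f ->
  Series f = sum_n f N + Series (fun k => f (S N + k)%nat).
Proof.
  intros Hf. rewrite (Series_incr_n f (S N)) by (lia || exact Hf).
  now rewrite sum_n_Reals.
Qed.

Lemma phi_int_pos (sigma h x : R) : 2 < sigma -> 0 < x -> h <= ln x -> 0 <= phi_int sigma h x.
Proof.
  intros Hs Hx Hl. unfold phi_int. apply Rmult_le_pos.
  - left. apply Rmult_lt_0_compat; [lra|apply exp_pos].
  - apply Rplus_le_le_0_compat.
    + apply Rmult_le_pos; [lra|]. left. apply Rinv_0_lt_compat. lra.
    + left. apply Rdiv_lt_0_compat; nra.
Qed.

Lemma Series_ln_term_upper (sigma h : R) (N : nat) : 2 < sigma -> h <= 1 -> (8 <= N)%nat ->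
  Series (ln_term sigma h) <= sum_n (ln_term sigma h) N + phi_int sigma h (INR N).
Proof.
  intros Hs Hh HN. rewrite (Series_split _ N) by (apply ex_series_ln_term; lra).
  apply Rplus_le_compat_l.
  replace (INR N) with (INR (N + 0)) by (f_equal; lia).
  apply (ex_series_telescope (fun k => ln_term sigma h (S N + k))
    (fun k => phi_int sigma h (INR (N + k)))).
  - intros k. rewrite ln_term_phi by lia. rewrite <- plus_n_Sm. simpl (S N + k)%nat. rewrite S_INR.
    assert (L := ln_ge_2 N k HN). assert (P : 0 < INR (N + k)) by (apply lt_0_INR; lia).
    split; [|apply phi_succ_le; lra].
    unfold phi. apply Rmult_le_pos; [|left; apply exp_pos].
    assert (ln (INR (N + k)) <= ln (INR (N + k) + 1)) by (apply ln_le; lra). lra.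
  - intros k. apply phi_int_pos; [lra|apply lt_0_INR; lia|]. generalize (ln_ge_2 N k HN). lra.
Qed.

Lemma is_lim_seq_phi_int (sigma h : R) (N : nat) : 2 < sigma ->
  is_lim_seq (fun k => phi_int sigma h (INR (N + k))) 0.
Proof.
  intros Hs.
  assert (H1 : is_lim_seq (npow (sigma - 1)) 0).
  { apply ex_series_lim_0, ex_series_npow. lra. }
  assert (H2 : is_lim_seq (fun n => ln (INR n) * npow (sigma - 1) n) 0).
  { apply ex_series_lim_0, ex_series_ln_npow. lra. }
  assert (H3 : is_lim_seq (fun n => / (sigma - 1) * (ln (INR n) * npow (sigma - 1) n) +
    (- h / (sigma - 1) + 1 / ((sigma - 1) * (sigma - 1))) * npow (sigma - 1) n) 0).
  { replace (Finite 0) with (Rbar_plus (Finite (/ (sigma - 1) * 0))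
      (Finite ((- h / (sigma - 1) + 1 / ((sigma - 1) * (sigma - 1))) * 0)))
      by (simpl; f_equal; ring).
    apply is_lim_seq_plus'.
    - exact (is_lim_seq_scal_l _ _ _ H2).
    - exact (is_lim_seq_scal_l _ _ _ H1). }
  apply is_lim_seq_incr_n with (N := S N) in H3.
  apply is_lim_seq_incr_1. eapply is_lim_seq_ext; [|exact H3].
  intros n. simpl. replace (n + S N)%nat with (S (N + n)) by lia.
  replace (N + S n)%nat with (S (N + n)) by lia. unfold phi_int, npow.
  set (x := INR (S (N + n))).
  assert (P : 0 < x) by (apply lt_0_INR; lia).
  assert (E : exp (- ((sigma - 1) * ln x)) = x * exp (- (sigma * ln x))).
  { replace (- ((sigma - 1) * ln x)) with (ln x + - (sigma * ln x)) by ring.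
    rewrite exp_plus, exp_ln by exact P. reflexivity. }
  rewrite E. field. lra.
Qed.

(** Summing the trapezoidal inequality counts the terms beyond [N] fully and the term at [N] by
    half. With [g] the integral minus half a term, the sum telescopes. *)
Lemma Series_ln_term_lower (sigma h : R) (N : nat) : 2 < sigma -> h <= 1 -> (8 <= N)%nat ->
  sum_n (ln_term sigma h) N + (phi_int sigma h (INR N) - phi sigma h (INR N) / 2) <=
  Series (ln_term sigma h).
Proof.
  intros Hs Hh HN. rewrite (Series_split _ N) by (apply ex_series_ln_term; lra).
  apply Rplus_le_compat_l.
  set (g := fun k => phi_int sigma h (INR (N + k)) - phi sigma h (INR (N + k)) / 2).
  assert (X : ex_series (fun k => ln_term sigma h (S N + k))).
  { apply (ex_series_incr_n (ln_term sigma h) (S N)), ex_series_ln_term. lra. }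
  assert (P : forall k, g 0%nat - phi_int sigma h (INR (N + S k)) <=
    sum_n (fun k => ln_term sigma h (S N + k)) k).
  { assert (Q : forall k, g k - g (S k) <= ln_term sigma h (S N + k)).
    { intros k. rewrite ln_term_phi by lia. unfold g. rewrite <- plus_n_Sm.
      simpl (S N + k)%nat. rewrite S_INR.
      assert (L := ln_ge_2 N k HN). assert (P : 0 < INR (N + k)) by (apply lt_0_INR; lia).
      generalize (phi_trapezoid sigma h (INR (N + k)) Hs P ltac:(lra)). lra. }
    assert (R : forall k, g 0%nat - g (S k) <= sum_n (fun k => ln_term sigma h (S N + k)) k).
    { induction k as [|k IH].
      - rewrite sum_O. apply Q.
      - rewrite sum_Sn. specialize (Q (S k)). unfold plus; simpl plus in *.
        unfold plus in *. simpl in *. lra. }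
    intros k. specialize (R k). unfold g at 2 in R.
    assert (0 <= phi sigma h (INR (N + S k))).
    { unfold phi. apply Rmult_le_pos; [|left; apply exp_pos]. generalize (ln_ge_2 N (S k) HN). lra. }
    lra. }
  assert (Z : Rbar_le (g 0%nat - 0) (Series (fun k => ln_term sigma h (S N + k)))).
  { eapply is_lim_seq_le; [exact P| |exact (Series_correct _ X)].
    apply is_lim_seq_minus'; [apply is_lim_seq_const|].
    assert (T := is_lim_seq_phi_int sigma h N Hs). apply is_lim_seq_incr_1 in T. exact T. }
  simpl in Z. unfold g in Z. rewrite Nat.add_0_r, Rminus_0_r in Z. exact Z.
Qed.

(** The bound of [Series_ln_term_lower] as an integer test. Since [c = 10^6 (sigma - 1)],
    multiplication by [2 c^2 scale^2] clears all denominators; [check_upper] uses [c^2 scale^2]. *)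
Definition check_lower (b : Z) (s : run_state) : bool :=
  let c := (2000000 - b)%Z in let n := rs_n s in let h := h_hi b in
  let p := pow_lo b n (rs_ll s) in
  ((0 <? scale * scale - pow_hi b 2 (ln_succ_hi 1 0) * pow_hi b 2 (ln_succ_hi 1 0)) &&
   (h <=? rs_ll s) && (h <=? scale) && (0 <=? rs_ah s) &&
   (0 <? 2 * (c * c) * (rs_bl s * scale - h * rs_ah s) +
     p * ((rs_ll s - h) * (2 * n * 1000000 * c - c * c) + 2 * n * 1000000000000 * scale)))%Z%bool.

Definition check_upper (b : Z) (s : run_state) : bool :=
  let c := (2000000 - b)%Z in let n := rs_n s in let h := h_lo b in
  let p := pow_hi b n (rs_lh s) in
  ((0 <? scale * scale - pow_hi b 2 (ln_succ_hi 1 0) * pow_hi b 2 (ln_succ_hi 1 0)) &&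
   (h_hi b <=? scale) && (0 <=? h) && (h <=? rs_lh s) && (0 <=? rs_al s) &&
   (c * c * (rs_bh s * scale - h * rs_al s) +
     p * ((rs_lh s - h) * (n * 1000000 * c) + n * 1000000000000 * scale) <? 0))%Z%bool.

Lemma sum_n_ln_term (sigma h : R) (N : nat) : @eq R (sum_n (ln_term sigma h) N)
  (sum_n (fun n => ln (INR n) * npow sigma n) N - h * sum_n (npow sigma) N).
Proof.
  induction N as [|N IH].
  - rewrite !sum_O. unfold ln_term. ring.
  - rewrite !sum_Sn, IH. unfold Hierarchy.plus; simpl Hierarchy.plus. unfold ln_term.
    cbn -[INR npow sum_n]. ring.
Qed.

Lemma check_lower_sound (b : Z) (N : nat) : (0 <= b <= 200000)%Z -> (8 <= N <= 512)%nat ->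
  check_lower b (run (N - 1) b run_init) = true ->
  0 < Series (ln_term (sigma_of b) (ratio_h (sigma_of b))).
Proof.
  intros Hb HN. set (s := run (N - 1) b run_init).
  assert (I : run_inv b N s).
  { replace N with (1 + (N - 1))%nat at 1 by lia. unfold s. apply run_inv_run; trivial; try lia.
    apply run_inv_init. }
  unfold check_lower. cbv zeta. rewrite !Bool.andb_true_iff, !Z.ltb_lt, !Z.leb_le.
  intros [[[[C1 C2] C3] C4] C5].
  destruct I as [I1 [I2 [I3 [I4 I5]]]].
  assert (H := encl_ratio_h b Hb C1).
  assert (P := encl_pow b (rs_n s) (rs_ll s) (rs_lh s) Hb ltac:(lia) I2).
  rewrite I1, <- INR_IZR_INZ in P. specialize (P I3).
  assert (P0 := pow_lo_nonneg b (rs_n s) (rs_ll s) ltac:(lia) ltac:(lia) I2).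
  rewrite <- I1 in P. generalize scale_pos. intros SP.
  assert (B1 := IZR_le _ _ (proj1 Hb)). assert (B2 := IZR_le _ _ (proj2 Hb)).
  set (sigma := sigma_of b) in *. set (h := ratio_h sigma) in *.
  set (pl := pow_lo b (rs_n s) (rs_ll s)) in *. set (c := (2000000 - b)%Z) in *.
  assert (Hc : IZR c = 1000000 * (sigma - 1)).
  { unfold c, sigma, sigma_of. rewrite minus_IZR. field. }
  assert (Hs : 2 < sigma) by (unfold sigma, sigma_of; lra).
  apply IZR_le in C2, C3, C4, P0. destruct H as [_ H2].
  eapply Rlt_le_trans; [|apply (Series_ln_term_lower sigma h N); [lra| |lia]].
  2: { apply Rmult_le_reg_l with (IZR scale); lra. }
  rewrite sum_n_ln_term. unfold phi_int, phi.
  set (l := ln (INR N)) in *. set (p := exp (- (sigma * l))) in *.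
  set (A := sum_n (npow sigma) N) in *.
  set (L := sum_n (fun n => ln (INR n) * npow sigma n) N) in *.
  apply IZR_lt in C5. rewrite plus_IZR, !mult_IZR, plus_IZR, !mult_IZR, !minus_IZR, !mult_IZR in C5.
  rewrite I1, <- INR_IZR_INZ in C5.
  assert (NP : 8 <= INR N) by (replace 8 with (INR 8) by (simpl; lra); apply le_INR; lia).
  destruct I3 as [I3 _], I4 as [_ I4], I5 as [I5 _], P as [P _].
  set (S := IZR scale) in *. set (n := INR N) in *. set (cc := IZR c) in *.
  set (hz := IZR (h_hi b)) in *. set (ah := IZR (rs_ah s)) in *. set (bl := IZR (rs_bl s)) in *.
  set (ll := IZR (rs_ll s)) in *. set (pz := IZR pl) in *.
  assert (Pc : 1000000 < cc) by lra.
  assert (Pcc : 0 < cc * cc) by (apply Rmult_lt_0_compat; lra).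
  assert (PSS : 0 < S * S) by (apply Rmult_lt_0_compat; lra).
  assert (A0 : 0 <= A).
  { unfold A. rewrite sum_n_Reals. apply cond_pos_sum. intros k. apply npow_ge_0. }
  assert (G : L - h * A + (n * p * ((l - h) / (sigma - 1) + 1 / ((sigma - 1) * (sigma - 1))) -
      (l - h) * p / 2) =
    (2 * (cc * cc) * (S * L * S - (S * h) * (S * A)) +
     (S * p) * ((S * l - S * h) * (2 * n * 1000000 * cc - cc * cc) + 2 * n * 1000000000000 * S)) /
    (2 * (cc * cc) * (S * S))).
  { rewrite Hc. field. split; lra. }
  rewrite G. apply Rdiv_lt_0_compat; [|apply Rmult_lt_0_compat; lra].
  eapply Rlt_le_trans; [exact C5|]. apply Rplus_le_compat.
  - apply Rmult_le_compat_l; [lra|].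
    assert (S * h * (S * A) <= hz * ah).
    { apply Rle_trans with (hz * (S * A)).
      - apply Rmult_le_compat_r; [apply Rmult_le_pos; lra|exact H2].
      - apply Rmult_le_compat_l; [|exact I4].
        assert (0 <= h); [|nra].
        unfold h, ratio_h. generalize (npow_lt_1 sigma 2 ltac:(lra) ltac:(lia)).
        generalize (npow_pos sigma 2 ltac:(lia)) ln_2_bounds. intros.
        apply Rmult_le_pos; [nra|]. left. apply Rinv_0_lt_compat. nra. }
    nra.
  - assert (0 <= 2 * n * 1000000 * cc - cc * cc).
    { assert (cc <= 2000000) by (unfold sigma, sigma_of in Hc; lra).
      replace (2 * n * 1000000 * cc - cc * cc) with (cc * (2000000 * n - cc)) by ring.
      apply Rmult_le_pos; lra. }
    assert (0 <= 2 * n * 1000000000000 * S) by nra.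
    apply Rmult_le_compat; [exact P0| |exact P|].
    + apply Rplus_le_le_0_compat; [|assumption]. apply Rmult_le_pos; lra.
    + apply Rplus_le_compat_r. apply Rmult_le_compat_r; lra.
Qed.

Lemma check_upper_sound (b : Z) (N : nat) : (0 <= b <= 200000)%Z -> (8 <= N <= 512)%nat ->
  check_upper b (run (N - 1) b run_init) = true ->
  Series (ln_term (sigma_of b) (ratio_h (sigma_of b))) < 0.
Proof.
  intros Hb HN. set (s := run (N - 1) b run_init).
  assert (I : run_inv b N s).
  { replace N with (1 + (N - 1))%nat at 1 by lia. unfold s. apply run_inv_run; trivial; try lia.
    apply run_inv_init. }
  unfold check_upper. cbv zeta. rewrite !Bool.andb_true_iff, !Z.ltb_lt, !Z.leb_le.
  intros [[[[[C1 C2] C3] C3'] C4] C5].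
  destruct I as [I1 [I2 [I3 [I4 I5]]]].
  assert (H := encl_ratio_h b Hb C1).
  assert (P := encl_pow b (rs_n s) (rs_ll s) (rs_lh s) Hb ltac:(lia) I2).
  rewrite I1, <- INR_IZR_INZ in P. specialize (P I3).
  rewrite <- I1 in P. generalize scale_pos. intros SP.
  assert (B1 := IZR_le _ _ (proj1 Hb)). assert (B2 := IZR_le _ _ (proj2 Hb)).
  set (sigma := sigma_of b) in *. set (h := ratio_h sigma) in *.
  set (ph := pow_hi b (rs_n s) (rs_lh s)) in *. set (c := (2000000 - b)%Z) in *.
  assert (Hc : IZR c = 1000000 * (sigma - 1)).
  { unfold c, sigma, sigma_of. rewrite minus_IZR. field. }
  assert (Hs : 2 < sigma) by (unfold sigma, sigma_of; lra).
  apply IZR_le in C2, C3, C3', C4. destruct H as [H1 H2].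
  assert (Hh : h <= 1) by (apply Rmult_le_reg_l with (IZR scale); lra).
  eapply Rle_lt_trans; [apply (Series_ln_term_upper sigma h N); [lra|exact Hh|lia]|].
  rewrite sum_n_ln_term. unfold phi_int, phi.
  assert (L2 := ln_ge_2 N 0 ltac:(lia)). rewrite Nat.add_0_r in L2.
  set (l := ln (INR N)) in *. set (p := exp (- (sigma * l))) in *.
  assert (Pp : 0 < p) by apply exp_pos.
  set (A := sum_n (npow sigma) N) in *.
  set (L := sum_n (fun n => ln (INR n) * npow sigma n) N) in *.
  apply IZR_lt in C5. rewrite plus_IZR, !mult_IZR, plus_IZR, !mult_IZR, !minus_IZR, !mult_IZR in C5.
  rewrite I1, <- INR_IZR_INZ in C5.
  assert (NP : 8 <= INR N) by (replace 8 with (INR 8) by (simpl; lra); apply le_INR; lia).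
  destruct I3 as [_ I3], I4 as [I4 _], I5 as [_ I5], P as [_ P].
  set (S := IZR scale) in *. set (n := INR N) in *. set (cc := IZR c) in *.
  set (hz := IZR (h_lo b)) in *. set (al := IZR (rs_al s)) in *. set (bh := IZR (rs_bh s)) in *.
  set (lh := IZR (rs_lh s)) in *. set (pz := IZR ph) in *.
  assert (Pc : 1000000 < cc) by lra.
  assert (Pcc : 0 < cc * cc) by (apply Rmult_lt_0_compat; lra).
  assert (PSS : 0 < S * S) by (apply Rmult_lt_0_compat; lra).
  assert (G : L - h * A + n * p * ((l - h) / (sigma - 1) + 1 / ((sigma - 1) * (sigma - 1))) =
    (cc * cc * (S * L * S - (S * h) * (S * A)) +
     (S * p) * ((S * l - S * h) * (n * 1000000 * cc) + n * 1000000000000 * S)) /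
    (cc * cc * (S * S))).
  { rewrite Hc. field. split; lra. }
  rewrite G. 
  assert (Pd : 0 < cc * cc * (S * S)) by (apply Rmult_lt_0_compat; lra).
  apply Rmult_lt_reg_r with (cc * cc * (S * S)); [exact Pd|].
  unfold Rdiv. rewrite Rmult_assoc, Rinv_l, Rmult_0_l, Rmult_1_r by lra.
  eapply Rle_lt_trans; [|exact C5]. apply Rplus_le_compat.
  - apply Rmult_le_compat_l; [lra|].
    assert (hz * al <= S * h * (S * A)) by (apply Rmult_le_compat; trivial; lra).
    nra.
  - assert (0 <= n * 1000000 * cc) by nra.
    assert (0 <= n * 1000000000000 * S) by nra.
    apply Rmult_le_compat; [nra| |exact P|].
    + apply Rplus_le_le_0_compat; [|assumption]. apply Rmult_le_pos; [nra|assumption].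
    + apply Rplus_le_compat_r. apply Rmult_le_compat_r; lra.
Qed.

(** The abscissa is [3 - 186986 / 10^6]. The lower bound has the trapezoidal correction and is run
    with 300 terms; the upper bound in the next lemma uses the bare integral and is run with 500. *)
Lemma ln_term_sum_pos : 0 < Series (ln_term 2.813014 (ratio_h 2.813014)).
Proof.
  replace 2.813014 with (sigma_of 186986) by (unfold sigma_of; lra).
  apply check_lower_sound with 300%nat; [lia|lia|]. vm_compute. reflexivity.
Qed.

Lemma ln_term_sum_neg : Series (ln_term 2.813015 (ratio_h 2.813015)) < 0.
Proof.
  replace 2.813015 with (sigma_of 186985) by (unfold sigma_of; lra).
  apply check_upper_sound with 500%nat; [lia|lia|]. vm_compute. reflexivity.
Qed.

(** * The half-plane to the right of [E] *)

Lemma npow_plus (s t : R) (n : nat) : npow (s + t) n = npow s n * npow t n.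
Proof.
  destruct n as [|n]; [simpl; ring|]. unfold npow. rewrite <- exp_plus. f_equal. ring.
Qed.

Lemma npow_decr (s : R) (m n : nat) : 0 <= s -> (1 <= m <= n)%nat -> npow s n <= npow s m.
Proof.
  intros Hs Hmn. destruct m as [|m]; [lia|]. destruct n as [|n]; [lia|]. unfold npow.
  apply exp_le_compat. apply Ropp_le_contravar. apply Rmult_le_compat_l; [exact Hs|].
  apply ln_le; [apply lt_0_INR; lia|apply le_INR; lia].
Qed.

(** For an exponent in fifths, such as [2.8 = 14/5], taking fifth powers turns the comparison of
    [n^(-p/5)] with a decimal into a rational inequality. *)
Lemma npow_le_rat (p n : nat) (y : R) : (1 <= n)%nat -> 0 < y ->
  1 <= y ^ 5 * INR n ^ p -> npow (INR p / 5) n <= y.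
Proof.
  intros Hn Hy H. assert (P : 0 < INR n) by (apply lt_0_INR; lia).
  destruct n as [|n]; [lia|]. unfold npow. rewrite <- (exp_ln y) by exact Hy.
  apply exp_le_compat. apply ln_le in H; [|lra].
  rewrite ln_1, ln_mult, !ln_pow in H by (trivial; apply pow_lt; trivial).
  simpl (INR 5) in H. lra.
Qed.

Lemma rat_le_npow (p n : nat) (y : R) : (1 <= n)%nat -> 0 < y ->
  y ^ 5 * INR n ^ p <= 1 -> y <= npow (INR p / 5) n.
Proof.
  intros Hn Hy H. assert (P : 0 < INR n) by (apply lt_0_INR; lia).
  destruct n as [|n]; [lia|]. unfold npow. rewrite <- (exp_ln y) at 1 by exact Hy.
  apply exp_le_compat. apply ln_le in H.
  2: { apply Rmult_lt_0_compat; apply pow_lt; trivial. }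
  rewrite ln_1, ln_mult, !ln_pow in H by (trivial; apply pow_lt; trivial).
  simpl (INR 5) in H. lra.
Qed.

Definition prime_npow (sigma : R) (q : nat) : R := if is_prime q then npow sigma q else 0.

Lemma prime_npow_bounds (sigma : R) (q : nat) : 0 <= prime_npow sigma q <= npow sigma q.
Proof. unfold prime_npow. generalize (npow_ge_0 sigma q). destruct (is_prime q); lra. Qed.

Lemma ex_series_incr_3 (f : nat -> R) : ex_series f -> ex_series (fun k => f (S (S (S k)))).
Proof.
  intros H. apply (ex_series_incr_1 (fun k => f (S (S k)))).
  apply (ex_series_incr_1 (fun k => f (S k))). now apply (ex_series_incr_1 f).
Qed.

Lemma ex_series_prime_npow (sigma : R) : 1 < sigma ->
  ex_series (fun k => prime_npow sigma (S (S (S k)))).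
Proof.
  intros Hs. apply ex_series_Rle with (fun k => npow sigma (S (S (S k)))).
  - intros k. generalize (prime_npow_bounds sigma (S (S (S k)))). intros B.
    rewrite Rabs_pos_eq; lra.
  - apply ex_series_incr_3. now apply ex_series_npow.
Qed.

(** The inequality behind the restriction to [sigma >= 2.8]: the left side is below 0.067, the right
    side above 0.071. *)
Lemma Series_prime_npow_14_5 :
  Series (fun k => prime_npow (INR 14 / 5) (S (S (S k)))) <= npow (INR 14 / 5) 2 / 2.
Proof.
  set (s := INR 14 / 5).
  assert (Hs : s = 2.8) by (unfold s; simpl; lra).
  assert (EX := ex_series_prime_npow s ltac:(lra)).
  (* The 20 explicit indices are the integers 3 to 22, with the primes 3 to 19; from 23 on the sum
     is bounded over all integers. *)
  rewrite (Series_incr_n _ 20) by (lia || exact EX).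
  assert (T : Series (fun k => prime_npow s (S (S (S (20 + k))))) <= / (s - 1) * npow (s - 1) 22).
  { set (u := fun k => / (s - 1) * npow (s - 1) (22 + k)).
    change (/ (s - 1) * npow (s - 1) 22) with (u 0%nat).
    apply (ex_series_telescope (fun k => prime_npow s (S (S (S (20 + k))))) u).
    - intros k. generalize (prime_npow_bounds s (S (S (S (20 + k))))). intros [B1 B2].
      split; [exact B1|]. eapply Rle_trans; [exact B2|]. unfold u.
      replace (S (S (S (20 + k)))) with (S (22 + k)) by lia.
      replace (22 + S k)%nat with (S (22 + k)) by lia. apply npow_telescope; [lra|lia].
    - intros k. unfold u. apply Rmult_le_pos; [|apply npow_ge_0].
      left. apply Rinv_0_lt_compat. lra. }
  assert (T22 : npow (s - 1) 22 <= 0.0039).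
  { replace (s - 1) with (INR 9 / 5) by (rewrite Hs; simpl; lra).
    apply npow_le_rat; [lia|lra|]. simpl INR. lra. }
  assert (T2 : 0.143 <= npow s 2) by (apply rat_le_npow; [lia|lra|simpl INR; lra]).
  assert (T3 : npow s 3 <= 0.0462) by (apply npow_le_rat; [lia|lra|simpl INR; lra]).
  assert (T5 : npow s 5 <= 0.0111) by (apply npow_le_rat; [lia|lra|simpl INR; lra]).
  assert (T7 : npow s 7 <= 0.00431) by (apply npow_le_rat; [lia|lra|simpl INR; lra]).
  assert (T11 : npow s 11 <= 0.00122) by (apply npow_le_rat; [lia|lra|simpl INR; lra]).
  assert (T13 : npow s 13 <= 0.00077) by (apply npow_le_rat; [lia|lra|simpl INR; lra]).
  assert (T17 : npow s 17 <= 0.00037) by (apply npow_le_rat; [lia|lra|simpl INR; lra]).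
  assert (T19 : npow s 19 <= 0.00027) by (apply npow_le_rat; [lia|lra|simpl INR; lra]).
  assert (F : sum_f_R0 (fun k => prime_npow s (S (S (S k)))) (pred 20) <=
    0.0462 + 0.0111 + 0.00431 + 0.00122 + 0.00077 + 0.00037 + 0.00027).
  { cbn [pred sum_f_R0]. unfold prime_npow.
    repeat match goal with |- context [is_prime ?n] =>
      let b := eval vm_compute in (is_prime n) in change (is_prime n) with b end.
    cbv iota. lra. }
  assert (I : / (s - 1) * npow (s - 1) 22 <= 0.0022).
  { replace (/ (s - 1)) with (5 / 9); [lra|].
    replace (s - 1) with (9 / 5) by lra. field. }
  lra.
Qed.

(** Increasing the exponent multiplies [2^(-sigma)] by [d] and every other prime power by at most
    [d], so the inequality is inherited from 2.8. *)
Lemma Series_prime_npow_le (sigma : R) : 2.8 <= sigma ->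
  Series (fun k => prime_npow sigma (S (S (S k)))) <= npow sigma 2 / 2.
Proof.
  intros Hs. set (s := INR 14 / 5). assert (Es : s = 2.8) by (unfold s; simpl; lra).
  set (d := npow (sigma - s) 2).
  assert (D : npow sigma 2 = d * npow s 2).
  { unfold d. rewrite <- npow_plus. f_equal. ring. }
  assert (Hd : 0 < d) by (apply npow_pos; lia).
  apply Rle_trans with (d * Series (fun k => prime_npow s (S (S (S k))))).
  - rewrite <- Series_scal_l. apply Series_le.
    + intros k. split; [apply prime_npow_bounds|]. unfold prime_npow.
      destruct (is_prime _); [|lra].
      replace sigma with ((sigma - s) + s) by ring. rewrite npow_plus.
      apply Rmult_le_compat_r; [apply npow_ge_0|]. apply npow_decr; [lra|lia].
    + apply ex_series_Rscal, ex_series_prime_npow. lra.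
  - rewrite D. generalize Series_prime_npow_14_5. fold s. nra.
Qed.

Lemma npow_2_le (sigma : R) : 2.8 <= sigma -> npow sigma 2 <= 0.144.
Proof.
  intros Hs. apply Rle_trans with (npow (INR 14 / 5) 2).
  - apply npow_anti. simpl. lra.
  - apply npow_le_rat; [lia|lra|simpl INR; lra].
Qed.

Lemma npow_3_le (sigma : R) (q : nat) : 2.8 <= sigma -> (3 <= q)%nat -> npow sigma q <= 0.0462.
Proof.
  intros Hs Hq. apply Rle_trans with (npow sigma 3); [apply npow_decr; [lra|lia]|].
  apply Rle_trans with (npow (INR 14 / 5) 3).
  - apply npow_anti. simpl. lra.
  - apply npow_le_rat; [lia|lra|simpl INR; lra].
Qed.

Lemma ln_ge_ln_3 (q : nat) : (3 <= q)%nat -> 1.0986 <= ln (INR q).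
Proof.
  intros Hq. apply Rle_trans with (ln 3); [left; apply ln_3_lower|].
  apply ln_le; [lra|]. replace 3 with (INR 3) by (simpl; lra). now apply le_INR.
Qed.

(** On [|w| = r] the real part of [w / (1 - w)] runs from [- r / (1 + r)] at [w = - r] to
    [r / (1 - r)] at [w = r]. With [m = |1 - w|^2], the two defects and the squared sine become
    fractions over [m] that share the factors [r - Re w] and [r + Re w], so they can be compared. *)
Lemma mobius_identities (w : C) (r : R) : Cmod w = r -> 0 < r < 1 ->
  exists m, 0 < m /\
    r / (1 - r) - Re (w / (1 - w))%C = (1 + r) * (r - Re w) / ((1 - r) * m) /\
    Re (w / (1 - w))%C + r / (1 + r) = (1 - r) * (r + Re w) / ((1 + r) * m) /\
    sin_arg (1 - w)%C * sin_arg (1 - w)%C = (r * r - Re w * Re w) / m /\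
    - r <= Re w <= r.
Proof.
  intros Hw Hr.
  assert (N := one_minus_neq_0 w ltac:(lra)). apply Cmod_gt_0 in N.
  assert (Q := Cmod_sqr w). rewrite Hw in Q.
  assert (M := Cmod_sqr (1 - w)%C).
  exists (Cmod (1 - w)%C * Cmod (1 - w)%C).
  assert (Mp : 0 < Cmod (1 - w)%C * Cmod (1 - w)%C) by nra.
  split; [exact Mp|].
  assert (B : - r <= Re w <= r).
  { generalize (re_le_Cmod w). rewrite Hw. intros H. now apply Rabs_le_between in H. }
  assert (SA : sin_arg (1 - w)%C * sin_arg (1 - w)%C =
    (Im w * Im w) / (Cmod (1 - w)%C * Cmod (1 - w)%C)).
  { unfold sin_arg. replace (Im (1 - w)%C) with (- Im w) by (destruct w; unfold Im; simpl; ring).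
    rewrite Rabs_Ropp.
    replace (Im w * Im w) with (Rabs (Im w) * Rabs (Im w)) by (symmetry; apply Rsqr_abs).
    field. lra. }
  assert (RX : Re (w / (1 - w))%C = (Re w - r * r) / (Cmod (1 - w)%C * Cmod (1 - w)%C)).
  { rewrite M, Q. rewrite M in Mp. destruct w as [x y].
    unfold Re, Im in *; simpl in *. field.
    repeat split; intros E; nra. }
  assert (ME : Cmod (1 - w)%C * Cmod (1 - w)%C = 1 - 2 * Re w + r * r).
  { rewrite M, Q. destruct w as [x y]. unfold Re, Im; simpl. ring. }
  rewrite RX, SA. rewrite ME in *. repeat split; try lra.
  - field. lra.
  - field. lra.
  - rewrite Q. f_equal. ring.
Qed.

(** The common factor [r - Re w] cancels and leaves [(r + Re w) (1 - r) <= 2 r (1 + r)]. This lemma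
    and [mobius_lower] bound from below the loss at an odd prime; [mobius_left] and [mobius_right]
    bound from above the gain at 2. *)
Lemma mobius_upper (w : C) (r : R) : Cmod w = r -> 0 < r < 1 ->
  Re (w / (1 - w))%C <= r / (1 - r) - sin_arg (1 - w)%C * sin_arg (1 - w)%C / (2 * r).
Proof.
  intros Hw Hr. destruct (mobius_identities w r Hw Hr) as [m [Hm [H1 [_ [H3 B]]]]].
  rewrite H3. set (x := Re w) in *.
  enough ((r * r - x * x) / m / (2 * r) <= (1 + r) * (r - x) / ((1 - r) * m)) by lra.
  apply Rmult_le_reg_r with (2 * r * ((1 - r) * m)); [apply Rmult_lt_0_compat; nra|].
  replace ((r * r - x * x) / m / (2 * r) * (2 * r * ((1 - r) * m))) with
    ((r - x) * ((r + x) * (1 - r))) by (field; lra).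
  replace ((1 + r) * (r - x) / ((1 - r) * m) * (2 * r * ((1 - r) * m))) with
    ((r - x) * ((1 + r) * (2 * r))) by (field; lra).
  apply Rmult_le_compat_l; [lra|]. nra.
Qed.

Lemma mobius_lower (w : C) (r : R) : Cmod w = r -> 0 < r < 1 ->
  - (r / (1 + r)) + (1 - r) / (1 + r) * (sin_arg (1 - w)%C * sin_arg (1 - w)%C / (2 * r)) <=
  Re (w / (1 - w))%C.
Proof.
  intros Hw Hr. destruct (mobius_identities w r Hw Hr) as [m [Hm [_ [H2 [H3 B]]]]].
  rewrite H3. set (x := Re w) in *.
  enough ((1 - r) / (1 + r) * ((r * r - x * x) / m / (2 * r)) <=
    (1 - r) * (r + x) / ((1 + r) * m)) by lra.
  apply Rmult_le_reg_r with (2 * r * ((1 + r) * m)); [apply Rmult_lt_0_compat; nra|].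
  replace ((1 - r) / (1 + r) * ((r * r - x * x) / m / (2 * r)) * (2 * r * ((1 + r) * m))) with
    ((1 - r) * (r + x) * (r - x)) by (field; lra).
  replace ((1 - r) * (r + x) / ((1 + r) * m) * (2 * r * ((1 + r) * m))) with
    ((1 - r) * (r + x) * (2 * r)) by (field; lra).
  apply Rmult_le_compat_l; [apply Rmult_le_pos; lra|lra].
Qed.

Lemma mobius_left (w : C) (r : R) : Cmod w = r -> 0 < r < 1 -> Re w <= 0 ->
  Re (w / (1 - w))%C <= - (r / (1 + r)) + sin_arg (1 - w)%C * sin_arg (1 - w)%C / r.
Proof.
  intros Hw Hr Hx. destruct (mobius_identities w r Hw Hr) as [m [Hm [_ [H2 [H3 B]]]]].
  rewrite H3. set (x := Re w) in *.
  enough ((1 - r) * (r + x) / ((1 + r) * m) <= (r * r - x * x) / m / r) by lra.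
  apply Rmult_le_reg_r with (r * ((1 + r) * m)); [apply Rmult_lt_0_compat; nra|].
  replace ((r * r - x * x) / m / r * (r * ((1 + r) * m))) with
    ((r + x) * ((r - x) * (1 + r))) by (field; lra).
  replace ((1 - r) * (r + x) / ((1 + r) * m) * (r * ((1 + r) * m))) with
    ((r + x) * ((1 - r) * r)) by (field; lra).
  apply Rmult_le_compat_l; [lra|nra].
Qed.

Lemma mobius_right (w : C) (r : R) : Cmod w = r -> 0 < r < 1 -> 0 <= Re w ->
  r / (1 - r) - (1 + r) / (1 - r) * (sin_arg (1 - w)%C * sin_arg (1 - w)%C / r) <=
  Re (w / (1 - w))%C.
Proof.
  intros Hw Hr Hx. destruct (mobius_identities w r Hw Hr) as [m [Hm [H1 [_ [H3 B]]]]].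
  rewrite H3. set (x := Re w) in *.
  enough ((1 + r) * (r - x) / ((1 - r) * m) <=
    (1 + r) / (1 - r) * ((r * r - x * x) / m / r)) by lra.
  apply Rmult_le_reg_r with (r * ((1 - r) * m)); [apply Rmult_lt_0_compat; nra|].
  replace ((1 + r) / (1 - r) * ((r * r - x * x) / m / r) * (r * ((1 - r) * m))) with
    ((1 + r) * (r - x) * (r + x)) by (field; lra).
  replace ((1 + r) * (r - x) / ((1 - r) * m) * (r * ((1 - r) * m))) with
    ((1 + r) * (r - x) * r) by (field; lra).
  apply Rmult_le_compat_l; [apply Rmult_le_pos; lra|lra].
Qed.

Definition odd_term (sigma : R) (q : nat) : R :=
  if is_prime q then ln (INR q) * (npow sigma q / (1 - npow sigma q)) else 0.

Definition odd_sum (sigma : R) : R := Series (fun k => odd_term sigma (S (S (S k)))).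

(* The logarithmic derivative of [sum lambda(n) n^(-sigma)], [lambda (n) = (-1)^(v_2 n)],
   up to sign; [E] is its zero. *)
Definition Psi (sigma : R) : R := odd_sum sigma - ln 2 * (npow sigma 2 / (1 + npow sigma 2)).

Lemma npow_le_half (sigma : R) (q : nat) : 1 < sigma -> (2 <= q)%nat -> npow sigma q <= 1 / 2.
Proof.
  intros Hs Hq. apply Rle_trans with (npow 1 2).
  - apply Rle_trans with (npow sigma 2); [apply npow_decr; [lra|lia]|apply npow_anti; lra].
  - unfold npow. rewrite Rmult_1_l, exp_Ropp, exp_ln by (simpl; lra). simpl. lra.
Qed.

Lemma odd_term_bounds (sigma : R) (q : nat) : 1 < sigma -> (2 <= q)%nat ->
  0 <= odd_term sigma q <= 2 * (ln (INR q) * npow sigma q).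
Proof.
  intros Hs Hq. unfold odd_term.
  generalize (ln_INR_ge_0 q) (npow_ge_0 sigma q) (npow_le_half sigma q Hs Hq).
  generalize (ln (INR q)) (npow sigma q). intros l r H1 H2 H3.
  assert (Q : 0 <= r / (1 - r) <= 2 * r).
  { split.
    - apply Rmult_le_pos; [lra|]. left. apply Rinv_0_lt_compat. lra.
    - apply Rmult_le_reg_r with (1 - r); [lra|]. unfold Rdiv. rewrite Rmult_assoc, Rinv_l by lra. nra. }
  destruct (is_prime q); nra.
Qed.

Lemma ex_series_odd_term (sigma : R) : 1 < sigma ->
  ex_series (fun k => odd_term sigma (S (S (S k)))).
Proof.
  intros Hs. apply ex_series_Rle with
    (fun k => 2 * (ln (INR (S (S (S k)))) * npow sigma (S (S (S k))))).
  - intros k. generalize (odd_term_bounds sigma (S (S (S k))) Hs ltac:(lia)). intros B.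
    rewrite Rabs_pos_eq; lra.
  - apply ex_series_Rscal, (ex_series_incr_3 (fun n => ln (INR n) * npow sigma n)).
    now apply ex_series_ln_npow.
Qed.

Lemma Re_euler_term (a : nat -> C) (q : nat) :
  Re (euler_term a q) = if is_prime q then ln (INR q) * Re (a q / (1 - a q))%C else 0.
Proof.
  unfold euler_term. destruct (is_prime q); [|reflexivity].
  generalize (a q / (1 - a q))%C. intros [x y]. unfold Re; simpl. ring.
Qed.

(* [s^2 / (2 r) >= k s - k^2 r / 2] for every [k]: Cauchy-Schwarz, linearised. *)
Lemma euler_term_odd (a : nat -> C) (sigma k : R) (q : nat) : 2.8 <= sigma -> cmult a sigma ->
  (3 <= q)%nat ->
  Rabs (Re (euler_term a q)) <=
  odd_term sigma q - (k * prime_sin_arg a q - k * k / 2 * prime_npow sigma q).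
Proof.
  intros Hs Ha Hq. rewrite Re_euler_term. unfold odd_term, prime_sin_arg, prime_npow.
  destruct (is_prime q); [|rewrite Rabs_R0; lra].
  assert (L := ln_ge_ln_3 q Hq). assert (R3 := npow_3_le sigma q Hs Hq).
  assert (R0 := npow_pos sigma q ltac:(lia)).
  assert (M := cmult_mod _ _ Ha q).
  assert (U := mobius_upper (a q) (npow sigma q) M ltac:(lra)).
  assert (V := mobius_lower (a q) (npow sigma q) M ltac:(lra)).
  revert L R3 R0 U V.
  generalize (ln (INR q)) (npow sigma q) (sin_arg (1 - a q)%C) (Re (a q / (1 - a q))%C).
  intros l r s X L R3 R0 U V.
  assert (G : k * s - k * k / 2 * r <= s * s / (2 * r)).
  { apply Rmult_le_reg_r with (2 * r); [lra|].
    unfold Rdiv at 2. rewrite Rmult_assoc, Rinv_l, Rmult_1_r by lra.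
    generalize (Rle_0_sqr (s - k * r)). unfold Rsqr. nra. }
  assert (G0 : 0 <= s * s / (2 * r)).
  { apply Rmult_le_pos; [apply Rle_0_sqr|]. left. apply Rinv_0_lt_compat. lra. }
  set (g := s * s / (2 * r)) in *. set (t := r / (1 - r)) in *.
  assert (T0 : 0 < t) by (apply Rdiv_lt_0_compat; lra).
  assert (T1 : r / (1 + r) <= t).
  { unfold t, Rdiv. apply Rmult_le_compat_l; [lra|]. apply Rinv_le_contravar; lra. }
  (* The product [0.911 * 1.0986] just exceeds 1, so even after the factor [(1 - r) / (1 + r)] the
     weight [log q >= log 3] keeps the loss at least [g]. *)
  assert (W : 0.911 <= (1 - r) / (1 + r)).
  { apply Rmult_le_reg_r with (1 + r); [lra|]. unfold Rdiv. rewrite Rmult_assoc, Rinv_l by lra. lra. }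
  apply Rabs_le. split.
  - assert (l * X >= l * (- t + 0.911 * g)).
    { apply Rle_ge, Rmult_le_compat_l; [lra|]. nra. }
    nra.
  - assert (l * X <= l * (t - g)) by (apply Rmult_le_compat_l; lra). nra.
Qed.

(** The linearised losses are summed: the sines at the odd primes add up to at least the sine [S2]
    at 2, and the moduli to at most [r / 2]. *)
Lemma euler_odd_sum (a : nat -> C) (sigma : R) : 2.8 <= sigma -> cmult a sigma ->
  Im (sieve_sum a 1) = 0 ->
  Rabs (Re (sieve_ln a 1 / sieve_sum a 1)%C - Re (euler_term a 2)) <=
  odd_sum sigma - sin_arg (1 - a 2%nat)%C * sin_arg (1 - a 2%nat)%C / npow sigma 2.
Proof.
  intros Hs Ha Hi.
  assert (E := is_series_euler a sigma ltac:(lra) Ha).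
  assert (EX : ex_series (fun k => Re (euler_term a (S (S k))))) by (eexists; exact E).
  apply is_series_unique in E. rewrite Series_incr_1 in E by exact EX. rewrite <- E.
  replace (Re (euler_term a 2) + Series (fun k => Re (euler_term a (S (S (S k))))) -
    Re (euler_term a 2)) with (Series (fun k => Re (euler_term a (S (S (S k)))))) by ring.
  set (S2 := sin_arg (1 - a 2%nat)%C). set (r := npow sigma 2).
  assert (Pr : 0 < r) by (apply npow_pos; lia).
  (* The maximiser of [k * S2 - k^2 * r / 4], with maximum [S2^2 / r]. *)
  set (k := 2 * S2 / r).
  assert (S20 : 0 <= S2) by (apply sin_arg_ge_0, cmult_one_minus_neq_0 with sigma; trivial; lra).
  assert (K0 : 0 <= k) by (apply Rmult_le_pos; [lra|left; now apply Rinv_0_lt_compat]).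
  assert (X1 := ex_series_odd_term sigma ltac:(lra)).
  assert (X2 := ex_series_prime_sin_arg a sigma ltac:(lra) Ha).
  assert (X3 := ex_series_prime_npow sigma ltac:(lra)).
  set (B := fun j => odd_term sigma (S (S (S j))) - (k * prime_sin_arg a (S (S (S j))) -
    k * k / 2 * prime_npow sigma (S (S (S j))))).
  assert (X4 : ex_series (fun j => k * prime_sin_arg a (S (S (S j))) -
    k * k / 2 * prime_npow sigma (S (S (S j))))).
  { apply (ex_series_minus (V := R_NormedModule) (fun j => k * prime_sin_arg a (S (S (S j))))
      (fun j => k * k / 2 * prime_npow sigma (S (S (S j))))); now apply ex_series_Rscal. }
  assert (XB : ex_series B).
  { apply (ex_series_minus (V := R_NormedModule) (fun j => odd_term sigma (S (S (S j))))
      (fun j => k * prime_sin_arg a (S (S (S j))) - k * k / 2 * prime_npow sigma (S (S (S j))))); trivial. }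
  assert (EB : Series B = odd_sum sigma - (k * Series (fun j => prime_sin_arg a (S (S (S j)))) -
    k * k / 2 * Series (fun j => prime_npow sigma (S (S (S j)))))).
  { unfold B. rewrite Series_minus, Series_minus, !Series_scal_l; trivial; now apply ex_series_Rscal. }
  assert (T : Rabs (Series (fun k => Re (euler_term a (S (S (S k)))))) <= Series B).
  { assert (BD : forall n, Rabs (Re (euler_term a (S (S (S n))))) <= B n).
    { intros n. apply euler_term_odd; trivial. lia. }
    eapply Rle_trans; [apply Series_Rabs|].
    - apply ex_series_Rle with B; [|exact XB]. intros n. rewrite Rabs_Rabsolu. apply BD.
    - apply Series_le; [|exact XB]. intros n. split; [apply Rabs_pos|apply BD]. }
  eapply Rle_trans; [exact T|]. rewrite EB.
  assert (F1 := sin_arg_two_le a sigma ltac:(lra) Ha Hi). fold S2 in F1.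
  assert (F2 := Series_prime_npow_le sigma Hs). fold r in F2.
  assert (F3 : k * S2 <= k * Series (fun j => prime_sin_arg a (S (S (S j))))) by now apply Rmult_le_compat_l.
  assert (F4 : k * k / 2 * Series (fun j => prime_npow sigma (S (S (S j)))) <= k * k / 2 * (r / 2)).
  { apply Rmult_le_compat_l; [nra|exact F2]. }
  assert (F5 : k * S2 - k * k / 2 * (r / 2) = S2 * S2 / r) by (unfold k; field; lra).
  lra.
Qed.

(** The odd primes lose [t] and the factor at 2 gains at most [ln 2 * t]; the constant 0.3 is below
    [1 - ln 2]. *)
Lemma log_deriv_left (a : nat -> C) (sigma : R) : 2.8 <= sigma -> cmult a sigma ->
  Im (sieve_sum a 1) = 0 -> Re (a 2%nat) <= 0 ->
  Re (sieve_ln a 1 / sieve_sum a 1)%C <=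
  Psi sigma - 0.3 * (sin_arg (1 - a 2%nat)%C * sin_arg (1 - a 2%nat)%C / npow sigma 2).
Proof.
  intros Hs Ha Hi Hr. assert (H := euler_odd_sum a sigma Hs Ha Hi).
  apply Rabs_le_between in H. rewrite Re_euler_term in H. change (is_prime 2) with true in H.
  cbv iota in H. change (INR 2) with 2 in H.
  assert (R0 := npow_pos sigma 2 ltac:(lia)). assert (R1 := npow_2_le sigma Hs).
  assert (M := mobius_left (a 2%nat) _ (cmult_mod _ _ Ha 2%nat) ltac:(lra) Hr).
  assert (L := ln_2_bounds). unfold Psi.
  set (t := sin_arg (1 - a 2%nat)%C * sin_arg (1 - a 2%nat)%C / npow sigma 2) in *.
  assert (T : 0 <= t).
  { apply Rmult_le_pos; [apply Rle_0_sqr|left; now apply Rinv_0_lt_compat]. }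
  assert (Q : ln 2 * Re (a 2%nat / (1 - a 2%nat))%C <=
    ln 2 * (- (npow sigma 2 / (1 + npow sigma 2)) + t)) by (apply Rmult_le_compat_l; lra).
  nra.
Qed.

Lemma log_deriv_right (a : nat -> C) (sigma : R) : 2.8 <= sigma -> cmult a sigma ->
  Im (sieve_sum a 1) = 0 -> 0 <= Re (a 2%nat) -> Psi sigma <= 0 ->
  0 < Re (sieve_ln a 1 / sieve_sum a 1)%C.
Proof.
  intros Hs Ha Hi Hr HP. assert (H := euler_odd_sum a sigma Hs Ha Hi).
  apply Rabs_le_between in H. rewrite Re_euler_term in H. change (is_prime 2) with true in H.
  cbv iota in H. change (INR 2) with 2 in H. unfold Psi in HP.
  assert (R0 := npow_pos sigma 2 ltac:(lia)). assert (R1 := npow_2_le sigma Hs).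
  assert (M := mobius_right (a 2%nat) _ (cmult_mod _ _ Ha 2%nat) ltac:(lra) Hr).
  assert (L := ln_2_bounds).
  set (t := sin_arg (1 - a 2%nat)%C * sin_arg (1 - a 2%nat)%C / npow sigma 2) in *.
  assert (T : 0 <= t).
  { apply Rmult_le_pos; [apply Rle_0_sqr|left; now apply Rinv_0_lt_compat]. }
  set (r := npow sigma 2) in *.
  (* What matters is [1.4 * ln 2 < 1]: the loss [t] at the odd primes still outweighs the gain at
     2. *)
  assert (Q1 : (1 + r) / (1 - r) <= 1.4).
  { apply Rmult_le_reg_r with (1 - r); [lra|]. unfold Rdiv. rewrite Rmult_assoc, Rinv_l by lra. lra. }
  assert (Q2 : r / (1 + r) < r / (1 - r)).
  { unfold Rdiv. apply Rmult_lt_compat_l; [lra|]. apply Rinv_lt_contravar; nra. }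
  assert (Q3 : (1 + r) / (1 - r) * t <= 1.4 * t) by (apply Rmult_le_compat_r; lra).
  assert (Q : ln 2 * (r / (1 - r) - 1.4 * t) <= ln 2 * Re (a 2%nat / (1 - a 2%nat))%C)
    by (apply Rmult_le_compat_l; lra).
  nra.
Qed.

(** From [s] to [s'] the odd sum shrinks at least by the factor [3^(s - s')], the term at 2 at most
    by the larger factor [2^(s - s')]. So [Psi] cannot return to 0 once it is nonpositive, which
    gives uniqueness of its zero and its sign on both sides. *)
Lemma Psi_decr (s s' : R) : 1 < s -> s < s' -> Psi s <= 0 -> Psi s' < 0.
Proof.
  intros Hs Hss HP. unfold Psi in *.
  set (d2 := npow (s' - s) 2). set (d3 := npow (s' - s) 3).
  assert (D3 : 0 < d3) by (apply npow_pos; lia).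
  assert (D32 : d3 < d2).
  { unfold d2, d3, npow. apply exp_increasing, Ropp_lt_contravar, Rmult_lt_compat_l; [lra|].
    apply ln_increasing; simpl; lra. }
  assert (D2 : d2 < 1) by (apply npow_lt_1; [lra|lia]).
  assert (R2 : npow s' 2 = npow s 2 * d2).
  { unfold d2. rewrite <- npow_plus. f_equal. ring. }
  assert (R0 := npow_pos s 2 ltac:(lia)).
  assert (O : odd_sum s' <= d3 * odd_sum s).
  { unfold odd_sum. rewrite <- Series_scal_l. apply Series_le.
    2: { apply ex_series_Rscal. now apply ex_series_odd_term. }
    intros k. split; [apply odd_term_bounds; [lra|lia]|].
    set (q := S (S (S k))). unfold odd_term. destruct (is_prime q); [|lra].
    assert (Q0 := npow_pos s q ltac:(lia)). assert (Q1 := npow_le_half s q Hs ltac:(lia)).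
    assert (QS : npow s' q = npow s q * npow (s' - s) q).
    { rewrite <- npow_plus. f_equal. ring. }
    assert (QD : npow (s' - s) q <= d3) by (apply npow_decr; [lra|lia]).
    assert (QP := npow_pos (s' - s) q ltac:(lia)).
    rewrite QS. set (r := npow s q) in *. set (e := npow (s' - s) q) in *.
    assert (F : r * e / (1 - r * e) <= d3 * (r / (1 - r))).
    { apply Rle_trans with (r * e / (1 - r)).
      - unfold Rdiv. apply Rmult_le_compat_l; [nra|]. apply Rinv_le_contravar; nra.
      - replace (d3 * (r / (1 - r))) with (r * d3 / (1 - r)) by (field; lra).
        unfold Rdiv. apply Rmult_le_compat_r; [left; apply Rinv_0_lt_compat; lra|nra]. }
    generalize (ln_INR_ge_0 q). intros. nra. }
  rewrite R2. set (r := npow s 2) in *. assert (L := ln_2_bounds).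
  assert (C : d3 * (r / (1 + r)) < r * d2 / (1 + r * d2)).
  { apply Rlt_le_trans with (d2 * (r / (1 + r))).
    - apply Rmult_lt_compat_r; [apply Rdiv_lt_0_compat; lra|exact D32].
    - replace (d2 * (r / (1 + r))) with (r * d2 * / (1 + r)) by (field; lra).
      unfold Rdiv. apply Rmult_le_compat_l; [nra|]. apply Rinv_le_contravar; nra. }
  set (x := r * d2 / (1 + r * d2)) in *. set (y := r / (1 + r)) in *.
  assert (d3 * odd_sum s <= d3 * (ln 2 * y)) by (apply Rmult_le_compat_l; lra).
  nra.
Qed.

(** * From the logarithmic derivative to zeta, its turning points and the equation of [E] *)

Lemma zterm_real (sigma : R) (n : nat) : zterm (RtoC sigma) n = RtoC (npow sigma n).
Proof.
  destruct n as [|n]; [reflexivity|]. unfold zterm, natCpow, npow, Cexp.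
  set (l := ln (INR (S n))). unfold Re, Im; simpl fst; simpl snd.
  replace (- sigma * l - - 0 * 0) with (- (sigma * l)) by ring.
  replace (- sigma * 0 + - 0 * l) with 0 by ring. rewrite cos_0, sin_0.
  apply injective_projections; simpl; ring.
Qed.

Lemma cmult_zterm (s : C) : cmult (zterm s) (Re s).
Proof.
  split.
  - reflexivity.
  - apply zterm_1.
  - apply zterm_mult.
  - apply Cmod_zterm.
Qed.

Lemma rough_le_1 (n : nat) : rough 1 n = true.
Proof. reflexivity. Qed.

Lemma sieve_sum_1 (c : nat -> C) (s : C) :
  sieve_sum (fun n => c n * zterm s n)%C 1 = dirichlet c s.
Proof. reflexivity. Qed.

Lemma sieve_ln_1 (c : nat -> C) (s : C) :
  sieve_ln (fun n => c n * zterm s n)%C 1 = dirichlet_ln c s.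
Proof.
  apply CSeries_ext. intros n. unfold sieved. rewrite rough_le_1. ring.
Qed.

Lemma cmult_ext (a b : nat -> C) (sigma : R) : (forall n, a n = b n) -> cmult a sigma -> cmult b sigma.
Proof.
  intros E [H0 H1 HM HN]. split; intros; rewrite <- !E; auto.
Qed.

Lemma cmult_one (s : C) : cmult (fun n => one_coef n * zterm s n)%C (Re s).
Proof.
  apply cmult_ext with (zterm s); [|apply cmult_zterm]. intros n. unfold one_coef. ring.
Qed.

Lemma Series_tail_npow_lt_1 (sigma : R) : 2 < sigma -> Series (tail (npow sigma) 1) < 1.
Proof.
  intros Hs. assert (X := ex_series_npow sigma ltac:(lra)).
  rewrite (Series_incr_n _ 2); [|lia|apply ex_series_tail; [apply npow_ge_0|exact X]].
  simpl sum_f_R0. unfold tail at 1 2. simpl Nat.leb. cbv iota.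
  assert (T : Series (fun k => tail (npow sigma) 1 (2 + k)) <= / (sigma - 1) * npow (sigma - 1) 1).
  { apply (ex_series_telescope (fun k => tail (npow sigma) 1 (2 + k))
      (fun k => / (sigma - 1) * npow (sigma - 1) (S k))).
    - intros k. split; [apply tail_bounds, npow_ge_0|]. unfold tail. simpl Nat.leb. cbv iota.
      apply npow_telescope; [lra|lia].
    - intros k. apply Rmult_le_pos; [|apply npow_ge_0]. left. apply Rinv_0_lt_compat. lra. }
  rewrite npow_1, Rmult_1_r in T.
  assert (/ (sigma - 1) < 1) by (rewrite <- Rinv_1; apply Rinv_lt_contravar; lra). lra.
Qed.

(** The sum differs from 1 by at most [sum_(n >= 2) n^(-sigma) < 1]. Hence a real value is positive,
    and the sign of the logarithmic derivative passes to the derivative. *)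
Lemma sieve_sum_Re_pos (a : nat -> C) (sigma : R) : 2 < sigma -> cmult a sigma ->
  0 < Re (sieve_sum a 1).
Proof.
  intros Hs Ha. generalize (sieve_sum_minus_1 a sigma 1 ltac:(lra) Ha ltac:(lia)).
  generalize (Series_tail_npow_lt_1 sigma Hs). intros H1 H2.
  generalize (re_le_Cmod (sieve_sum a 1 - 1)%C). intros H3. apply Rabs_le_between in H3.
  destruct (sieve_sum a 1) as [x y]. unfold Re in *; simpl in *. lra.
Qed.

Lemma Re_div_real (z w : C) : Im w = 0 -> Re w <> 0 -> Re z = Re w * Re (z / w)%C.
Proof.
  intros H1 H2. destruct z as [x y], w as [u v]. unfold Re, Im in *; simpl in *. subst v.
  field. nra.
Qed.

(** The last alternative admits the line [Re s = E]: there [Psi] vanishes, and strictness must come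
    from the quadratic loss, which is nonzero unless the term at 2 is real. *)
Lemma dirichlet_ln_left (c : nat -> C) (s : C) :
  cmult (fun n => c n * zterm s n)%C (Re s) -> 2.8 <= Re s -> Psi (Re s) <= 0 ->
  Im (dirichlet c s) = 0 -> Re (c 2%nat * zterm s 2)%C <= 0 ->
  (Psi (Re s) < 0 \/ Im (c 2%nat * zterm s 2)%C <> 0) -> Re (dirichlet_ln c s) < 0.
Proof.
  intros Ha Hs HP Hi Hr Hx.
  set (a := fun n => (c n * zterm s n)%C) in *.
  assert (P := sieve_sum_Re_pos a (Re s) ltac:(lra) Ha).
  rewrite <- (sieve_sum_1 c s) in Hi. fold a in Hi.
  assert (Q := log_deriv_left a (Re s) Hs Ha Hi Hr).
  rewrite <- (sieve_ln_1 c s). fold a.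
  rewrite (Re_div_real (sieve_ln a 1) (sieve_sum a 1) Hi ltac:(lra)).
  assert (R0 := npow_pos (Re s) 2 ltac:(lia)).
  assert (N := cmult_one_minus_neq_0 a (Re s) 2 ltac:(lra) Ha ltac:(lia)).
  set (t := sin_arg (1 - a 2%nat)%C) in *.
  assert (T : 0 <= t * t / npow (Re s) 2).
  { apply Rmult_le_pos; [apply Rle_0_sqr|left; now apply Rinv_0_lt_compat]. }
  enough (Re (sieve_ln a 1 / sieve_sum a 1)%C < 0) by nra.
  destruct Hx as [Hx|Hx]; [lra|].
  assert (T' : 0 < t * t / npow (Re s) 2); [|lra].
  apply Rdiv_lt_0_compat; [|exact R0]. apply Rlt_0_sqr.
  unfold t, sin_arg. apply Cmod_gt_0 in N.
  apply Rgt_not_eq. apply Rdiv_lt_0_compat; [|exact N]. apply Rabs_pos_lt.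
  unfold a. intros E. apply Hx. destruct (c 2%nat * zterm s 2)%C as [x y].
  unfold Im in *; simpl in *. lra.
Qed.

(** Right of [E], at a point where zeta is real, [Re zeta'] is positive if [Re 2^(-b) <= 0] and
    negative otherwise, so it is never 0. *)
Lemma turning_point_bound (E : R) (b : C) : 2.8 <= E -> Psi E = 0 -> turning_point b -> Re b <= E.
Proof.
  intros HE HP [_ [Hi [d [Hd Hr]]]].
  destruct (Rle_lt_dec (Re b) E) as [H|H]; [exact H|exfalso].
  assert (HPb : Psi (Re b) < 0) by (apply Psi_decr with E; lra).
  rewrite zeta_dirichlet_series in Hi by lra.
  apply is_zeta'_unique in Hd; [|lra]. subst d.
  assert (Hr' : Re (dirichlet_ln one_coef b) = 0).
  { destruct (dirichlet_ln one_coef b); unfold Re in *; simpl in *. lra. }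
  assert (Ha := cmult_one b).
  destruct (Rle_lt_dec (Re (one_coef 2 * zterm b 2)%C) 0) as [L|L].
  - generalize (dirichlet_ln_left one_coef b Ha ltac:(lra) ltac:(lra) Hi L (or_introl HPb)). lra.
  - rewrite <- sieve_sum_1 in Hi. rewrite <- sieve_ln_1 in Hr'.
    assert (P := sieve_sum_Re_pos _ (Re b) ltac:(lra) Ha).
    assert (Q := log_deriv_right _ (Re b) ltac:(lra) Ha Hi (Rlt_le _ _ L) ltac:(lra)).
    rewrite (Re_div_real _ _ Hi ltac:(lra)) in Hr'. nra.
Qed.

Lemma CSeries_RtoC (f : nat -> R) : CSeries (fun n => RtoC (f n)) = RtoC (Series f).
Proof.
  unfold CSeries, RtoC; simpl. f_equal.
  transitivity (0 * Series (fun _ : nat => 0)); [|ring].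
  rewrite <- Series_scal_l. apply Series_ext. intros n. unfold Im; simpl. ring.
Qed.

Lemma dirichlet_real (sigma : R) : dirichlet one_coef (RtoC sigma) = RtoC (Series (npow sigma)).
Proof.
  rewrite <- CSeries_RtoC. apply CSeries_ext. intros n. unfold one_coef.
  rewrite zterm_real. ring.
Qed.

Lemma dirichlet_ln_real (sigma : R) : dirichlet_ln one_coef (RtoC sigma) =
  RtoC (Series (fun n => ln (INR n) * npow sigma n)).
Proof.
  rewrite <- CSeries_RtoC. apply CSeries_ext. intros n. unfold one_coef.
  rewrite zterm_real, RtoC_mult. ring.
Qed.

Lemma Series_npow_pos (sigma : R) : 1 < sigma -> 0 < Series (npow sigma).
Proof.
  intros Hs. assert (X := ex_series_npow sigma Hs).
  rewrite (Series_incr_n _ 2) by (lia || exact X). simpl pred. simpl sum_f_R0.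
  change (exp (- (sigma * ln 1))) with (npow sigma 1). rewrite npow_1.
  assert (0 <= Series (fun k => npow sigma (2 + k))); [|lra].
  apply Series_nonneg.
  - intros n. apply npow_ge_0.
  - apply (ex_series_incr_n (npow sigma) 2). exact X.
Qed.

Lemma ratio_h_eq (sigma : R) : 1 < sigma -> ratio_h sigma =
  ln 2 * (npow sigma 2 / (1 - npow sigma 2)) + ln 2 * (npow sigma 2 / (1 + npow sigma 2)).
Proof.
  intros Hs. unfold ratio_h. generalize (npow_le_half sigma 2 Hs ltac:(lia)) (npow_ge_0 sigma 2).
  intros. field. repeat split; nra.
Qed.

(** On the real axis zeta and [F] have the same Euler factors at the odd primes; [ratio_h] is
    exactly the difference at 2. *)
Lemma log_deriv_Psi (sigma : R) : 1 < sigma ->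
  Series (fun n => ln (INR n) * npow sigma n) / Series (npow sigma) = ratio_h sigma + Psi sigma.
Proof.
  intros Hs. set (s := RtoC sigma).
  assert (Ha := cmult_one s). change (Re s) with sigma in Ha.
  assert (A := Series_npow_pos sigma Hs).
  assert (E := is_series_euler _ sigma Hs Ha).
  assert (EX : ex_series (fun k => Re (euler_term (fun n => one_coef n * zterm s n)%C (S (S k)))))
    by (eexists; exact E).
  apply is_series_unique in E. rewrite Series_incr_1 in E by exact EX.
  rewrite sieve_sum_1, sieve_ln_1 in E. unfold s in E. rewrite dirichlet_real, dirichlet_ln_real in E.
  rewrite <- RtoC_div in E by lra. fold s in E.
  assert (RR : forall x : R, Re (RtoC x) = x) by reflexivity. rewrite RR in E.
  rewrite <- E.
  assert (T : forall q, (2 <= q)%nat -> Re (euler_term (fun n => one_coef n * zterm s n)%C q) = odd_term sigma q).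
  { intros q Hq. rewrite Re_euler_term. unfold odd_term. destruct (is_prime q); [|reflexivity].
    f_equal. unfold one_coef, s. rewrite zterm_real.
    assert (H := npow_le_half sigma q Hs Hq).
    replace (1 * npow sigma q)%C with (RtoC (npow sigma q)) by ring.
    rewrite <- RtoC_minus, <- RtoC_div by lra. reflexivity. }
  rewrite T by lia. rewrite (Series_ext _ (fun k => odd_term sigma (S (S (S k))))).
  2: { intros k. apply T. lia. }
  fold (odd_sum sigma). unfold Psi. rewrite ratio_h_eq by exact Hs.
  unfold odd_term. change (is_prime 2) with true. cbv iota. change (INR 2) with 2. ring.
Qed.

Lemma E_equation_iff (sigma : R) : E_equation sigma <-> 1 < sigma /\ Psi sigma = 0.
Proof.
  assert (K : 1 < sigma -> Rpower 2 (sigma + 1) / (Rpower 4 sigma - 1) * ln 2 = ratio_h sigma).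
  { intros Hs. unfold ratio_h, npow. change (INR 2) with 2. unfold Rpower.
    replace 4 with (2 * 2) by ring. rewrite ln_mult by lra.
    replace ((sigma + 1) * ln 2) with (sigma * ln 2 + ln 2) by ring.
    replace (sigma * (ln 2 + ln 2)) with (sigma * ln 2 + sigma * ln 2) by ring.
    rewrite !exp_plus, exp_Ropp, exp_ln by lra.
    assert (H : 1 < exp (sigma * ln 2)).
    { rewrite <- exp_0. apply exp_increasing. generalize ln_2_bounds. nra. }
    field. repeat split; nra. }
  assert (Q : 1 < sigma -> (- (- dirichlet_ln one_coef (RtoC sigma) / zeta (RtoC sigma)))%C =
    RtoC (ratio_h sigma + Psi sigma)).
  { intros Hs. rewrite zeta_dirichlet_series by exact Hs.
    rewrite <- log_deriv_Psi by exact Hs.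
    assert (A := Series_npow_pos sigma Hs).
    rewrite RtoC_div by lra. rewrite dirichlet_real, dirichlet_ln_real. field.
    intros H. apply RtoC_inj in H. lra. }
  split.
  - intros [Hs [d [Hd He]]]. split; [exact Hs|].
    apply is_zeta'_unique in Hd; [|exact Hs]. subst d.
    rewrite Q, K in He by exact Hs. apply RtoC_inj in He. lra.
  - intros [Hs HP]. split; [exact Hs|].
    exists (- dirichlet_ln one_coef (RtoC sigma))%C. split; [now apply is_derive_zeta|].
    rewrite Q, K by exact Hs. f_equal. lra.
Qed.

Lemma continuity_pt_Lipschitz (f : R -> R) (x d K : R) : 0 < d -> 0 <= K ->
  (forall y, Rabs (y - x) < d -> Rabs (f y - f x) <= K * Rabs (y - x)) -> continuity_pt f x.
Proof.
  intros Hd HK H. apply continuity_pt_filterlim. apply filterlim_locally. intros eps.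
  assert (P : 0 < Rmin d (pos eps / (K + 1))).
  { apply Rmin_pos; [exact Hd|]. apply Rdiv_lt_0_compat; [apply eps|lra]. }
  exists (mkposreal _ P). intros y Hy. change (Rabs (y - x) < Rmin d (pos eps / (K + 1))) in Hy.
  change (Rabs (f y - f x) < pos eps).
  assert (H1 : Rabs (y - x) < d) by (eapply Rlt_le_trans; [exact Hy|apply Rmin_l]).
  assert (H2 : Rabs (y - x) < pos eps / (K + 1)) by (eapply Rlt_le_trans; [exact Hy|apply Rmin_r]).
  specialize (H y H1). apply Rmult_lt_compat_r with (r := K + 1) in H2; [|lra].
  unfold Rdiv in H2. rewrite Rmult_assoc, Rinv_l, Rmult_1_r in H2 by lra.
  generalize (Rabs_pos (y - x)). nra.
Qed.

Lemma continuity_pt_of_dirichlet (F : C -> C) (f : R -> R) (K x : R) : 2 < x -> 0 <= K ->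
  (forall s, F (RtoC s) = RtoC (f s)) ->
  (forall s s', 2 <= Re s -> 2 <= Re s' -> Cmod (F s' - F s)%C <= K * Cmod (s' - s)%C) ->
  continuity_pt f x.
Proof.
  intros Hx HK E H. apply (continuity_pt_Lipschitz f x (x - 2) K); [lra|exact HK|].
  intros y Hy. apply Rabs_lt_between in Hy.
  specialize (H (RtoC x) (RtoC y) ltac:(simpl; lra) ltac:(simpl; lra)).
  rewrite !E, <- !RtoC_minus, !Cmod_R in H. exact H.
Qed.

Lemma exists_E : exists E, 2.813014 <= E < 2.813015 /\ Psi E = 0.
Proof.
  set (L := fun s => Series (fun n => ln (INR n) * npow s n)).
  set (A := fun s => Series (npow s)).
  (* [G = - zeta * Psi] has the zeros of [Psi], but its continuity follows from Lipschitz bounds on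
     Dirichlet series. The sign makes it pass from negative to positive. *)
  set (G := fun s => ratio_h s * A s - L s).
  assert (GP : forall s, 1 < s -> G s = - (A s * Psi s)).
  { intros s Hs. unfold G. assert (X := log_deriv_Psi s Hs).
    assert (P := Series_npow_pos s Hs). fold (A s) (L s) in X, P.
    assert (L s = A s * (ratio_h s + Psi s)) by (rewrite <- X; field; lra). lra. }
  assert (GL : forall s, 1 < s -> Series (ln_term s (ratio_h s)) = - G s).
  { intros s Hs. rewrite Series_ln_term by exact Hs. unfold G, A, L. ring. }
  assert (C : forall x, 2.813014 <= x <= 2.813015 -> continuity_pt G x).
  { intros x Hx. unfold G. apply continuity_pt_minus; [apply continuity_pt_mult|].
    - apply continuity_pt_filterlim. apply (ex_derive_continuous ratio_h).
      unfold ratio_h, npow. auto_derive.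
      assert (P := npow_le_half x 2 ltac:(lra) ltac:(lia)). assert (P0 := npow_ge_0 x 2).
      unfold npow in P, P0. change (INR 2) with (1 + 1) in P, P0. nra.
    - apply (continuity_pt_of_dirichlet (dirichlet one_coef) A
        (3 * Series (fun n => ln (INR n) * npow 2 n))); [lra| | |].
      + apply Rmult_le_pos; [lra|]. apply Series_nonneg; [|apply ex_series_ln_npow; lra].
        intros n. apply ln_npow_ge_0.
      + intros s. apply dirichlet_real.
      + intros s s'. apply dirichlet_Lipschitz; [apply unit_bounded_one|lra].
    - apply (continuity_pt_of_dirichlet (dirichlet_ln one_coef) L
        (3 * Series (fun n => ln (INR n) * ln (INR n) * npow 2 n))); [lra| | |].
      + apply Rmult_le_pos; [lra|]. apply Series_nonneg; [|apply ex_series_ln2_npow; lra].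
        intros n. apply Rmult_le_pos; [|apply npow_ge_0]. apply Rle_0_sqr.
      + intros s. apply dirichlet_ln_real.
      + intros s s'. apply dirichlet_ln_Lipschitz; [apply unit_bounded_one|lra]. }
  assert (G1 : G 2.813014 < 0) by (generalize ln_term_sum_pos; rewrite GL by lra; lra).
  assert (G2 : 0 < G 2.813015) by (generalize ln_term_sum_neg; rewrite GL by lra; lra).
  destruct (Ranalysis5.IVT_interv G 2.813014 2.813015 C ltac:(lra) G1 G2) as [E [HE H0]].
  exists E. split.
  - split; [lra|]. destruct (Req_dec E 2.813015) as [->|]; lra.
  - rewrite GP in H0 by lra. assert (P := Series_npow_pos E ltac:(lra)). fold (A E) in P. nra.
Qed.

(** * Simultaneous approximation of a sign character by [n^(it)] *)

Fixpoint lsum (f : nat -> R) (l : list nat) : R :=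
  match l with nil => 0 | x :: l => f x + lsum f l end.

Lemma lsum_app (f : nat -> R) (l l' : list nat) : lsum f (l ++ l') = lsum f l + lsum f l'.
Proof. induction l as [|x l IH]; simpl; [ring|]. rewrite IH. ring. Qed.

Lemma lsum_ext (f g : nat -> R) (l : list nat) : (forall x, In x l -> f x = g x) -> lsum f l = lsum g l.
Proof.
  induction l as [|x l IH]; simpl; intros H; [reflexivity|].
  rewrite H, IH by auto. reflexivity.
Qed.

Lemma lsum_plus (f g : nat -> R) (l : list nat) : lsum (fun x => f x + g x) l = lsum f l + lsum g l.
Proof. induction l as [|x l IH]; simpl; [ring|]. rewrite IH. ring. Qed.

Lemma lsum_scal (c : R) (f : nat -> R) (l : list nat) : lsum (fun x => c * f x) l = c * lsum f l.
Proof. induction l as [|x l IH]; simpl; [ring|]. rewrite IH. ring. Qed.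

Lemma lsum_le (f g : nat -> R) (l : list nat) : (forall x, In x l -> f x <= g x) -> lsum f l <= lsum g l.
Proof.
  induction l as [|x l IH]; simpl; intros H; [lra|].
  apply Rplus_le_compat; [apply H; auto|apply IH; auto].
Qed.

Lemma lsum_const (c : R) (l : list nat) : lsum (fun _ => c) l = INR (length l) * c.
Proof. induction l as [|x l IH]; [simpl; ring|]. simpl lsum. simpl length. rewrite IH, S_INR. ring. Qed.

Lemma lsum_nonneg (f : nat -> R) (l : list nat) : (forall x, In x l -> 0 <= f x) -> 0 <= lsum f l.
Proof. intros H. rewrite <- (Rmult_0_r (INR (length l))), <- (lsum_const 0). now apply lsum_le. Qed.

Lemma lsum_ge_term (f : nat -> R) (l : list nat) (y : nat) : (forall x, In x l -> 0 <= f x) ->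
  In y l -> f y <= lsum f l.
Proof.
  induction l as [|x l IH]; simpl; intros H Hy; [easy|]. destruct Hy as [->|Hy].
  - assert (0 <= lsum f l) by (apply lsum_nonneg; auto). lra.
  - assert (f y <= lsum f l) by (apply IH; auto). assert (0 <= f x) by auto. lra.
Qed.

Lemma lsum_exchange (f : nat -> nat -> R) (l l' : list nat) :
  lsum (fun x => lsum (f x) l') l = lsum (fun y => lsum (fun x => f x y) l) l'.
Proof.
  induction l as [|x l IH]; simpl.
  - rewrite lsum_const. ring.
  - rewrite IH, <- lsum_plus. reflexivity.
Qed.

Lemma is_derive_lsum (f df : nat -> R -> R) (l : list nat) (t : R) :
  (forall x, In x l -> is_derive (f x) t (df x t)) ->
  is_derive (fun t => lsum (fun x => f x t) l) t (lsum (fun x => df x t) l).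
Proof.
  induction l as [|x l IH]; simpl; intros H.
  - apply (is_derive_const (V := R_NormedModule) 0 t).
  - apply (is_derive_plus (V := R_NormedModule) (f x)); auto.
Qed.

Definition ind_eq (x y : nat) : R := if x =? y then 1 else 0.

Lemma lsum_ind_eq (g : nat -> R) (l : list nat) (x : nat) : NoDup l -> In x l ->
  lsum (fun v => ind_eq v x * g v) l = g x.
Proof.
  induction l as [|v l IH]; intros Hd Hx; [destruct Hx|].
  inversion Hd as [|v' l' Hv Hd']; subst. simpl. destruct Hx as [->|Hx].
  - unfold ind_eq at 1. rewrite Nat.eqb_refl.
    rewrite (lsum_ext _ (fun _ => 0)); [rewrite lsum_const; ring|].
    intros y Hy. unfold ind_eq. destruct (Nat.eqb_spec y x) as [->|]; [contradiction|ring].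
  - rewrite IH by assumption. unfold ind_eq.
    destruct (Nat.eqb_spec v x) as [->|]; [contradiction|ring].
Qed.

(** Equals the sum of the squared multiplicities of the values in [l], which is the diagonal part in
    the mean square of [wave_sum]. *)
Definition coincidences (l : list nat) : R := lsum (fun x => lsum (ind_eq x) l) l.

Lemma coincidences_lower (l s : list nat) : (forall x, In x l -> In x s) -> (0 < length s)%nat ->
  INR (length l) * INR (length l) <= coincidences l * INR (length s).
Proof.
  intros Hin Hs. set (v := nodup Nat.eq_dec s).
  assert (Dv : NoDup v) by apply NoDup_nodup.
  assert (Iv : forall x, In x l -> In x v) by (intros x Hx; apply nodup_In; auto).
  assert (Lv : (length v <= length s)%nat).
  { apply NoDup_incl_length; [exact Dv|]. intros x Hx. now apply nodup_In in Hx. }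
  assert (Key : forall g, lsum (fun w => lsum (fun x => ind_eq w x) l * g w) v = lsum g l).
  { intros g. rewrite (lsum_ext _ (fun w => lsum (fun x => ind_eq w x * g w) l)).
    - rewrite lsum_exchange. apply lsum_ext. intros x Hx. now apply lsum_ind_eq; auto.
    - intros w _. rewrite (lsum_ext (fun x => ind_eq w x * g w) (fun x => g w * ind_eq w x)).
      + rewrite lsum_scal. apply Rmult_comm.
      + intros; ring. }
  set (cnt := fun w => lsum (fun x => ind_eq w x) l) in *.
  assert (K1 : lsum (fun w => cnt w * cnt w) v = coincidences l) by apply (Key cnt).
  assert (K2 : lsum cnt v = INR (length l)).
  { rewrite (lsum_ext cnt (fun w => cnt w * 1)) by (intros; ring).
    transitivity (lsum (fun _ => 1) l); [apply (Key (fun _ => 1))|]. rewrite lsum_const. ring. }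
  assert (N0 : 0 <= coincidences l).
  { rewrite <- K1. apply lsum_nonneg. intros. apply Rle_0_sqr. }
  assert (LV : INR (length v) <= INR (length s)) by now apply le_INR.
  destruct (Nat.eq_dec (length v) 0) as [Z|Z].
  { assert (l = nil).
    { destruct l as [|x l]; [reflexivity|]. specialize (Iv x (or_introl eq_refl)).
      destruct v; [destruct Iv|discriminate]. }
    subst l. simpl. assert (0 <= INR (length s)) by apply pos_INR. nra. }
  assert (V0 : 0 < INR (length v)) by (apply lt_0_INR; lia).
  (* The mean multiplicity: nonnegativity of the sum of [(cnt w - k)^2] is the Cauchy-Schwarz
     inequality wanted. *)
  set (k := INR (length l) / INR (length v)).
  assert (Q : 0 <= lsum (fun w => (cnt w * cnt w + (-2 * k) * cnt w) + k * k) v).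
  { apply lsum_nonneg. intros w _. generalize (Rle_0_sqr (cnt w - k)). unfold Rsqr. lra. }
  rewrite !lsum_plus, lsum_scal, K1, K2, lsum_const in Q.
  assert (E : coincidences l + -2 * k * INR (length l) + INR (length v) * (k * k) =
    coincidences l - INR (length l) * INR (length l) / INR (length v)) by (unfold k; field; lra).
  rewrite E in Q.
  assert (INR (length l) * INR (length l) <= coincidences l * INR (length v)).
  { apply Rmult_le_reg_r with (/ INR (length v)); [now apply Rinv_0_lt_compat|].
    rewrite (Rmult_assoc (coincidences l)), Rinv_r by lra. unfold Rdiv in Q. lra. }
  nra.
Qed.

(** * Twisted sums of [n^(it)], their powers and their mean squares *)

Definition wave (chi : nat -> R) (t : R) (x : nat) : C :=
  (chi x * cos (t * ln (INR x)), chi x * sin (t * ln (INR x))).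

Definition wave_sum (chi : nat -> R) (t : R) (l : list nat) : C :=
  (lsum (fun x => Re (wave chi t x)) l, lsum (fun x => Im (wave chi t x)) l).

Definition sign_char (chi : nat -> R) : Prop :=
  (forall m n, (1 <= m)%nat -> (1 <= n)%nat -> chi (m * n)%nat = chi m * chi n) /\
  (forall n, (1 <= n)%nat -> chi n * chi n = 1).

Lemma wave_mult (chi : nat -> R) (t : R) (m n : nat) : sign_char chi ->
  (1 <= m)%nat -> (1 <= n)%nat -> wave chi t (m * n) = (wave chi t m * wave chi t n)%C.
Proof.
  intros [Hc _] Hm Hn. unfold wave. rewrite Hc, mult_INR, ln_mult by (trivial; apply lt_0_INR; lia).
  rewrite Rmult_plus_distr_l, cos_plus, sin_plus.
  apply injective_projections; simpl; ring.
Qed.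

Lemma wave_sum_map_mult (chi : nat -> R) (t : R) (n : nat) (l : list nat) : sign_char chi ->
  (1 <= n)%nat -> (forall x, In x l -> (1 <= x)%nat) ->
  wave_sum chi t (map (Nat.mul n) l) = (wave chi t n * wave_sum chi t l)%C.
Proof.
  intros Hc Hn. induction l as [|x l IH]; intros Hl.
  - apply injective_projections; simpl; ring.
  - assert (E := IH (fun y Hy => Hl y (or_intror Hy))).
    apply (f_equal (fun z => (wave chi t (n * x) + z)%C)) in E.
    rewrite wave_mult in E by (trivial; apply Hl; now left).
    transitivity (wave chi t n * wave chi t x + wave_sum chi t (map (Nat.mul n) l))%C.
    + rewrite <- wave_mult by (trivial; apply Hl; now left). reflexivity.
    + rewrite E. transitivity (wave chi t n * (wave chi t x + wave_sum chi t l))%C; [ring|].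
      reflexivity.
Qed.

(** One entry for each [m]-tuple, repetitions included, so that the wave sum over this list is the
    [m]-th power of that over [1..N]. *)
Fixpoint prods (N m : nat) : list nat :=
  match m with
  | O => 1%nat :: nil
  | S m => flat_map (fun n => map (Nat.mul n) (prods N m)) (seq 1 N)
  end.

Lemma prods_pos (N m x : nat) : In x (prods N m) -> (1 <= x)%nat.
Proof.
  revert x. induction m as [|m IH]; intros x; cbn [prods].
  - intros [<-|[]]. lia.
  - rewrite in_flat_map. intros [n [Hn Hx]]. apply in_map_iff in Hx. destruct Hx as [y [<- Hy]].
    apply in_seq in Hn. specialize (IH y Hy). nia.
Qed.

Lemma wave_sum_app (chi : nat -> R) (t : R) (l l' : list nat) :
  wave_sum chi t (l ++ l') = (wave_sum chi t l + wave_sum chi t l')%C.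
Proof. unfold wave_sum. rewrite !lsum_app. reflexivity. Qed.

Lemma sign_char_1 (chi : nat -> R) : sign_char chi -> chi 1%nat = 1.
Proof.
  intros [H1 H2]. specialize (H1 1%nat 1%nat ltac:(lia) ltac:(lia)).
  specialize (H2 1%nat ltac:(lia)). simpl (1 * 1)%nat in H1. lra.
Qed.

Lemma wave_1 (chi : nat -> R) (t : R) : sign_char chi -> wave chi t 1 = RtoC 1.
Proof.
  intros Hc. unfold wave. rewrite sign_char_1 by exact Hc. simpl INR.
  rewrite ln_1, Rmult_0_r, cos_0, sin_0. apply injective_projections; simpl; ring.
Qed.

Lemma wave_sum_prods (chi : nat -> R) (t : R) (N m : nat) : sign_char chi ->
  wave_sum chi t (prods N m) = (wave_sum chi t (seq 1 N) ^ m)%C.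
Proof.
  intros Hc. induction m as [|m IH].
  - transitivity (wave chi t 1 + RtoC 0)%C; [apply injective_projections; simpl; ring|].
    rewrite wave_1 by exact Hc. simpl. ring.
  - cbn [prods]. simpl Cpow. rewrite <- IH.
    assert (G : forall l, (forall x, In x l -> (1 <= x)%nat) ->
      wave_sum chi t (flat_map (fun n => map (Nat.mul n) (prods N m)) l) =
      (wave_sum chi t l * wave_sum chi t (prods N m))%C).
    { induction l as [|n l IHl]; intros Hl.
      - apply injective_projections; simpl; ring.
      - simpl flat_map. rewrite wave_sum_app, IHl by (intros; apply Hl; now right).
        rewrite wave_sum_map_mult; trivial; [|apply Hl; now left|intros x; apply prods_pos].
        transitivity ((wave chi t n + wave_sum chi t l) * wave_sum chi t (prods N m))%C; [ring|].
        reflexivity. }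
    apply G. intros x Hx. apply in_seq in Hx. lia.
Qed.

Definition wave_prim (chi : nat -> R) (x y : nat) (t : R) : R :=
  chi x * chi y * (if x =? y then t else
    sin (t * (ln (INR x) - ln (INR y))) / (ln (INR x) - ln (INR y))).

Lemma ln_INR_inj (x y : nat) : (1 <= x)%nat -> (1 <= y)%nat -> x <> y -> ln (INR x) - ln (INR y) <> 0.
Proof.
  intros Hx Hy Hn H. apply Hn, INR_eq. apply ln_inv; [apply lt_0_INR; lia|apply lt_0_INR; lia|lra].
Qed.

Lemma is_derive_wave_prim (chi : nat -> R) (x y : nat) (t : R) : (1 <= x)%nat -> (1 <= y)%nat ->
  is_derive (wave_prim chi x y) t (chi x * chi y * cos (t * (ln (INR x) - ln (INR y)))).
Proof.
  intros Hx Hy. unfold wave_prim. destruct (Nat.eqb_spec x y) as [->|N].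
  - rewrite Rminus_diag, Rmult_0_r, cos_0. auto_derive; [trivial|ring].
  - assert (D := ln_INR_inj x y Hx Hy N). auto_derive; [trivial|]. field. exact D.
Qed.

Lemma Cmod_sqr_wave_sum (chi : nat -> R) (t : R) (l : list nat) :
  Cmod (wave_sum chi t l) * Cmod (wave_sum chi t l) =
  lsum (fun x => lsum (fun y => chi x * chi y * cos (t * (ln (INR x) - ln (INR y)))) l) l.
Proof.
  set (p := fun x => Re (wave chi t x)). set (q := fun x => Im (wave chi t x)).
  transitivity (lsum p l * lsum p l + lsum q l * lsum q l); [rewrite Cmod_sqr; reflexivity|].
  symmetry. rewrite (lsum_ext _ (fun x => lsum p l * p x + lsum q l * q x)).
  - rewrite lsum_plus, !lsum_scal. reflexivity.
  - intros x _. rewrite (lsum_ext _ (fun y => p x * p y + q x * q y)).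
    + rewrite lsum_plus, !lsum_scal. f_equal; apply Rmult_comm.
    + intros y _. rewrite Rmult_minus_distr_l, cos_minus.
      unfold p, q, wave, Re, Im; simpl. ring.
Qed.

(* The mean value of [|wave_sum|^2] over [t] is the number of coincidences. *)
Lemma coincidences_upper (chi : nat -> R) (B : R) (l : list nat) : sign_char chi ->
  (forall x, In x l -> (1 <= x)%nat) ->
  (forall t, Cmod (wave_sum chi t l) * Cmod (wave_sum chi t l) <= B) -> coincidences l <= B.
Proof.
  intros Hc Hl HB.
  (* A primitive of the squared modulus, vanishing at 0, so the mean value theorem replaces
     integration. Its diagonal part is [t * coincidences l]; the off-diagonal part is bounded by [K]
     for all [t]. *)
  set (H := fun t => lsum (fun x => lsum (fun y => wave_prim chi x y t) l) l).
  set (K := lsum (fun x => lsum (fun y => if x =? y then 0 else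
    / Rabs (ln (INR x) - ln (INR y))) l) l).
  assert (D : forall t, is_derive H t (Cmod (wave_sum chi t l) * Cmod (wave_sum chi t l))).
  { intros t. rewrite Cmod_sqr_wave_sum. unfold H.
    apply (is_derive_lsum (fun x t => lsum (fun y => wave_prim chi x y t) l)
      (fun x t => lsum (fun y => chi x * chi y * cos (t * (ln (INR x) - ln (INR y)))) l)).
    intros x Hx. apply (is_derive_lsum (fun y t => wave_prim chi x y t)
      (fun y t => chi x * chi y * cos (t * (ln (INR x) - ln (INR y))))).
    intros y Hy. apply is_derive_wave_prim; auto. }
  assert (H0 : H 0 = 0).
  { unfold H. rewrite (lsum_ext _ (fun _ => 0)); [rewrite lsum_const; ring|].
    intros x _. rewrite (lsum_ext _ (fun _ => 0)); [rewrite lsum_const; ring|].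
    intros y _. unfold wave_prim. rewrite Rmult_0_l, sin_0.
    destruct (x =? y); unfold Rdiv; ring. }
  assert (Up : forall t, 0 < t -> H t <= B * t).
  { intros t Ht. destruct (MVT_derive H (fun t => Cmod (wave_sum chi t l) * Cmod (wave_sum chi t l)) 0 t)
      as [c [_ E]]; [exact Ht|intros x _; apply D|].
    rewrite H0, !Rminus_0_r in E. rewrite E. apply Rmult_le_compat_r; [lra|apply HB]. }
  assert (Lo : forall t, t * coincidences l + - K <= H t).
  { intros t. unfold coincidences, K, H.
    rewrite <- (Rmult_1_l (- _)), <- Ropp_mult_distr_r, Ropp_mult_distr_l.
    rewrite <- !lsum_scal, <- lsum_plus. apply lsum_le. intros x Hx.
    rewrite <- !lsum_scal, <- lsum_plus. apply lsum_le. intros y Hy.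
    unfold wave_prim, ind_eq. destruct (Nat.eqb_spec x y) as [->|N].
    - destruct Hc as [_ Hc]. rewrite Hc by auto. lra.
    - assert (Dn := ln_INR_inj x y (Hl x Hx) (Hl y Hy) N).
      set (d := ln (INR x) - ln (INR y)) in *.
      assert (A : Rabs (chi x * chi y * (sin (t * d) / d)) <= / Rabs d).
      { unfold Rdiv. rewrite !Rabs_mult, Rabs_inv.
        assert (O : forall z, In z l -> Rabs (chi z) = 1).
        { intros z Hz. destruct Hc as [_ Hc]. specialize (Hc z (Hl z Hz)).
          assert (S := Rsqr_abs (chi z)). unfold Rsqr in S. generalize (Rabs_pos (chi z)). nra. }
        rewrite !O by assumption. rewrite !Rmult_1_l.
        rewrite <- (Rmult_1_l (/ Rabs d)) at 2. apply Rmult_le_compat_r.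
        - left. apply Rinv_0_lt_compat. now apply Rabs_pos_lt.
        - apply Rabs_le, SIN_bound. }
      apply Rabs_le_between in A. lra. }
  destruct (Rle_lt_dec (coincidences l) B) as [L|L]; [exact L|exfalso].
  set (e := coincidences l - B). assert (He : 0 < e) by (unfold e; lra).
  assert (K0 : 0 <= K).
  { apply lsum_nonneg. intros x Hx. apply lsum_nonneg. intros y Hy.
    destruct (Nat.eqb_spec x y) as [->|N]; [lra|].
    left. apply Rinv_0_lt_compat, Rabs_pos_lt. apply ln_INR_inj; auto. }
  (* At the time [(K + 1) / e] the excess [e] per unit of time outgrows the off-diagonal bound
     [K]. *)
  assert (T : 0 < (K + 1) / e) by (apply Rdiv_lt_0_compat; lra).
  specialize (Up _ T). specialize (Lo ((K + 1) / e)).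
  assert (E : (K + 1) / e * e = K + 1) by (field; lra). unfold e in E at 2.
  rewrite Rmult_minus_distr_l in E. lra.
Qed.

(** It contains every value in [prods N m], since a product depends only on how often each factor
    [1..N] occurs. Its length [(m + 1)^N] is polynomial in [m]. *)
Fixpoint smooth (N m : nat) : list nat :=
  match N with
  | O => 1%nat :: nil
  | S N => flat_map (fun e => map (fun x => x * S N ^ e)%nat (smooth N m)) (seq 0 (S m))
  end.

(** The exponent of the factor [i + 1] is [e i]; hence the index [n - 1] in [prods_smooth]. *)
Fixpoint factored (N : nat) (e : nat -> nat) : nat :=
  match N with O => 1 | S N => factored N e * S N ^ e N end%nat.

Lemma smooth_length (N m : nat) : length (smooth N m) = (S m ^ N)%nat.
Proof.
  induction N as [|N IH]; [reflexivity|].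
  cbn [smooth Nat.pow]. rewrite (flat_map_constant_length (c := (S m ^ N)%nat)).
  - now rewrite length_seq.
  - intros e _. now rewrite length_map.
Qed.

Lemma factored_smooth (N m : nat) (e : nat -> nat) : (forall i, (e i <= m)%nat) ->
  In (factored N e) (smooth N m).
Proof.
  intros He. induction N as [|N IH]; [now left|].
  cbn [smooth factored]. apply in_flat_map. exists (e N). split.
  - apply in_seq. specialize (He N). lia.
  - apply in_map_iff. exists (factored N e). now split.
Qed.

Lemma factored_incr (N j : nat) (e : nat -> nat) :
  factored N (fun i => if i =? j then S (e i) else e i) =
  (if j <? N then S j * factored N e else factored N e)%nat.
Proof.
  induction N as [|N IH]; [reflexivity|].
  cbn [factored]. rewrite IH.
  destruct (Nat.eqb_spec N j) as [->|D].
  - replace (j <? j) with false by (symmetry; apply Nat.ltb_ge; lia).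
    replace (j <? S j) with true by (symmetry; apply Nat.ltb_lt; lia).
    rewrite Nat.pow_succ_r'. ring.
  - destruct (Nat.ltb_spec j N).
    + replace (j <? S N) with true by (symmetry; apply Nat.ltb_lt; lia). ring.
    + replace (j <? S N) with false by (symmetry; apply Nat.ltb_ge; lia). ring.
Qed.

Lemma prods_smooth (N m x : nat) : In x (prods N m) -> In x (smooth N m).
Proof.
  intros H. enough (X : exists e, (forall i, (e i <= m)%nat) /\ x = factored N e).
  { destruct X as [e [He ->]]. now apply factored_smooth. }
  revert x H. induction m as [|m IH]; intros x; cbn [prods].
  - intros [<-|[]]. exists (fun _ => 0%nat). split; [auto|].
    clear. induction N as [|N IH]; [reflexivity|]. cbn [factored]. rewrite <- IH. reflexivity.
  - rewrite in_flat_map. intros [n [Hn Hx]]. apply in_map_iff in Hx. destruct Hx as [y [<- Hy]].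
    apply in_seq in Hn. destruct (IH y Hy) as [e [He ->]].
    exists (fun i => if i =? (n - 1) then S (e i) else e i). split.
    + intros i. specialize (He i). destruct (_ =? _); lia.
    + rewrite factored_incr.
      replace (n - 1 <? N) with true by (symmetry; apply Nat.ltb_lt; lia).
      now replace (S (n - 1)) with n by lia.
Qed.

Lemma prods_length (N m : nat) : length (prods N m) = (N ^ m)%nat.
Proof.
  induction m as [|m IH]; [reflexivity|].
  cbn [prods Nat.pow]. rewrite (flat_map_constant_length (c := (N ^ m)%nat)).
  - now rewrite length_seq.
  - intros e _. now rewrite length_map.
Qed.

(** If all sums were at most [B], comparing the upper and lower bounds for the coincidences in
    [prods N m] would give [(N / B)^(2m) <= (m + 1)^N] for every [m]: exponential growth below a
    polynomial. *)
Lemma wave_sum_large (chi : nat -> R) (N : nat) (B : R) : sign_char chi -> (1 <= N)%nat ->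
  0 < B < INR N -> exists t, B < Cmod (wave_sum chi t (seq 1 N)).
Proof.
  intros Hc HN HB. apply NNPP. intros Hno.
  assert (Hle : forall t, Cmod (wave_sum chi t (seq 1 N)) <= B).
  { intros t. destruct (Rle_lt_dec (Cmod (wave_sum chi t (seq 1 N))) B) as [|L]; [assumption|].
    exfalso. apply Hno. now exists t. }
  assert (M : forall m, INR N ^ m * INR N ^ m <= B ^ m * B ^ m * INR (S m) ^ N).
  { intros m.
    assert (U : coincidences (prods N m) <= B ^ m * B ^ m).
    { apply coincidences_upper with chi; [exact Hc|intros x; apply prods_pos|].
      intros t. rewrite wave_sum_prods by exact Hc. rewrite Cmod_pow.
      assert (0 <= Cmod (wave_sum chi t (seq 1 N)) ^ m <= B ^ m).
      { split; [apply pow_le, Cmod_ge_0|]. apply pow_incr. split; [apply Cmod_ge_0|apply Hle]. }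
      nra. }
    assert (V := coincidences_lower (prods N m) (smooth N m) (prods_smooth N m)).
    rewrite smooth_length, prods_length, !pow_INR in V.
    eapply Rle_trans; [apply V|].
    - generalize (Nat.pow_nonzero (S m) N ltac:(lia)). lia.
    - apply Rmult_le_compat_r; [apply pow_le, pos_INR|exact U]. }
  set (q := (INR N / B) * (INR N / B)).
  assert (Q1 : 1 < INR N / B).
  { apply Rmult_lt_reg_r with B; [lra|]. unfold Rdiv. rewrite Rmult_assoc, Rinv_l by lra. lra. }
  set (eta := q - 1). assert (He : 0 < eta) by (unfold eta, q; nra).
  assert (Mq : forall m, q ^ m <= INR (S m) ^ N).
  { intros m. specialize (M m). assert (0 < B ^ m) by (apply pow_lt; lra).
    unfold q. rewrite !Rpow_mult_distr. unfold Rdiv. rewrite Rpow_mult_distr, pow_inv.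
    apply Rmult_le_reg_r with (B ^ m * B ^ m); [nra|].
    replace (INR N ^ m * / B ^ m * (INR N ^ m * / B ^ m) * (B ^ m * B ^ m)) with
      (INR N ^ m * INR N ^ m) by (field; lra). lra. }
  assert (PN : 0 < INR N) by lra.
  (* With [m = 2 j N] an [N]-th root can be taken, leaving [q^(2j) <= 2 j N + 1]. Bernoulli's
     inequality, squared, gives [q^(2j) >= (1 + j eta)^2], too large once [j eta^2 > 2 N]. *)
  destruct (INR_unbounded (2 * INR N / (eta * eta))) as [j Hj].
  assert (Hj' : 2 * INR N < INR j * (eta * eta)).
  { apply Rmult_lt_compat_r with (r := eta * eta) in Hj; [|nra].
    unfold Rdiv in Hj. rewrite Rmult_assoc, Rinv_l in Hj by nra. lra. }
  specialize (Mq (2 * j * N)%nat). rewrite pow_mult in Mq.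
  assert (Mj : q ^ (2 * j) <= INR (S (2 * j * N))).
  { destruct (Rle_lt_dec (q ^ (2 * j)) (INR (S (2 * j * N)))) as [L|L]; [exact L|exfalso].
    apply Rlt_not_le in Mq; [exact Mq|].
    assert (G : forall a b n, 0 <= a < b -> a ^ S n < b ^ S n).
    { intros a b n Hab. induction n as [|n IH]; [simpl; lra|].
      change (a ^ S (S n)) with (a * a ^ S n). change (b ^ S (S n)) with (b * b ^ S n).
      assert (0 <= a ^ S n) by (apply pow_le; lra).
      apply Rle_lt_trans with (b * a ^ S n); [apply Rmult_le_compat_r; lra|].
      apply Rmult_lt_compat_l; lra. }
    destruct N as [|N']; [lia|]. apply G. split; [apply pos_INR|exact L]. }
  assert (Bj : 1 + INR j * eta <= q ^ j).
  { replace q with (1 + eta) by (unfold eta; ring). apply poly. exact He. }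
  replace (2 * j)%nat with (j + j)%nat in Mj at 1 by lia. rewrite pow_add in Mj.
  rewrite S_INR, !mult_INR in Mj. change (INR 2) with 2 in Mj.
  assert (J0 : 0 <= INR j) by apply pos_INR.
  assert (S1 : (1 + INR j * eta) * (1 + INR j * eta) <= q ^ j * q ^ j).
  { apply Rmult_le_compat; trivial; nra. }
  assert (J1 : 0 < INR j) by nra.
  assert (INR j * (2 * INR N) < INR j * (INR j * (eta * eta))) by (apply Rmult_lt_compat_l; lra).
  nra.
Qed.

(** This is [n^(-it)], whereas [wave] carries [n^(it)]; the distance to a real number is the same
    for both. *)
Definition unit_wave (t : R) (n : nat) : C := (cos (t * ln (INR n)), - sin (t * ln (INR n))).

(** A sum of [N] unit vectors of length nearly [N] forces all of them to point nearly in the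
    direction [(u, v)] of the sum. The term at 1 equals 1, so this direction is nearly 1 and
    [chi n * n^(it)] is nearly 1 for each [n]. *)
Lemma kronecker_sign (chi : nat -> R) (N : nat) (eps : R) : sign_char chi -> 0 < eps ->
  exists t, forall n, (1 <= n <= N)%nat ->
    Cmod (unit_wave t n - RtoC (chi n))%C <= eps.
Proof.
  intros Hc He. destruct (le_lt_dec N 0) as [Z|HN]; [exists 0; intros; lia|].
  assert (N1 : 1 <= INR N) by (apply (le_INR 1); lia).
  (* Each vector, the one at 1 included, lies within squared distance [2 d] of the common direction;
     hence any one lies within squared distance [2 (2 d + 2 d) = 8 d <= eps^2] of 1. *)
  set (d := Rmin (1 / 2) (eps * eps / 8)).
  assert (Hd : 0 < d) by (apply Rmin_pos; nra).
  assert (Hd1 : d <= 1 / 2) by apply Rmin_l. assert (Hd2 : d <= eps * eps / 8) by apply Rmin_r.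
  destruct (wave_sum_large chi N (INR N - d) Hc HN ltac:(lra)) as [t Ht].
  exists t. set (P := wave_sum chi t (seq 1 N)) in *. set (p := Cmod P) in *.
  assert (Pp : 0 < p) by lra.
  set (u := Re P / p). set (v := Im P / p).
  assert (UV : u * u + v * v = 1).
  { assert (S := Cmod_sqr P). fold p in S. unfold u, v.
    replace (Re P / p * (Re P / p) + Im P / p * (Im P / p)) with
      ((Re P * Re P + Im P * Im P) / (p * p)) by (field; lra).
    rewrite <- S. field. lra. }
  set (pr := fun x => u * Re (wave chi t x) + v * Im (wave chi t x)).
  assert (Un : forall x, (1 <= x)%nat ->
    Re (wave chi t x) * Re (wave chi t x) + Im (wave chi t x) * Im (wave chi t x) = 1).
  { intros x Hx. destruct Hc as [_ Hc]. specialize (Hc x Hx). unfold wave, Re, Im; simpl.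
    generalize (sin2_cos2 (t * ln (INR x))). unfold Rsqr. intros H.
    transitivity (chi x * chi x * (sin (t * ln (INR x)) * sin (t * ln (INR x)) +
      cos (t * ln (INR x)) * cos (t * ln (INR x)))); [ring|]. rewrite H, Hc. ring. }
  assert (PS : lsum pr (seq 1 N) = p).
  { unfold pr. rewrite lsum_plus, !lsum_scal.
    change (lsum (fun x => Re (wave chi t x)) (seq 1 N)) with (Re P).
    change (lsum (fun x => Im (wave chi t x)) (seq 1 N)) with (Im P).
    assert (S := Cmod_sqr P). fold p in S. unfold u, v.
    replace (Re P / p * Re P + Im P / p * Im P) with ((Re P * Re P + Im P * Im P) / p) by (field; lra).
    rewrite <- S. field. lra. }
  assert (Q : forall x, (1 <= x <= N)%nat -> 1 - pr x < d).
  { intros x Hx. apply Rle_lt_trans with (lsum (fun x => 1 + - 1 * pr x) (seq 1 N)).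
    - replace (1 - pr x) with (1 + -1 * pr x) by ring.
      apply (lsum_ge_term (fun x => 1 + -1 * pr x)); [|apply in_seq; lia].
      intros y Hy. apply in_seq in Hy. specialize (Un y ltac:(lia)). unfold pr.
      generalize (Rle_0_sqr (u - Re (wave chi t y))) (Rle_0_sqr (v - Im (wave chi t y))).
      unfold Rsqr. lra.
    - rewrite lsum_plus, lsum_const, lsum_scal, PS, length_seq. lra. }
  intros n Hn.
  assert (A := Q 1%nat ltac:(lia)). assert (B := Q n Hn). unfold pr in A, B.
  assert (U1 := Un 1%nat ltac:(lia)). assert (U2 := Un n ltac:(lia)).
  rewrite wave_1 in A, U1 by exact Hc. unfold Re at 1, Im at 1 in A. simpl in A.
  assert (G : (u - Re (wave chi t n)) * (u - Re (wave chi t n)) +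
    (v - Im (wave chi t n)) * (v - Im (wave chi t n)) < 2 * d) by lra.
  assert (G1 : (u - 1) * (u - 1) + v * v < 2 * d) by lra.
  assert (F : (Re (wave chi t n) - 1) * (Re (wave chi t n) - 1) +
    Im (wave chi t n) * Im (wave chi t n) <= 8 * d).
  { set (x := Re (wave chi t n)) in *. set (y := Im (wave chi t n)) in *.
    generalize (Rle_0_sqr ((u - x) + (u - 1))) (Rle_0_sqr ((v - y) + v)). unfold Rsqr. lra. }
  apply Rsqr_incr_0_var; [|lra]. unfold Rsqr. rewrite Cmod_sqr.
  destruct Hc as [_ Hc]. specialize (Hc n ltac:(lia)).
  unfold wave, Re, Im in F. simpl in F. unfold Re, Im; simpl.
  set (c := cos (t * ln (INR n))) in *. set (s := sin (t * ln (INR n))) in *.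
  assert (E : (c + - chi n) * (c + - chi n) + (- s + - 0) * (- s + - 0) =
    (chi n * c - 1) * (chi n * c - 1) + chi n * s * (chi n * s)).
  { assert (E1 : chi n * c * (chi n * c) = c * c)
      by (transitivity (chi n * chi n * (c * c)); [ring|rewrite Hc; ring]).
    assert (E2 : chi n * s * (chi n * s) = s * s)
      by (transitivity (chi n * chi n * (s * s)); [ring|rewrite Hc; ring]).
    lra. }
  rewrite E. lra.
Qed.

(** * Turning points with real part close to [E] *)

Lemma decreasing_zero (f df : R -> R) (a b : R) : a < b ->
  (forall y, is_derive f y (df y)) -> 0 < f a -> f b < 0 -> exists y, a <= y <= b /\ f y = 0.
Proof.
  intros Hab Hd Ha Hb.
  destruct (Ranalysis5.IVT_interv (fun y => - f y) a b) as [y [Hy H]]; try lra.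
  - intros y _. apply continuity_pt_opp, continuity_pt_filterlim.
    apply (ex_derive_continuous f). exists (df y). apply Hd.
  - exists y. split; [exact Hy|lra].
Qed.

(* The rightmost point of [{Z = 0, W <= 0}] in the rectangle is a zero of [W]: if [W < 0]
   there, then [Z x] still changes sign for [x] slightly larger. *)
Lemma vertical_tangent (Z W : R -> R -> R) (K x0 x1 y0 y1 : R) : 0 < K -> x0 < x1 ->
  (forall x x' y y', x0 <= x <= x1 -> x0 <= x' <= x1 ->
    Rabs (Z x' y' - Z x y) <= K * (Rabs (x' - x) + Rabs (y' - y))) ->
  (forall x x' y y', x0 <= x <= x1 -> x0 <= x' <= x1 ->
    Rabs (W x' y' - W x y) <= K * (Rabs (x' - x) + Rabs (y' - y))) ->
  (forall x y, x0 <= x <= x1 -> is_derive (Z x) y (W x y)) ->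
  (exists y, y0 <= y <= y1 /\ Z x0 y = 0 /\ W x0 y <= 0) ->
  (forall y, y0 <= y <= y1 -> Z x1 y = 0 -> 0 < W x1 y) ->
  (forall x, x0 <= x <= x1 -> Z x y0 = 0 -> 0 < W x y0) ->
  (forall x, x0 <= x <= x1 -> Z x y1 = 0 -> 0 < W x y1) ->
  exists x y, x0 <= x <= x1 /\ Z x y = 0 /\ W x y = 0.
Proof.
  intros HK Hx LZ LW HD HS HR HT0 HT1.
  set (X := fun x => x0 <= x <= x1 /\ exists y, y0 <= y <= y1 /\ Z x y = 0 /\ W x y <= 0).
  destruct (completeness X) as [xs [Hub Hlub]].
  { exists x1. intros x [H _]. lra. }
  { exists x0. split; [lra|exact HS]. }
  assert (Hxs : x0 <= xs <= x1).
  { split; [apply Hub; split; [lra|exact HS]|]. apply Hlub. intros x [H _]. lra. }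
  assert (Seq : forall n : nat, exists p : R * R, xs - / INR (S n) < fst p <= xs /\
    x0 <= fst p <= x1 /\ y0 <= snd p <= y1 /\ Z (fst p) (snd p) = 0 /\ W (fst p) (snd p) <= 0).
  { intros n. apply NNPP. intros Hno.
    assert (I : 0 < / INR (S n)) by (apply Rinv_0_lt_compat, lt_0_INR; lia).
    assert (xs <= xs - / INR (S n)); [|lra].
    apply Hlub. intros x Hx'. destruct (Rle_lt_dec x (xs - / INR (S n))) as [L|L]; [exact L|].
    exfalso. apply Hno. assert (x <= xs) by now apply Hub.
    destruct Hx' as [B [y [By [Zy Wy]]]]. exists (x, y). simpl. tauto. }
  set (p := fun n => proj1_sig (constructive_indefinite_description _ (Seq n))).
  assert (Hp : forall n, xs - / INR (S n) < fst (p n) <= xs /\ x0 <= fst (p n) <= x1 /\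
    y0 <= snd (p n) <= y1 /\ Z (fst (p n)) (snd (p n)) = 0 /\ W (fst (p n)) (snd (p n)) <= 0).
  { intros n. apply (proj2_sig (constructive_indefinite_description _ (Seq n))). }
  (* The abscissas converge to the supremum by construction; compactness supplies a limit ordinate,
     so the supremum is attained. *)
  destruct (Bolzano_Weierstrass (fun n => snd (p n)) (fun c => y0 <= c <= y1)) as [ys Hys].
  { apply compact_P3. }
  { intros n. apply Hp. }
  assert (Near : forall e, 0 < e -> exists n, Rabs (fst (p n) - xs) < e /\ Rabs (snd (p n) - ys) < e).
  { intros e He. destruct (INR_unbounded (/ e)) as [N HN].
    destruct (Hys (disc ys (mkposreal e He)) N) as [n [Hn Hd]].
    { exists (mkposreal e He). intros z Hz. exact Hz. }
    exists n. split; [|exact Hd]. destruct (Hp n) as [B _].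
    assert (/ INR (S n) < e).
    { rewrite <- (Rinv_inv e). apply Rinv_lt_contravar.
      - apply Rmult_lt_0_compat; [now apply Rinv_0_lt_compat|apply lt_0_INR; lia].
      - eapply Rlt_le_trans; [exact HN|]. apply le_INR. lia. }
    apply Rabs_def1; lra. }
  assert (By : y0 <= ys <= y1).
  { split; apply Rnot_lt_le; intros H.
    - destruct (Near (y0 - ys) ltac:(lra)) as [n [_ Hn]]. apply Rabs_def2 in Hn.
      destruct (Hp n) as [_ [_ [B _]]]. lra.
    - destruct (Near (ys - y1) ltac:(lra)) as [n [_ Hn]]. apply Rabs_def2 in Hn.
      destruct (Hp n) as [_ [_ [B _]]]. lra. }
  assert (Zs : Z xs ys = 0).
  { apply NNPP. intros H. apply Rabs_pos_lt in H.
    destruct (Near (Rabs (Z xs ys) / (2 * K))) as [n [N1 N2]]; [apply Rdiv_lt_0_compat; lra|].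
    destruct (Hp n) as [_ [B [_ [Zn _]]]].
    generalize (LZ (fst (p n)) xs (snd (p n)) ys B Hxs). rewrite Zn, Rminus_0_r.
    rewrite (Rabs_minus_sym xs), (Rabs_minus_sym ys). intros L.
    assert (K * (Rabs (fst (p n) - xs) + Rabs (snd (p n) - ys)) <
      K * (Rabs (Z xs ys) / (2 * K) + Rabs (Z xs ys) / (2 * K))) by (apply Rmult_lt_compat_l; lra).
    replace (K * (Rabs (Z xs ys) / (2 * K) + Rabs (Z xs ys) / (2 * K))) with (Rabs (Z xs ys)) in H0
      by (field; lra). lra. }
  assert (Ws : W xs ys <= 0).
  { apply Rnot_lt_le. intros H.
    destruct (Near (W xs ys / (2 * K))) as [n [N1 N2]]; [apply Rdiv_lt_0_compat; lra|].
    destruct (Hp n) as [_ [B [_ [_ Wn]]]].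
    generalize (LW (fst (p n)) xs (snd (p n)) ys B Hxs).
    rewrite (Rabs_minus_sym xs), (Rabs_minus_sym ys). intros L.
    assert (K * (Rabs (fst (p n) - xs) + Rabs (snd (p n) - ys)) <
      K * (W xs ys / (2 * K) + W xs ys / (2 * K))) by (apply Rmult_lt_compat_l; lra).
    replace (K * (W xs ys / (2 * K) + W xs ys / (2 * K))) with (W xs ys) in H0
      by (field; lra).
    generalize (Rle_abs (W xs ys - W (fst (p n)) (snd (p n)))). lra. }
  exists xs, ys. split; [exact Hxs|]. split; [exact Zs|].
  destruct Ws as [Ws|Ws]; [exfalso|exact Ws].
  assert (Ex : xs < x1).
  { destruct (Rle_lt_or_eq_dec xs x1) as [L|L]; [lra|exact L|].
    generalize (HR ys By). rewrite <- L. intros H. specialize (H Zs). lra. }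
  assert (Ey0 : y0 < ys).
  { destruct (Rle_lt_or_eq_dec y0 ys) as [L|L]; [lra|exact L|].
    generalize (HT0 xs Hxs). rewrite L. intros H. specialize (H Zs). lra. }
  assert (Ey1 : ys < y1).
  { destruct (Rle_lt_or_eq_dec ys y1) as [L|L]; [lra|exact L|].
    generalize (HT1 xs Hxs). rewrite <- L. intros H. specialize (H Zs). lra. }
  (* On a square of radius [r], cut to the strip, [W] stays at most [- w / 2]. So [Z xs] falls from
     at least [w r / 2] to at most [- w r / 2] between [ys - r] and [ys + r]. *)
  set (w := - W xs ys). assert (Hw : 0 < w) by (unfold w; lra).
  set (r := Rmin (w / (4 * K)) (Rmin (ys - y0) (y1 - ys))).
  assert (Hr : 0 < r).
  { apply Rmin_pos; [apply Rdiv_lt_0_compat; lra|apply Rmin_pos; lra]. }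
  assert (r1 : r <= w / (4 * K)) by apply Rmin_l.
  assert (r2 : r <= ys - y0) by (eapply Rle_trans; [apply Rmin_r|apply Rmin_l]).
  assert (r3 : r <= y1 - ys) by (eapply Rle_trans; [apply Rmin_r|apply Rmin_r]).
  assert (Kr : K * r <= w / 4).
  { apply Rle_trans with (K * (w / (4 * K))); [apply Rmult_le_compat_l; lra|].
    right. field. lra. }
  assert (WN : forall x y, x0 <= x <= x1 -> Rabs (x - xs) <= r -> Rabs (y - ys) <= r -> W x y <= - (w / 2)).
  { intros x y Bx Hx' Hy'. generalize (LW xs x ys y Hxs Bx). intros L.
    assert (K * (Rabs (x - xs) + Rabs (y - ys)) <= K * (r + r)) by (apply Rmult_le_compat_l; lra).
    generalize (Rle_abs (W x y - W xs ys)). unfold w in *. lra. }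
  assert (Zl : w / 2 * r <= Z xs (ys - r)).
  { destruct (MVT_derive (Z xs) (W xs) (ys - r) ys) as [c [Hc E]]; [lra|intros; now apply HD|].
    assert (W xs c <= - (w / 2)).
    { apply WN; [exact Hxs|rewrite Rminus_diag, Rabs_R0; lra|apply Rabs_le; lra]. }
    rewrite Zs in E. nra. }
  assert (Zr : Z xs (ys + r) <= - (w / 2 * r)).
  { destruct (MVT_derive (Z xs) (W xs) ys (ys + r)) as [c [Hc E]]; [lra|intros; now apply HD|].
    assert (W xs c <= - (w / 2)).
    { apply WN; [exact Hxs|rewrite Rminus_diag, Rabs_R0; lra|apply Rabs_le; lra]. }
    rewrite Zs in E. nra. }
  assert (Hwr : 0 < w / 2 * r) by (apply Rmult_lt_0_compat; lra).
  (* Moving right by [h] changes [Z] by at most half of [w r / 2], so the sign change survives and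
     yields a point of [X] beyond the supremum. *)
  set (h := Rmin r (Rmin (x1 - xs) (w / 2 * r / (2 * K)))).
  assert (Hh : 0 < h).
  { apply Rmin_pos; [exact Hr|apply Rmin_pos; [lra|apply Rdiv_lt_0_compat; lra]]. }
  assert (h1 : h <= r) by apply Rmin_l.
  assert (h2 : h <= x1 - xs) by (eapply Rle_trans; [apply Rmin_r|apply Rmin_l]).
  assert (h3 : h <= w / 2 * r / (2 * K)) by (eapply Rle_trans; [apply Rmin_r|apply Rmin_r]).
  assert (Kh : K * h <= w / 2 * r / 2).
  { apply Rle_trans with (K * (w / 2 * r / (2 * K))); [apply Rmult_le_compat_l; lra|].
    right. field. lra. }
  assert (Bh : x0 <= xs + h <= x1) by lra.
  assert (Lh : forall y, Rabs (Z (xs + h) y - Z xs y) <= K * h).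
  { intros y. generalize (LZ xs (xs + h) y y Hxs Bh).
    replace (xs + h - xs) with h by ring. rewrite Rminus_diag, Rabs_R0, (Rabs_pos_eq h) by lra.
    now rewrite Rplus_0_r. }
  destruct (decreasing_zero (Z (xs + h)) (W (xs + h)) (ys - r) (ys + r)) as [y [Hy Zy]].
  - lra.
  - intros y. now apply HD.
  - generalize (Lh (ys - r)). intros L. apply Rabs_le_between in L. lra.
  - generalize (Lh (ys + r)). intros L. apply Rabs_le_between in L. lra.
  - assert (X (xs + h)).
    { split; [exact Bh|]. exists y. split; [lra|]. split; [exact Zy|].
      apply Rle_trans with (- (w / 2)); [|lra]. apply WN; [exact Bh| |apply Rabs_le; lra].
      replace (xs + h - xs) with h by ring. rewrite Rabs_pos_eq; lra. }
    generalize (Hub (xs + h) H). lra.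
Qed.

(** A Cauchy-Riemann relation: along a vertical line the derivative of the imaginary part is the
    real part of the complex derivative [- dirichlet_ln c]. It is read off the complex Taylor
    bound. *)
Lemma is_derive_Im_dirichlet (c : nat -> C) (x y : R) : unit_bounded c -> 1 < x ->
  is_derive (fun y => Im (dirichlet c (x, y))) y (- Re (dirichlet_ln c (x, y))).
Proof.
  intros Hc Hx.
  set (K := 2 * Series (fun n => ln (INR n) * ln (INR n) * npow x n)).
  assert (HK : 0 <= K).
  { apply Rmult_le_pos; [lra|]. apply Series_nonneg; [|now apply ex_series_ln2_npow].
    intros n. apply Rmult_le_pos; [apply Rle_0_sqr|apply npow_ge_0]. }
  split; [apply is_linear_scal_l|].
  intros z Hz. apply (is_filter_lim_locally_unique (V := R_NormedModule)) in Hz. subst z.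
  intros eps.
  assert (Hd : 0 < pos eps / (K + 1)) by (apply Rdiv_lt_0_compat; [apply eps|lra]).
  exists (mkposreal _ Hd). intros z Hz. change (Rabs (z - y) < pos eps / (K + 1)) in Hz.
  change (Rabs (Im (dirichlet c (x, z)) - Im (dirichlet c (x, y)) -
    (z - y) * - Re (dirichlet_ln c (x, y))) <= pos eps * Rabs (z - y)).
  assert (T := dirichlet_Taylor c x Hc Hx (x, y) (x, z) (Rle_refl x) (Rle_refl x)).
  fold K in T.
  assert (M : Cmod ((x, z) - (x, y))%C = Rabs (z - y)).
  { unfold Cmod; simpl. rewrite <- sqrt_Rsqr_abs. f_equal. unfold Rsqr. ring. }
  rewrite M in T.
  assert (I := Im_le_Cmod (dirichlet c (x, z) - dirichlet c (x, y) +
    ((x, z) - (x, y)) * dirichlet_ln c (x, y))%C).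
  replace (Im (dirichlet c (x, z) - dirichlet c (x, y) +
    ((x, z) - (x, y)) * dirichlet_ln c (x, y))%C) with
    (Im (dirichlet c (x, z)) - Im (dirichlet c (x, y)) - (z - y) * - Re (dirichlet_ln c (x, y))) in I.
  2: { destruct (dirichlet c (x, z)), (dirichlet c (x, y)), (dirichlet_ln c (x, y)).
       unfold Re, Im; simpl. ring. }
  eapply Rle_trans; [exact I|]. eapply Rle_trans; [exact T|].
  rewrite <- Rmult_assoc. apply Rmult_le_compat_r; [apply Rabs_pos|].
  apply Rmult_lt_compat_r with (r := K + 1) in Hz; [|lra].
  unfold Rdiv in Hz. rewrite Rmult_assoc, Rinv_l, Rmult_1_r in Hz by lra.
  generalize (Rabs_pos (z - y)). nra.
Qed.

(** * The limit function [F] and its approximation by vertical shifts of zeta *)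

Fixpoint lam_pos (p : positive) : R := match p with xO q => - lam_pos q | _ => 1 end.

(* [(-1) ^ v_2 n] *)
Definition lam (n : nat) : R := lam_pos (Pos.of_nat n).

Lemma lam_pos_mult (p q : positive) : lam_pos (p * q) = lam_pos p * lam_pos q.
Proof.
  revert q. induction p as [p IH|p IH|]; intros q.
  - induction q as [q IHq|q IHq|].
    + simpl. ring.
    + rewrite Pos.mul_xO_r. cbn [lam_pos]. rewrite IHq. cbn [lam_pos]. ring.
    + rewrite Pos.mul_1_r. simpl. ring.
  - change (xO p * q)%positive with (xO (p * q)). cbn [lam_pos]. rewrite IH. ring.
  - rewrite Pos.mul_1_l. simpl. ring.
Qed.

Lemma lam_pos_sqr (p : positive) : lam_pos p * lam_pos p = 1.
Proof. induction p as [p IH|p IH|]; simpl; lra. Qed.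

Lemma sign_char_lam : sign_char lam.
Proof.
  split.
  - intros m n Hm Hn. unfold lam. rewrite Nat2Pos.inj_mul by lia. apply lam_pos_mult.
  - intros n _. apply lam_pos_sqr.
Qed.

Lemma lam_odd (n : nat) : (n mod 2 <> 0)%nat -> lam n = 1.
Proof.
  intros H. unfold lam. destruct (Pos.of_nat n) as [p|p|] eqn:E; [reflexivity| |reflexivity].
  exfalso. destruct n as [|n]; [discriminate|].
  apply (f_equal Pos.to_nat) in E. rewrite Nat2Pos.id in E by lia.
  rewrite Pos2Nat.inj_xO in E. apply H. rewrite E, Nat.mul_comm. apply Nat.Div0.mod_mul.
Qed.

Lemma lam_odd_prime (q : nat) : (3 <= q)%nat -> is_prime q = true -> lam q = 1.
Proof.
  intros Hq H. unfold is_prime in H. apply lam_odd. rewrite rough_spec in H. apply H. lia.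
Qed.

Definition lam_coef (n : nat) : C := RtoC (lam n).

Lemma Cmod_lam (n : nat) : Cmod (lam_coef n) = 1.
Proof.
  unfold lam_coef. rewrite Cmod_R.
  assert (S := Rsqr_abs (lam n)). unfold Rsqr in S. unfold lam in *. rewrite lam_pos_sqr in S.
  generalize (Rabs_pos (lam_pos (Pos.of_nat n))). nra.
Qed.

Lemma unit_bounded_lam : unit_bounded lam_coef.
Proof. intros n. rewrite Cmod_lam. lra. Qed.

Lemma cmult_lam (s : C) : cmult (fun n => lam_coef n * zterm s n)%C (Re s).
Proof.
  destruct sign_char_lam as [HM _]. split.
  - simpl. apply Cmult_0_r.
  - unfold lam_coef. rewrite zterm_1, sign_char_1 by apply sign_char_lam. ring.
  - intros m n. destruct m as [|m]; [simpl; ring|].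
    destruct n as [|n]; [rewrite Nat.mul_0_r; simpl; ring|].
    unfold lam_coef. rewrite HM, zterm_mult, RtoC_mult by lia. ring.
  - intros n. rewrite Cmod_mult, Cmod_lam, Cmod_zterm. ring.
Qed.

Lemma dirichlet_lam_real (sigma : R) : dirichlet lam_coef (RtoC sigma) =
  RtoC (Series (fun n => lam n * npow sigma n)).
Proof.
  rewrite <- CSeries_RtoC. apply CSeries_ext. intros n. unfold lam_coef.
  rewrite zterm_real, RtoC_mult. reflexivity.
Qed.

Lemma log_deriv_lam (sigma : R) : 1 < sigma ->
  Re (dirichlet_ln lam_coef (RtoC sigma) / dirichlet lam_coef (RtoC sigma))%C = Psi sigma.
Proof.
  intros Hs. set (s := RtoC sigma).
  assert (Ha := cmult_lam s). change (Re s) with sigma in Ha.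
  assert (E := is_series_euler _ sigma Hs Ha).
  assert (EX : ex_series (fun k => Re (euler_term (fun n => lam_coef n * zterm s n)%C (S (S k)))))
    by (eexists; exact E).
  apply is_series_unique in E. rewrite Series_incr_1 in E by exact EX.
  rewrite sieve_sum_1, sieve_ln_1 in E. rewrite <- E.
  assert (T : forall k, Re (euler_term (fun n => lam_coef n * zterm s n)%C (S (S (S k)))) =
    odd_term sigma (S (S (S k)))).
  { intros k. set (q := S (S (S k))). assert (Hq : (3 <= q)%nat) by lia.
    rewrite Re_euler_term. unfold odd_term. destruct (is_prime q) eqn:P; [|reflexivity].
    f_equal. unfold lam_coef, s. rewrite lam_odd_prime, zterm_real by assumption.
    assert (H := npow_le_half sigma q Hs ltac:(lia)).
    replace (1 * npow sigma q)%C with (RtoC (npow sigma q)) by ring.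
    rewrite <- RtoC_minus, <- RtoC_div by lra. reflexivity. }
  rewrite (Series_ext _ _ T). fold (odd_sum sigma). unfold Psi.
  rewrite Re_euler_term. change (is_prime 2) with true. cbv iota. change (INR 2) with 2.
  unfold lam_coef, s. rewrite zterm_real. change (lam 2) with (- (1)).
  assert (H := npow_le_half sigma 2 Hs ltac:(lia)). assert (H0 := npow_ge_0 sigma 2).
  rewrite <- RtoC_mult, <- RtoC_minus, <- RtoC_div by lra.
  change (Re (RtoC ?x)) with x. field. lra.
Qed.

Lemma unit_wave_Cexp (t : R) (n : nat) : Cexp (- ((0, t) * RtoC (ln (INR n))))%C = unit_wave t n.
Proof.
  unfold Cexp, unit_wave, Re, Im; simpl fst; simpl snd. set (l := ln (INR n)).
  replace (- (0 * l - t * 0)) with 0 by ring. replace (- (0 * 0 + t * l)) with (- (t * l)) by ring.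
  rewrite exp_0, cos_neg, sin_neg, !Rmult_1_l. reflexivity.
Qed.

Lemma Cmod_unit_wave (t : R) (n : nat) : Cmod (unit_wave t n) = 1.
Proof.
  rewrite <- unit_wave_Cexp, Cmod_Cexp. rewrite <- exp_0. f_equal. unfold Re; simpl. ring.
Qed.

Lemma unit_bounded_wave (t : R) : unit_bounded (unit_wave t).
Proof. intros n. rewrite Cmod_unit_wave. lra. Qed.

Lemma zterm_shift (x y t : R) (n : nat) : zterm (x, y + t) n = (unit_wave t n * zterm (x, y) n)%C.
Proof.
  replace (x, y + t) with ((x, y) + (0, t))%C by (apply injective_projections; simpl; ring).
  rewrite zterm_plus, unit_wave_Cexp. ring.
Qed.

Lemma dirichlet_shift (x y t : R) : dirichlet one_coef (x, y + t) = dirichlet (unit_wave t) (x, y).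
Proof. apply CSeries_ext. intros n. unfold one_coef. rewrite zterm_shift. ring. Qed.

Lemma dirichlet_ln_shift (x y t : R) :
  dirichlet_ln one_coef (x, y + t) = dirichlet_ln (unit_wave t) (x, y).
Proof. apply CSeries_ext. intros n. unfold one_coef. rewrite zterm_shift. ring. Qed.

(** Up to [N] the coefficients are [e]-close, beyond [N] they differ by at most 2. The bound
    involves only the majorant [f], so it is uniform over a half-plane. *)
Lemma CSeries_coef_close (c c' z : nat -> C) (f : nat -> R) (N : nat) (e : R) : 0 <= e ->
  (forall n, 0 <= f n) -> ex_series f -> f 0%nat = 0 -> (forall n, Cmod (z n) <= f n) ->
  unit_bounded c -> unit_bounded c' ->
  (forall n, (1 <= n <= N)%nat -> Cmod (c n - c' n)%C <= e) ->
  Cmod (CSeries (fun n => c n * z n)%C - CSeries (fun n => c' n * z n)%C)%C <=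
  e * Series f + 2 * Series (tail f N).
Proof.
  intros He Hf Xf F0 Hz Hc Hc' Hcl.
  assert (XA : forall d, unit_bounded d -> abs_summable (fun n => d n * z n)%C).
  { intros d Hd. apply abs_summable_le with f; [|exact Xf]. intros n. now apply Cmod_mult_le. }
  rewrite <- CSeries_minus by (now apply XA).
  assert (XT := ex_series_tail f N Hf Xf).
  rewrite <- !Series_scal_l, <- Series_plus by (now apply ex_series_Rscal).
  apply Cmod_CSeries_le.
  - intros n. replace (c n * z n - c' n * z n)%C with ((c n - c' n) * z n)%C by ring.
    rewrite Cmod_mult. specialize (Hz n). specialize (Hf n).
    assert (Z0 := Cmod_ge_0 (z n)). assert (D0 := Cmod_ge_0 (c n - c' n)%C).
    unfold tail. destruct (Nat.leb_spec n N) as [L|L].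
    + destruct n as [|n]; [rewrite F0 in *; nra|].
      specialize (Hcl (S n) ltac:(lia)). nra.
    + assert (Cmod (c n - c' n)%C <= 2).
      { unfold Cminus. eapply Rle_trans; [apply Cmod_triangle|]. rewrite Cmod_opp.
        specialize (Hc n). specialize (Hc' n). lra. }
      nra.
  - apply (ex_series_plus (V := R_NormedModule)); now apply ex_series_Rscal.
Qed.

Lemma exists_shift (eps : R) : 0 < eps -> exists t,
  Cmod (unit_wave t 2 + 1)%C <= eps /\
  forall s, 2.5 <= Re s ->
    Cmod (dirichlet (unit_wave t) s - dirichlet lam_coef s)%C <= eps /\
    Cmod (dirichlet_ln (unit_wave t) s - dirichlet_ln lam_coef s)%C <= eps.
Proof.
  intros He.
  set (f := npow 2.5). set (g := fun n => ln (INR n) * npow 2.5 n).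
  assert (Pf : forall n, 0 <= f n) by apply npow_ge_0.
  assert (Pg : forall n, 0 <= g n).
  { intros n. apply ln_npow_ge_0. }
  assert (Xf : ex_series f) by (apply ex_series_npow; lra).
  assert (Xg : ex_series g) by (apply ex_series_ln_npow; lra).
  assert (Tf := is_lim_seq_Series_tail f Pf Xf). assert (Tg := is_lim_seq_Series_tail g Pg Xg).
  apply is_lim_seq_spec in Tf. apply is_lim_seq_spec in Tg.
  assert (He4 : 0 < eps / 4) by lra.
  destruct (Tf (mkposreal _ He4)) as [N1 HN1]. destruct (Tg (mkposreal _ He4)) as [N2 HN2].
  set (N := (2 + N1 + N2)%nat).
  specialize (HN1 N ltac:(lia)). specialize (HN2 N ltac:(lia)). simpl pos in *.
  rewrite Rminus_0_r in HN1, HN2. apply Rabs_def2 in HN1. apply Rabs_def2 in HN2.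
  assert (Sf := Series_nonneg f Pf Xf). assert (Sg := Series_nonneg g Pg Xg).
  (* The head contributes at most [eps / 2], and twice a tail below [eps / 4] the other half. The
     bound [e <= eps] serves the condition at [n = 2]. *)
  set (e := Rmin eps (eps / (2 * (Series f + Series g + 1)))).
  assert (He0 : 0 < e) by (apply Rmin_pos; [lra|apply Rdiv_lt_0_compat; lra]).
  assert (e1 : e <= eps) by apply Rmin_l.
  assert (e2 : e * (Series f + Series g + 1) <= eps / 2).
  { apply Rle_trans with (eps / (2 * (Series f + Series g + 1)) * (Series f + Series g + 1)).
    - apply Rmult_le_compat_r; [lra|apply Rmin_r].
    - right. field. lra. }
  destruct (kronecker_sign lam N e sign_char_lam He0) as [t Ht]. exists t. split.
  - specialize (Ht 2%nat ltac:(unfold N; lia)). change (lam 2) with (- (1)) in Ht.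
    replace (unit_wave t 2 + 1)%C with (unit_wave t 2 - RtoC (- (1)))%C; [lra|].
    rewrite RtoC_opp. ring.
  - intros s Hs. split.
    + eapply Rle_trans; [apply (CSeries_coef_close (unit_wave t) lam_coef (zterm s) f N e)|]; trivial.
      * lra.
      * intros n. rewrite Cmod_zterm. now apply npow_anti.
      * apply unit_bounded_wave.
      * apply unit_bounded_lam.
      * nra.
    + eapply Rle_trans; [apply (CSeries_coef_close (unit_wave t) lam_coef
        (fun n => RtoC (ln (INR n)) * zterm s n)%C g N e)|]; trivial.
      * lra.
      * unfold g. simpl. ring.
      * intros n. rewrite Cmod_ln_zterm. apply Rmult_le_compat_l; [apply ln_INR_ge_0|].
        now apply npow_anti.
      * apply unit_bounded_wave.
      * apply unit_bounded_lam.
      * nra.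
Qed.

Lemma cmult_wave (t : R) (s : C) : cmult (fun n => unit_wave t n * zterm s n)%C (Re s).
Proof.
  destruct s as [x y]. apply cmult_ext with (zterm (x, y + t)).
  - intros n. apply zterm_shift.
  - apply (cmult_zterm (x, y + t)).
Qed.

Lemma zterm_2 (x y : R) : zterm (x, y) 2 = (RtoC (npow x 2) * unit_wave y 2)%C.
Proof.
  replace (x, y) with (x, 0 + y) by (f_equal; ring). rewrite zterm_shift.
  change (x, 0) with (RtoC x). rewrite zterm_real. ring.
Qed.

Lemma cos_mult_ln_2 (y : R) : -1 <= y <= 1 -> 0.75 <= cos (y * ln 2) <= 1.
Proof.
  intros Hy. generalize (one_minus_cos_bounds (y * ln 2)) ln_2_bounds. intros H1 H2.
  assert (y * y <= 1) by nra. assert (ln 2 * ln 2 <= 0.5) by nra.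
  replace (y * ln 2 * (y * ln 2)) with (y * y * (ln 2 * ln 2)) in H1 by ring.
  assert (0 <= y * y) by nra. assert (0 <= ln 2 * ln 2) by nra. nra.
Qed.

Lemma sin_ln_2_pos : 0 < sin (ln 2).
Proof. generalize ln_2_bounds. intros H. apply sin_gt_0; [lra|]. generalize PI2_3_2 PI_RGT_0. unfold PI2. lra. Qed.

(** At heights 1 and -1 the number [2^(-iy)] is not real, so [dirichlet_ln_left] is strict although
    [Psi E = 0]. The margin [mu] lets the alternative survive small changes of the abscissa and of
    the coefficients. *)
Lemma lam_horizontal (E y : R) : 2.8 <= E -> Psi E = 0 -> y = 1 \/ y = -1 ->
  exists mu, 0 < mu /\ (mu <= Rabs (Im (dirichlet lam_coef (E, y))) \/
    mu <= - Re (dirichlet_ln lam_coef (E, y))).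
Proof.
  intros HE HP Hy. destruct (Req_dec (Im (dirichlet lam_coef (E, y))) 0) as [Z|Z].
  - exists (- Re (dirichlet_ln lam_coef (E, y))). split; [|right; lra].
    enough (Re (dirichlet_ln lam_coef (E, y)) < 0) by lra.
    assert (R0 := npow_pos E 2 ltac:(lia)).
    assert (Hy' : -1 <= y <= 1) by lra. assert (C := cos_mult_ln_2 y Hy').
    assert (EQ : (lam_coef 2 * zterm (E, y) 2)%C =
      (- (npow E 2 * cos (y * ln 2)), npow E 2 * sin (y * ln 2))).
    { unfold lam_coef. change (lam 2) with (- (1)). rewrite zterm_2. unfold unit_wave.
      change (INR 2) with 2. apply injective_projections; simpl; ring. }
    apply dirichlet_ln_left; trivial.
    + apply cmult_lam.
    + unfold Re; simpl. lra.
    + rewrite EQ. unfold Re; cbn [fst]. nra.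
    + right. rewrite EQ. unfold Im; cbn [snd]. generalize sin_ln_2_pos. intros S.
      destruct Hy as [->| ->].
      * rewrite Rmult_1_l. nra.
      * replace (-1 * ln 2) with (- ln 2) by ring. rewrite sin_neg. nra.
  - exists (Rabs (Im (dirichlet lam_coef (E, y)))). split; [now apply Rabs_pos_lt|left; lra].
Qed.

Lemma Rabs_pair_diff (F : C -> C) (K x x' y y' : R) : 0 <= K ->
  Cmod (F (x', y') - F (x, y))%C <= K * Cmod ((x', y') - (x, y))%C ->
  Rabs (Im (F (x', y')) - Im (F (x, y))) <= K * (Rabs (x' - x) + Rabs (y' - y)) /\
  Rabs (Re (F (x', y')) - Re (F (x, y))) <= K * (Rabs (x' - x) + Rabs (y' - y)).
Proof.
  intros HK H.
  assert (B : Cmod ((x', y') - (x, y))%C <= Rabs (x' - x) + Rabs (y' - y))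
    by exact (Cmod_le_Re_Im ((x', y') - (x, y))%C).
  assert (D : Cmod (F (x', y') - F (x, y))%C <= K * (Rabs (x' - x) + Rabs (y' - y))).
  { eapply Rle_trans; [exact H|]. now apply Rmult_le_compat_l. }
  split; (eapply Rle_trans; [|exact D]);
    [rewrite <- Im_le_Cmod|rewrite <- re_le_Cmod]; right; f_equal;
    destruct (F (x', y')), (F (x, y)); reflexivity.
Qed.

Lemma Rabs_Im_Re_diff (z w : C) (e : R) : Cmod (z - w)%C <= e ->
  Rabs (Im z - Im w) <= e /\ Rabs (Re z - Re w) <= e.
Proof.
  intros H. split; (eapply Rle_trans; [|exact H]);
    [rewrite <- Im_le_Cmod|rewrite <- re_le_Cmod]; right; f_equal; destruct z, w; reflexivity.
Qed.

Lemma turning_point_near (E rho : R) : 2.81 <= E -> Psi E = 0 -> 0 < rho ->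
  exists b, turning_point b /\ E - rho <= Re b.
Proof.
  intros HE HP Hrho.
  destruct (lam_horizontal E 1 ltac:(lra) HP (or_introl eq_refl)) as [mu1 [M1 B1]].
  destruct (lam_horizontal E (-1) ltac:(lra) HP (or_intror eq_refl)) as [mu2 [M2 B2]].
  (* One Lipschitz constant for both functions and all unit-bounded coefficients on [Re s >= 2.5];
     the summand 1 makes it positive. *)
  set (K := 3 * Series (fun n => ln (INR n) * npow 2.5 n) +
    3 * Series (fun n => ln (INR n) * ln (INR n) * npow 2.5 n) + 1).
  assert (S1 : 0 <= Series (fun n => ln (INR n) * npow 2.5 n)).
  { apply Series_nonneg; [|apply ex_series_ln_npow; lra].
    intros n. apply ln_npow_ge_0. }
  assert (S2 : 0 <= Series (fun n => ln (INR n) * ln (INR n) * npow 2.5 n)).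
  { apply Series_nonneg; [|apply ex_series_ln2_npow; lra].
    intros n. apply Rmult_le_pos; [apply Rle_0_sqr|apply npow_ge_0]. }
  assert (HK : 0 < K) by (unfold K; lra).
  assert (LZ : forall c x x' y y', unit_bounded c -> 2.5 <= x -> 2.5 <= x' ->
    Rabs (Im (dirichlet c (x', y')) - Im (dirichlet c (x, y))) <= K * (Rabs (x' - x) + Rabs (y' - y))).
  { intros c x x' y y' Hc Hx Hx'. refine (proj1 (Rabs_pair_diff (dirichlet c) K x x' y y' _ _)); [lra|].
    eapply Rle_trans; [apply (dirichlet_Lipschitz c 2.5 Hc); [lra|exact Hx|exact Hx']|].
    apply Rmult_le_compat_r; [apply Cmod_ge_0|unfold K; lra]. }
  assert (LW : forall c x x' y y', unit_bounded c -> 2.5 <= x -> 2.5 <= x' ->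
    Rabs (Re (dirichlet_ln c (x', y')) - Re (dirichlet_ln c (x, y))) <=
    K * (Rabs (x' - x) + Rabs (y' - y))).
  { intros c x x' y y' Hc Hx Hx'. refine (proj2 (Rabs_pair_diff (dirichlet_ln c) K x x' y y' _ _)); [lra|].
    eapply Rle_trans; [apply (dirichlet_ln_Lipschitz c 2.5 Hc); [lra|exact Hx|exact Hx']|].
    apply Rmult_le_compat_r; [apply Cmod_ge_0|unfold K; lra]. }
  set (mu := Rmin mu1 mu2). assert (Mu : 0 < mu) by now apply Rmin_pos.
  assert (Mu1 : mu <= mu1) by apply Rmin_l. assert (Mu2 : mu <= mu2) by apply Rmin_r.
  (* Half the width of the rectangle. The bound 0.1 keeps it in [Re s >= 2.5]; on the horizontal
     sides, moving away from [E] uses up at most [mu / 4] of the margin. *)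
  set (h := Rmin (Rmin rho 0.1) (mu / (4 * K))).
  assert (Hh : 0 < h) by (apply Rmin_pos; [apply Rmin_pos; lra|apply Rdiv_lt_0_compat; lra]).
  assert (h1 : h <= rho) by (eapply Rle_trans; [apply Rmin_l|apply Rmin_l]).
  assert (h2 : h <= 0.1) by (eapply Rle_trans; [apply Rmin_l|apply Rmin_r]).
  assert (h3 : K * h <= mu / 4).
  { apply Rle_trans with (K * (mu / (4 * K))); [apply Rmult_le_compat_l; [lra|apply Rmin_r]|].
    right. field. lra. }
  set (x0 := E - h). set (x1 := E + h).
  (* Left of [E] the twisted function decreases through its zero on the real axis. *)
  assert (P0 : 0 < Psi x0).
  { apply Rnot_le_lt. intros H. generalize (Psi_decr x0 E ltac:(unfold x0; lra) ltac:(unfold x0; lra) H). lra. }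
  set (w := Re (dirichlet_ln lam_coef (x0, 0))).
  assert (F0 : Im (dirichlet lam_coef (x0, 0)) = 0).
  { change (x0, 0) with (RtoC x0). rewrite dirichlet_lam_real. reflexivity. }
  assert (Hw : 0 < w).
  { unfold w. change (x0, 0) with (RtoC x0) in *.
    assert (Q := sieve_sum_Re_pos _ (Re (RtoC x0)) ltac:(unfold Re, x0; simpl; lra) (cmult_lam (RtoC x0))).
    rewrite sieve_sum_1 in Q.
    rewrite (Re_div_real _ _ F0 ltac:(lra)), log_deriv_lam by (unfold x0; lra).
    now apply Rmult_lt_0_compat. }
  (* On the left side, up to height [eta], the derivative of [Im F] stays at most [- 3/4 w], so
     [Im F] changes sign there with room [3/4 w eta]. *)
  set (eta := Rmin 1 (w / (4 * K))).
  assert (Heta : 0 < eta) by (apply Rmin_pos; [lra|apply Rdiv_lt_0_compat; lra]).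
  assert (eta1 : eta <= 1) by apply Rmin_l.
  assert (eta2 : K * eta <= w / 4).
  { apply Rle_trans with (K * (w / (4 * K))); [apply Rmult_le_compat_l; [lra|apply Rmin_r]|].
    right. field. lra. }
  assert (WF : forall y, - eta <= y <= eta -> 3 / 4 * w <= Re (dirichlet_ln lam_coef (x0, y))).
  { intros y Hy. generalize (LW lam_coef x0 x0 0 y unit_bounded_lam ltac:(unfold x0; lra) ltac:(unfold x0; lra)).
    rewrite Rminus_diag, Rabs_R0, Rplus_0_l, Rminus_0_r. fold w. intros L.
    assert (Rabs y <= eta) by (apply Rabs_le; lra).
    assert (K * Rabs y <= K * eta) by (apply Rmult_le_compat_l; lra).
    apply Rabs_le_between in L. lra. }
  assert (DF : forall c y, unit_bounded c -> is_derive (fun y => Im (dirichlet c (x0, y))) y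
    (- Re (dirichlet_ln c (x0, y)))).
  { intros c y Hc. apply is_derive_Im_dirichlet; [exact Hc|unfold x0; lra]. }
  assert (Zl : 3 / 4 * w * eta <= Im (dirichlet lam_coef (x0, - eta))).
  { destruct (MVT_derive (fun y => Im (dirichlet lam_coef (x0, y)))
      (fun y => - Re (dirichlet_ln lam_coef (x0, y))) (- eta) 0) as [c [Hc Eq]]; [lra| |].
    - intros y _. apply DF, unit_bounded_lam.
    - cbv beta in Eq. rewrite F0 in Eq. assert (Q := WF c ltac:(lra)). nra. }
  assert (Zr : Im (dirichlet lam_coef (x0, eta)) <= - (3 / 4 * w * eta)).
  { destruct (MVT_derive (fun y => Im (dirichlet lam_coef (x0, y)))
      (fun y => - Re (dirichlet_ln lam_coef (x0, y))) 0 eta) as [c [Hc Eq]]; [lra| |].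
    - intros y _. apply DF, unit_bounded_lam.
    - cbv beta in Eq. rewrite F0 in Eq. assert (Q := WF c ltac:(lra)). nra. }
  assert (Hwe : 0 < w * eta) by now apply Rmult_lt_0_compat.
  (* In this order: [2^(-it)] stays near -1 for the right side; the margin on the horizontal sides
     is kept; the derivative on the left side stays negative; its sign change of the imaginary part
     is kept. *)
  set (eps := Rmin (Rmin 0.1 (mu / 4)) (Rmin (w / 4) (w * eta / 4))).
  assert (Heps : 0 < eps) by (apply Rmin_pos; apply Rmin_pos; lra).
  assert (ep1 : eps <= 0.1) by (eapply Rle_trans; [apply Rmin_l|apply Rmin_l]).
  assert (ep2 : eps <= mu / 4) by (eapply Rle_trans; [apply Rmin_l|apply Rmin_r]).
  assert (ep3 : eps <= w / 4) by (eapply Rle_trans; [apply Rmin_r|apply Rmin_l]).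
  assert (ep4 : eps <= w * eta / 4) by (eapply Rle_trans; [apply Rmin_r|apply Rmin_r]).
  destruct (exists_shift eps Heps) as [t [T2 Tc]].
  assert (Uw := unit_bounded_wave t).
  assert (CL : forall x y, 2.5 <= x ->
    Rabs (Im (dirichlet (unit_wave t) (x, y)) - Im (dirichlet lam_coef (x, y))) <= eps /\
    Rabs (Re (dirichlet_ln (unit_wave t) (x, y)) - Re (dirichlet_ln lam_coef (x, y))) <= eps).
  { intros x y Hx. destruct (Tc (x, y) Hx) as [C1 C2]. split.
    - now apply Rabs_Im_Re_diff.
    - now apply Rabs_Im_Re_diff. }
  assert (Hor : forall y m, mu <= m -> (m <= Rabs (Im (dirichlet lam_coef (E, y))) \/
      m <= - Re (dirichlet_ln lam_coef (E, y))) ->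
    forall x, x0 <= x <= x1 -> Im (dirichlet (unit_wave t) (x, y)) = 0 ->
    0 < - Re (dirichlet_ln (unit_wave t) (x, y))).
  { intros y m Hm B x Hx Hz.
    assert (Hx' : 2.5 <= x) by (unfold x0 in Hx; lra).
    destruct (CL x y Hx') as [C1 C2].
    assert (L1 := LZ lam_coef E x y y unit_bounded_lam ltac:(lra) Hx').
    assert (L2 := LW lam_coef E x y y unit_bounded_lam ltac:(lra) Hx').
    rewrite Rminus_diag, Rabs_R0, Rplus_0_r in L1, L2.
    assert (Rabs (x - E) <= h) by (apply Rabs_le; unfold x0, x1 in Hx; lra).
    assert (K * Rabs (x - E) <= K * h) by (apply Rmult_le_compat_l; lra).
    rewrite Hz in C1. destruct B as [B|B].
    - exfalso. rewrite Rminus_0_l, Rabs_Ropp in C1.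
      generalize (Rabs_triang (Im (dirichlet lam_coef (E, y)) - Im (dirichlet lam_coef (x, y)))
        (Im (dirichlet lam_coef (x, y)))).
      replace (Im (dirichlet lam_coef (E, y)) - Im (dirichlet lam_coef (x, y)) +
        Im (dirichlet lam_coef (x, y))) with (Im (dirichlet lam_coef (E, y))) by ring.
      rewrite Rabs_minus_sym in L1. lra.
    - apply Rabs_le_between in C2. apply Rabs_le_between in L2. lra. }
  destruct (vertical_tangent (fun x y => Im (dirichlet (unit_wave t) (x, y)))
    (fun x y => - Re (dirichlet_ln (unit_wave t) (x, y))) K x0 x1 (-1) 1) as [x [y [Bx [Hz Hr]]]].
  - exact HK.
  - unfold x0, x1. lra.
  - intros x x' y y' Hx Hx'. apply LZ; [exact Uw| |]; unfold x0 in *; lra.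
  - intros x x' y y' Hx Hx'.
    replace (- Re (dirichlet_ln (unit_wave t) (x', y')) - - Re (dirichlet_ln (unit_wave t) (x, y)))
      with (- (Re (dirichlet_ln (unit_wave t) (x', y')) - Re (dirichlet_ln (unit_wave t) (x, y)))) by ring.
    rewrite Rabs_Ropp. apply LW; [exact Uw| |]; unfold x0 in *; lra.
  - intros x y Hx. apply is_derive_Im_dirichlet; [exact Uw|unfold x0 in *; lra].
  - destruct (decreasing_zero (fun y => Im (dirichlet (unit_wave t) (x0, y)))
      (fun y => - Re (dirichlet_ln (unit_wave t) (x0, y))) (- eta) eta) as [y [Hy Hz]].
    + lra.
    + intros y. now apply DF.
    + destruct (CL x0 (- eta) ltac:(unfold x0; lra)) as [C1 _]. apply Rabs_le_between in C1. lra.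
    + destruct (CL x0 eta ltac:(unfold x0; lra)) as [C1 _]. apply Rabs_le_between in C1. lra.
    + exists y. split; [lra|]. split; [exact Hz|].
      destruct (CL x0 y ltac:(unfold x0; lra)) as [_ C2]. apply Rabs_le_between in C2.
      assert (Q := WF y Hy). lra.
  - intros y Hy Hz. cbv beta in *.
    enough (Re (dirichlet_ln (unit_wave t) (x1, y)) < 0) by lra.
    assert (PX : Psi x1 < 0) by (apply (Psi_decr E); unfold x1; lra).
    apply dirichlet_ln_left; trivial.
    + apply cmult_wave.
    + unfold Re, x1; simpl. lra.
    + unfold Re; simpl. lra.
    + assert (R0 := npow_pos x1 2 ltac:(lia)).
      destruct (Rabs_Im_Re_diff (unit_wave t 2) (- (1))%C eps) as [A1 A2].
      { replace (unit_wave t 2 - - (1))%C with (unit_wave t 2 + 1)%C by ring. exact T2. }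
      unfold unit_wave, Re, Im in A1, A2. simpl in A1, A2.
      change (1 + 1) with 2 in A1, A2.
      replace (Re (unit_wave t 2 * zterm (x1, y) 2)%C) with (npow x1 2 *
        (cos (t * ln 2) * cos (y * ln 2) - sin (t * ln 2) * sin (y * ln 2))).
      2: { rewrite zterm_2. unfold unit_wave, Re. change (INR 2) with 2.
           generalize (npow x1 2). intros r. simpl. ring. }
      assert (C := cos_mult_ln_2 y Hy).
      generalize (SIN_bound (y * ln 2)). intros SB.
      set (cy := cos (y * ln 2)) in *. set (sy := sin (y * ln 2)) in *.
      set (ct := cos (t * ln 2)) in *. set (st := sin (t * ln 2)) in *.
      set (r := npow x1 2) in *.
      apply Rabs_le_between in A1. apply Rabs_le_between in A2.
      (* Here [ct <= -0.9], [|st| <= 0.1] and [cy >= 0.75]: for [|y| <= 1] the shifted [2^(-s)]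
         stays in the left half-plane, as [dirichlet_ln_left] requires. *)
      assert (N : ct * cy - st * sy <= 0) by nra.
      nra.
    + now left.
  - intros x Hx. apply (Hor (-1) mu2 Mu2 B2 x Hx).
  - intros x Hx. apply (Hor 1 mu1 Mu1 B1 x Hx).
  (* Twisting the coefficients by [n^(-it)] is a vertical shift, so the point found for the twisted
     series is a turning point of zeta at height [y + t]. *)
  - cbv beta in *. exists (x, y + t).
    assert (Hx : 1 < Re (x, y + t)) by (unfold Re; simpl; unfold x0 in Bx; lra).
    split; [|unfold Re; simpl; unfold x0 in Bx; lra].
    split; [intros H; apply (f_equal Re) in H; rewrite H in Hx; unfold Re in Hx; simpl in Hx; lra|].
    split; [rewrite zeta_dirichlet_series, dirichlet_shift by exact Hx; exact Hz|].
    exists (Copp (dirichlet_ln one_coef (x, y + t))). split; [now apply is_derive_zeta|].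
    rewrite dirichlet_ln_shift. destruct (dirichlet_ln (unit_wave t) (x, y)).
    unfold Re in *; simpl in *. exact Hr.
Qed.

Theorem theorem9p1 :
  exists E : R,
    unique E_equation E /\
    2.813014 <= E < 2.813015 /\
    (forall b : C, turning_point b -> Re b <= E) /\
    (exists b : nat -> C,
       (forall k : nat, turning_point (b k)) /\
       is_lim_seq (fun k : nat => Re (b k)) (Finite E)).
Proof.
  destruct exists_E as [E [HE HP]]. exists E.
  assert (UB : forall b, turning_point b -> Re b <= E).
  { intros b. apply turning_point_bound; [lra|exact HP]. }
  split; [|split; [exact HE|split; [exact UB|]]].
  - split.
    + apply E_equation_iff. split; [lra|exact HP].
    + intros E' H'. apply E_equation_iff in H'. destruct H' as [H1 H2].
      destruct (Rtotal_order E E') as [L|[L|L]]; [|exact L|].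
      * generalize (Psi_decr E E' ltac:(lra) L ltac:(lra)). lra.
      * generalize (Psi_decr E' E H1 L ltac:(lra)). lra.
  - assert (X : forall k : nat, exists b, turning_point b /\ E - / INR (S k) <= Re b).
    { intros k. apply turning_point_near; [lra|exact HP|].
      apply Rinv_0_lt_compat, lt_0_INR. lia. }
    set (b := fun k => proj1_sig (constructive_indefinite_description _ (X k))).
    assert (Hb : forall k, turning_point (b k) /\ E - / INR (S k) <= Re (b k)).
    { intros k. apply (proj2_sig (constructive_indefinite_description _ (X k))). }
    exists b. split; [apply Hb|].
    apply is_lim_seq_le_le with (u := fun k => E - / INR (S k)) (w := fun _ => E).
    + intros k. split; [apply Hb|apply UB, Hb].
    + rewrite <- (Rminus_0_r E) at 1. apply is_lim_seq_minus'; [apply is_lim_seq_const|].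
      apply (is_lim_seq_incr_1 (fun k => / INR k)).
      apply (is_lim_seq_inv INR p_infty); [apply is_lim_seq_INR|discriminate].
    + apply is_lim_seq_const.
Qed.
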